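(* The Lie group $E_{7,\mathbb{R}}$ is isomorphic to the Lie group $Sp(3)$: $E_{7,\mathbb{R}}\cong Sp(3)$.
   Context: $Sp(3)=\{A\in M(3,\mathbb{H})\mid AA^*=E\}$ is the compact symplectic group of $3\times 3$ quaternionic matrices. Let $(\mathfrak{J}_{\mathbb{R}})^{\mathbb{C}}$ be the space of symmetric $3\times3$ complex matrices with $X\circ Y=\frac12(XY+YX)$, $(X,Y)=\mathrm{tr}(X\circ Y)$, and $X\times Y=\frac12\bigl(2X\circ Y-\mathrm{tr}(X)Y-\mathrm{tr}(Y)X+(\mathrm{tr}(X)\mathrm{tr}(Y)-(X,Y))E\bigr)$; $\tau$ denotes complex conjugation and $\langle X,Y\rangle=(\tau X,Y)$. Let $(\mathfrak{e}_{6,\mathbb{R}})^{\mathbb{C}}=\{\phi\in\mathrm{Hom}_{\mathbb{C}}((\mathfrak{J}_{\mathbb{R}})^{\mathbb{C}})\mid(\phi X,X\times X)=0\ \forall X\}$ ($\mathrm{Hom}_{\mathbb{C}}(V)$ denotes $\mathbb{C}$-linear endomorphisms of $V$); ${}^t\phi$ is the transpose with respect to $(X,Y)$. For $X\in(\mathfrak{J}_{\mathbb{R}})^{\mathbb{C}}$ let $\tilde X Z=X\circ Z$, and set $X\vee W=[\tilde X,\tilde W]+(X\circ W-\frac13(X,W)E)^{\sim}\in(\mathfrak{e}_{6,\mathbb{R}})^{\mathbb{C}}$. Let $(\mathfrak{P}_{\mathbb{R}})^{\mathbb{C}}=(\mathfrak{J}_{\mathbb{R}})^{\mathbb{C}}\oplus(\mathfrak{J}_{\mathbb{R}})^{\mathbb{C}}\oplus\mathbb{C}\oplus\mathbb{C}$.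 For $\phi\in(\mathfrak{e}_{6,\mathbb{R}})^{\mathbb{C}}$, $A,B\in(\mathfrak{J}_{\mathbb{R}})^{\mathbb{C}}$, $\nu\in\mathbb{C}$, define the linear map $\Phi(\phi,A,B,\nu)$ of $(\mathfrak{P}_{\mathbb{R}})^{\mathbb{C}}$ by $\Phi(\phi,A,B,\nu)(X,Y,\xi,\eta)=(\phi X-\frac13\nu X+2B\times Y+\eta A,\ 2A\times X-{}^t\phi Y+\frac13\nu Y+\xi B,\ (A,Y)+\nu\xi,\ (B,X)-\nu\eta)$. For $P=(X,Y,\xi,\eta)$, $Q=(Z,W,\zeta,\omega)$ define $P\times Q=\Phi(\phi,A,B,\nu)$ with $\phi=-\frac12(X\vee W+Z\vee Y)$, $A=-\frac14(2Y\times W-\xi Z-\zeta X)$, $B=\frac14(2X\times Z-\eta W-\omega Y)$, $\nu=\frac18((X,W)+(Z,Y)-3(\xi\omega+\zeta\eta))$; and the Hermitian inner product $\langle P,Q\rangle=\langle X,Z\rangle+\langle Y,W\rangle+(\tau\xi)\zeta+(\tau\eta)\omega$. Define $E_{7,\mathbb{R}}=\{\alpha\in\mathrm{Iso}_{\mathbb{C}}((\mathfrak{P}_{\mathbb{R}})^{\mathbb{C}})\mid\alpha(P\times Q)\alpha^{-1}=\alpha P\times\alpha Q,\ \langle\alpha P,\alpha Q\rangle=\langle P,Q\rangle\ \forall P,Q\}$, where $\mathrm{Iso}_{\mathbb{C}}(V)$ is the group of $\mathbb{C}$-linear automorphisms of $V$. *)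

(* Defs.v *)
From HB Require Import structures.
From mathcomp Require Import all_boot all_order all_algebra.
From mathcomp Require Import all_classical all_reals all_analysis.
From mathcomp Require Import complex.
From mathcomp Require Import ring.

Set Implicit Arguments.
Unset Strict Implicit.
Unset Printing Implicit Defensive.
Import Order.TTheory GRing.Theory Num.Theory.
Import numFieldNormedType.Exports.

Local Open Scope classical_set_scope.
Local Open Scope ring_scope.

Record quat (R : Type) := Quat { q1 : R; qi : R; qj : R; qk : R }.

Section Quaternions.
Variable R : comNzRingType.
Implicit Types a b c : quat R.

Definition quat_tuple a := (q1 a, qi a, qj a, qk a).
Definition tuple_quat (t : R * R * R * R) :=
  let: (x, y, z, w) := t in Quat x y z w.
Lemma quat_tupleK : cancel quat_tuple tuple_quat.
Proof. by case. Qed.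

HB.instance Definition _ := Choice.copy (quat R) (can_type quat_tupleK).

Definition quat_add a b :=
  Quat (q1 a + q1 b) (qi a + qi b) (qj a + qj b) (qk a + qk b).
Definition quat_opp a := Quat (- q1 a) (- qi a) (- qj a) (- qk a).
Definition quat_mul a b :=
  Quat (q1 a * q1 b - qi a * qi b - qj a * qj b - qk a * qk b)
       (q1 a * qi b + qi a * q1 b + qj a * qk b - qk a * qj b)
       (q1 a * qj b - qi a * qk b + qj a * q1 b + qk a * qi b)
       (q1 a * qk b + qi a * qj b - qj a * qi b + qk a * q1 b).

Definition quat_conj a := Quat (q1 a) (- qi a) (- qj a) (- qk a).

Fact quat_addA : associative quat_add.
Proof. by move=> [????] [????] [????]; congr Quat => /=; ring. Qed.
Fact quat_addC : commutative quat_add.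
Proof. by move=> [????] [????]; congr Quat => /=; ring. Qed.
Fact quat_add0 : left_id (Quat 0 0 0 0) quat_add.
Proof. by move=> [????]; congr Quat => /=; ring. Qed.
Fact quat_addN : left_inverse (Quat 0 0 0 0) quat_opp quat_add.
Proof. by move=> [????]; congr Quat => /=; ring. Qed.

HB.instance Definition _ := GRing.isZmodule.Build (quat R)
  quat_addA quat_addC quat_add0 quat_addN.

Fact quat_mulA : associative quat_mul.
Proof. by move=> [????] [????] [????]; congr Quat => /=; ring. Qed.
Fact quat_mul1 : left_id (Quat 1 0 0 0) quat_mul.
Proof. by move=> [????]; congr Quat => /=; ring. Qed.
Fact quat_mulr1 : right_id (Quat 1 0 0 0) quat_mul.
Proof. by move=> [????]; congr Quat => /=; ring. Qed.
Fact quat_mulDl : left_distributive quat_mul +%R.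
Proof. by move=> [????] [????] [????]; congr Quat => /=; ring. Qed.
Fact quat_mulDr : right_distributive quat_mul +%R.
Proof. by move=> [????] [????] [????]; congr Quat => /=; ring. Qed.
Fact quat_1neq0 : Quat 1 0 0 0 != 0 :> quat R.
Proof. by apply/eqP => -[/eqP]; rewrite oner_eq0. Qed.

HB.instance Definition _ := GRing.Zmodule_isNzRing.Build (quat R)
  quat_mulA quat_mul1 quat_mulr1 quat_mulDl quat_mulDr quat_1neq0.

Lemma quat_conj_is_additive : zmod_morphism quat_conj.
Proof. by move=> [????] [????]; congr Quat => /=; ring. Qed.
HB.instance Definition _ :=
  GRing.isZmodMorphism.Build (quat R) (quat R) quat_conj quat_conj_is_additive.

Lemma quat_conjM a b : quat_conj (a * b) = quat_conj b * quat_conj a.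
Proof. by case: a => ????; case: b => ????; congr Quat => /=; ring. Qed.

Definition quat_adj m n (A : 'M[quat R]_(m, n)) : 'M[quat R]_(n, m) :=
  map_mx quat_conj A^T.

Lemma quat_adjM m n p (A : 'M[quat R]_(m, n)) (B : 'M[quat R]_(n, p)) :
  quat_adj (A *m B) = quat_adj B *m quat_adj A.
Proof.
apply/matrixP => i j; rewrite !mxE raddf_sum; apply: eq_bigr => k _.
by rewrite !mxE; exact: quat_conjM.
Qed.

End Quaternions.

Section Sp3.
Variable R : realType.

Definition Sp3 : set 'M[quat R]_3 := [set A | A *m quat_adj A = 1%:M].

Lemma Sp3_1 : Sp3 1%:M.
Proof.
rewrite /Sp3 /= mul1mx; apply/matrixP => i j; rewrite !mxE eq_sym.
by case: (i == j); congr Quat; rewrite oppr0.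
Qed.

Lemma Sp3_mul A B : Sp3 A -> Sp3 B -> Sp3 (A *m B).
Proof.
by rewrite /Sp3 /= => hA hB; rewrite quat_adjM mulmxA -(mulmxA A) hB mulmx1.
Qed.

Definition quat_normsq (x : quat R) : R :=
  q1 x ^+ 2 + qi x ^+ 2 + qj x ^+ 2 + qk x ^+ 2.

Fact quat_normsq_eq0 x : quat_normsq x = 0 -> x = 0.
Proof.
case: x => a b c d /eqP; rewrite /quat_normsq /=.
rewrite !paddr_eq0 ?addr_ge0 ?sqr_ge0 // !sqrf_eq0.
by move=> /andP[/andP[/andP[/eqP-> /eqP->] /eqP->] /eqP->].
Qed.

Fact q1_sum (I : finType) (F : I -> quat R) :
  q1 (\sum_i F i) = \sum_i q1 (F i).
Proof. by apply: (big_morph (@q1 R)). Qed.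

Fact quat_normsq_mx (M : 'M[quat R]_3) :
  \sum_i q1 ((M *m quat_adj M) i i) = \sum_i \sum_j quat_normsq (M i j).
Proof.
apply: eq_bigr => i _; rewrite mxE q1_sum; apply: eq_bigr => j _.
by rewrite !mxE; case: (M i j) => ????; rewrite /quat_normsq /=; ring.
Qed.

Fact quat_adjK m n (M : 'M[quat R]_(m, n)) : quat_adj (quat_adj M) = M.
Proof.
by apply/matrixP => i j; rewrite !mxE; case: (M i j) => ????;
  rewrite /quat_conj /= !opprK.
Qed.

Lemma Sp3_inv A : Sp3 A -> Sp3 (quat_adj A).
Proof.
rewrite /Sp3 /= quat_adjK => hA.
pose N := quat_adj A *m A; pose K := 1%:M - N.
have NN : N *m N = N by rewrite /N mulmxA -(mulmxA _ A) hA mulmx1.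
have adjN : quat_adj N = N by rewrite /N quat_adjM quat_adjK.
have adjK : quat_adj K = K.
  rewrite -[RHS]/(1%:M - N) -[in RHS]adjN; apply/matrixP => i j.
  rewrite !mxE raddfB; congr (_ - _); rewrite eq_sym.
  by case: (i == j); congr Quat; rewrite oppr0.
have KK : K *m K = K.
  by rewrite {1}/K mulmxBl mul1mx {2}/K mulmxBr mulmx1 NN subrr subr0.
have q1B (x y : quat R) : q1 (x - y) = q1 x - q1 y by [].
have trN : \sum_i q1 (N i i) = \sum_i q1 ((1%:M : 'M[quat R]_3) i i).
  rewrite /N -{2}[A]quat_adjK quat_normsq_mx -hA quat_normsq_mx exchange_big.
  apply: eq_bigr => i _; apply: eq_bigr => j _; rewrite !mxE.
  by rewrite /quat_normsq /= !sqrrN.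
have K0 : \sum_i \sum_j quat_normsq (K i j) = 0.
  rewrite -quat_normsq_mx adjK KK /K.
  under eq_bigr => i _ do rewrite mxE [X in _ + X]mxE q1B.
  by rewrite big_split /= sumrN trN subrr.
have nn x : 0 <= quat_normsq x by rewrite /quat_normsq !addr_ge0 ?sqr_ge0.
suff /eqP : K = 0 by rewrite subr_eq0 => /eqP.
apply/matrixP => i j; rewrite [RHS]mxE; apply: quat_normsq_eq0.
move/eqP: K0; rewrite psumr_eq0; last by move=> *; apply: sumr_ge0.
move=> /allP/(_ i (mem_index_enum _)) /=; rewrite psumr_eq0 //.
by move=> /allP/(_ j (mem_index_enum _)) /eqP.
Qed.

End Sp3.

Section Jordan.
Variable R : realType.
Local Notation C := R[i].

Definition symv : {vspace 'M[C]_3} := lker (linfun (@trmx C 3 3) - \1)%VF.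

Lemma symvP (A : 'M[C]_3) : reflect (A^T = A) (A \in symv).
Proof.
rewrite memv_ker add_lfunE opp_lfunE id_lfunE lfunE subr_eq0.
exact: eqP.
Qed.

Definition jordan := subvs_of symv.
HB.instance Definition _ := Vector.on jordan.
Implicit Types X Y Z W : jordan.

Lemma jordan_tr X : (vsval X)^T = vsval X.
Proof. exact/symvP/subvsP. Qed.

Fact jid_subproof : (1%:M : 'M[C]_3) \in symv.
Proof. by apply/symvP; rewrite trmx1. Qed.
Definition jid : jordan := Subvs jid_subproof.

Fact jprod_subproof X Y :
  2^-1 *: (vsval X *m vsval Y + vsval Y *m vsval X) \in symv.
Proof.
by apply/symvP; rewrite linearZ linearD /= !trmx_mul !jordan_tr addrC.
Qed.
Definition jprod X Y : jordan := Subvs (jprod_subproof X Y).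

Definition jtr X : C := \tr (vsval X).

Definition jform X Y : C := jtr (jprod X Y).

Definition jcross X Y : jordan :=
  2^-1 *: (2 *: jprod X Y - jtr X *: Y - jtr Y *: X
           + (jtr X * jtr Y - jform X Y) *: jid).

Fact jconj_subproof X : map_mx (@conjc R) (vsval X) \in symv.
Proof.
apply/symvP; apply/matrixP => i j.
by rewrite !mxE -[in LHS](jordan_tr X) mxE.
Qed.
Definition jconj X : jordan := Subvs (jconj_subproof X).

Definition jherm X Y : C := jform (jconj X) Y.

Lemma vsval_jid : vsval jid = 1%:M.
Proof. by []. Qed.

Lemma vsval_jprod X Y :
  vsval (jprod X Y) = 2^-1 *: (vsval X *m vsval Y + vsval Y *m vsval X).
Proof. by []. Qed.

Fact jprod_is_linear X : linear (jprod X).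
Proof.
move=> a Y Z; apply: subvs_inj.
have lv U V : vsval (a *: U + V : jordan) = a *: vsval U + vsval V.
  exact: linearP.
rewrite lv !vsval_jprod lv.
rewrite mulmxDl mulmxDr -scalemxAl -scalemxAr addrACA -scalerDr.
by rewrite [LHS]scalerDr !scalerA (mulrC a).
Qed.
HB.instance Definition _ X :=
  GRing.isLinear.Build C jordan jordan *:%R (jprod X) (jprod_is_linear X).

Definition jmul X : 'End(jordan) := linfun (jprod X).

Definition vee X W : 'End(jordan) :=
  (jmul X \o jmul W)%VF - (jmul W \o jmul X)%VF
  + jmul (jprod X W - (3^-1 * jform X W) *: jid).

Definition e6R : set 'End(jordan) :=
  [set phi | forall X, jform (phi X) (jcross X X) = 0].

Fact half_dbl (c : C) : 2^-1 * (c + c) = c.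
Proof. by field. Qed.

Fact half_dblZ (V : lmodType C) (v : V) : 2^-1 *: (v + v) = v.
Proof. by rewrite scalerDr -scalerDl -[RHS]scale1r; congr (_ *: _); field. Qed.

Lemma jformE X Y : jform X Y = \sum_i \sum_j vsval X i j * vsval Y i j.
Proof.
rewrite /jform /jtr vsval_jprod linearZ linearD /= (mxtrace_mulC (vsval Y)).
rewrite half_dbl.
apply: eq_bigr => i _; rewrite mxE; apply: eq_bigr => j _.
by rewrite -[in X in _ * X](jordan_tr Y) mxE.
Qed.

(* The transpose with respect to jform.  As (Z, (e_ij + e_ji) / 2) = Z i j, *)
(* the entries of the transpose of phi at Y are given by pairing Y with the *)
(* images of these matrices.                                                *)
Fact jsym_subproof (M : 'M[C]_3) : 2^-1 *: (M + M^T) \in symv.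
Proof. by apply/symvP; rewrite linearZ linearD /= trmxK addrC. Qed.
Definition jsym (M : 'M[C]_3) : jordan := Subvs (jsym_subproof M).

Definition jadj_fun (phi : 'End(jordan)) Y : jordan :=
  jsym (\matrix_(i, j) jform Y (phi (jsym (delta_mx i j)))).
Definition jadj (phi : 'End(jordan)) : 'End(jordan) := linfun (jadj_fun phi).

Lemma jprodC X Y : jprod X Y = jprod Y X.
Proof. by apply: subvs_inj; rewrite !vsval_jprod addrC. Qed.

Lemma jformC X Y : jform X Y = jform Y X.
Proof. by rewrite /jform jprodC. Qed.

Fact jform_is_linear X : linear_for *%R (jform X).
Proof. by move=> a Y Z; rewrite /jform /jtr !linearP. Qed.
HB.instance Definition _ X :=
  GRing.isLinear.Build C jordan C *%R (jform X) (jform_is_linear X).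

Lemma jmulE X Y : jmul X Y = jprod X Y.
Proof. exact: lfunE. Qed.

Lemma veeE X W Z : vee X W Z =
  jprod X (jprod W Z) - jprod W (jprod X Z)
  + (jprod (jprod X W) Z - (3^-1 * jform X W) *: Z).
Proof.
rewrite add_lfunE. rewrite add_lfunE. rewrite opp_lfunE. rewrite comp_lfunE. rewrite comp_lfunE. rewrite !jmulE. congr (_ + _).
rewrite jprodC linearB linearZ /= jprodC; congr (_ - _ *: _).
apply: subvs_inj; rewrite vsval_jprod vsval_jid mulmx1 mul1mx.
by rewrite half_dblZ.
Qed.

Lemma vsval_jsym M : vsval (jsym M) = 2^-1 *: (M + M^T).
Proof. by []. Qed.

Lemma jform_jsym M X : jform (jsym M) X = \sum_i \sum_j M i j * vsval X i j.
Proof.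
pose S := \sum_i \sum_j M i j * vsval X i j; rewrite -/S.
have S2 : S = \sum_i \sum_j M j i * vsval X i j.
  rewrite /S exchange_big; apply: eq_bigr => i _; apply: eq_bigr => j _.
  by rewrite -[in LHS](jordan_tr X) mxE.
rewrite -[RHS]half_dbl {2}S2 jformE /S -big_split big_distrr.
apply: eq_bigr => i _; rewrite -big_split big_distrr.
by apply: eq_bigr => j _; rewrite vsval_jsym !mxE -mulrA mulrDl.
Qed.

Fact jsym_is_linear : linear jsym.
Proof.
move=> a M N; apply: subvs_inj; rewrite [RHS]linearP /=.
by apply/matrixP => i j; rewrite !mxE; ring.
Qed.

HB.instance Definition _ :=
  GRing.isLinear.Build C 'M[C]_3 jordan *:%R jsym jsym_is_linear.

Lemma jordan_dec Y : Y = \sum_i \sum_j vsval Y i j *: jsym (delta_mx i j).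
Proof.
have {1}-> : Y = jsym (vsval Y).
  by apply: subvs_inj; rewrite vsval_jsym jordan_tr half_dblZ.
rewrite {1}[vsval Y]matrix_sum_delta linear_sum; apply: eq_bigr => i _.
by rewrite linear_sum; apply: eq_bigr => j _; rewrite linearZ.
Qed.

Fact jadj_fun_is_linear phi : linear (jadj_fun phi).
Proof.
move=> a Y Z; rewrite /jadj_fun -jsym_is_linear; congr jsym.
apply/matrixP => i j; rewrite mxE [RHS]mxE jformC linearP /= !(jformC (phi _)).
by congr (_ + _); [rewrite 2!mxE | rewrite mxE].
Qed.
HB.instance Definition _ phi :=
  GRing.isLinear.Build C jordan jordan *:%R (jadj_fun phi)
    (jadj_fun_is_linear phi).

Lemma jadjP phi X Y : jform (jadj phi X) Y = jform X (phi Y).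
Proof.
rewrite lfunE jform_jsym.
rewrite {2}(jordan_dec Y).
rewrite linear_sum linear_sum; apply: eq_bigr => i _.
rewrite linear_sum linear_sum; apply: eq_bigr => j _.
by rewrite linearZ linearZ mxE mulrC.
Qed.

Fact jform_tr X Y : jform X Y = \tr (vsval X *m vsval Y).
Proof.
rewrite /jform /jtr vsval_jprod mxtraceZ mxtraceD (mxtrace_mulC (vsval Y)).
exact: half_dbl.
Qed.

Fact jcross_self Z : exists d : C, vsval Z *m vsval (jcross Z Z) = d%:M.
Proof.
have -> : vsval (jcross Z Z) =
    vsval Z *m vsval Z - jtr Z *: vsval Z
    + (2^-1 * (jtr Z * jtr Z - \tr (vsval Z *m vsval Z))) *: 1%:M.
  rewrite -jform_tr /jcross; move: (jtr Z) (jform Z Z) => t q.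
  rewrite linearZ linearD linearB linearB /= !linearZ /=.
  move: (vsval Z *m vsval Z) (vsval Z) => z2 z.
  by apply/matrixP => i j; rewrite !mxE; field.
rewrite /jtr; move: (vsval Z) => z.
pose o0 : 'I_3 := ord0; pose o1 : 'I_3 := lift ord0 ord0.
pose o2 : 'I_3 := lift ord0 (lift ord0 ord0).
have ordP (i : 'I_3) : [\/ i = o0, i = o1 | i = o2].
  case: i => [[|[|[|i]]] hi] //; [apply: Or31 | apply: Or32 | apply: Or33];
  exact: val_inj.
exists (z o0 o0 * (z o1 o1 * z o2 o2 - z o1 o2 * z o2 o1)
  - z o0 o1 * (z o1 o0 * z o2 o2 - z o1 o2 * z o2 o0)
  + z o0 o2 * (z o1 o0 * z o2 o1 - z o1 o1 * z o2 o0)).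
rewrite /mxtrace; apply/matrixP => i j.
do 3! rewrite ?(mxE, big_ord_recl, big_ord0) /=.
rewrite -/o0 -/o1 -/o2.
by case: (ordP i) => ->; case: (ordP j) => -> /=; rewrite ?mulr1n ?mulr0n; field.
Qed.

Lemma vsval_vee X W Z : vsval (vee X W Z) =
  2^-1 *: (vsval X *m vsval W *m vsval Z + vsval Z *m vsval W *m vsval X)
  - (3^-1 * jform X W) *: vsval Z.
Proof.
rewrite veeE; move: (jform X W) => t.
rewrite linearD !linearB /= linearZ /=.
move: (vsval X) (vsval W) (vsval Z) => x w z.
rewrite !(mulmxDl, mulmxDr) -!(scalemxAl, scalemxAr).
rewrite !(mulmxDl, mulmxDr) !mulmxA.
move: (x *m w *m z) (z *m w *m x) (x *m z *m w) => a1 a2 a3.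
move: (w *m z *m x) (w *m x *m z) (z *m x *m w) => a4 a5 a6.
by apply/matrixP => i j; rewrite !mxE; field.
Qed.

Lemma vee_e6R X W : e6R (vee X W).
Proof.
move=> Z; have [d zc] := jcross_self Z.
have cz : vsval (jcross Z Z) *m vsval Z = d%:M.
  by rewrite -tr_scalar_mx -zc trmx_mul !jordan_tr.
rewrite jform_tr vsval_vee jform_tr; move: (vsval (jcross Z Z)) zc cz => c.
move: (vsval X) (vsval W) (vsval Z) => x w z zc cz.
rewrite mulmxBl -!scalemxAl mulmxDl -!mulmxA zc.
have trB (U V : 'M[C]_3) : \tr (U - V) = \tr U - \tr V by exact: raddfB.
rewrite trB mxtraceZ mxtraceD mxtraceZ.
rewrite [X in _ * (_ + X) - _](mxtrace_mulC z) -!mulmxA cz.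
rewrite !mulmxA !mul_mx_scalar !mxtraceZ mxtrace_scalar (mxtrace_mulC w).
by rewrite -mulr_natr; field.
Qed.

End Jordan.

Fact lker0_conj (K : fieldType) (V : vectType K) (alpha X Y : 'End(V)) : lker alpha == 0%VS ->
  (alpha \o X \o alpha^-1)%VF = Y <-> (alpha \o X = Y \o alpha)%VF.
Proof.
move=> k0; split=> [<-|->].
  by rewrite -!comp_lfunA lker0_compVf // comp_lfun1r.
by rewrite -comp_lfunA lker0_compfV // comp_lfun1r.
Qed.

Section Freudenthal.
Variable R : realType.
Local Notation C := R[i].
Local Notation J := (jordan R).

Definition freud : Type := (J * J * C^o * C^o)%type.
HB.instance Definition _ := Vector.on freud.
Implicit Types P Q : freud.

Definition Phi_fun (phi : 'End(J)) (A B : J) (nu : C) P : freud :=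
  let: (X, Y, xi, eta) := P in
  (phi X - (3^-1 * nu) *: X + 2 *: jcross B Y + (eta : C) *: A,
   2 *: jcross A X - jadj phi Y + (3^-1 * nu) *: Y + (xi : C) *: B,
   jform A Y + nu * xi,
   jform B X - nu * eta).

Fact sum4_linear (V : lmodType C) (a : C) (p p' q q' r r' s s' : V) :
  (a *: p + p') + (a *: q + q') + (a *: r + r') + (a *: s + s')
  = a *: (p + q + r + s) + (p' + q' + r' + s').
Proof.
rewrite (addrACA (a *: p)) (addrACA (a *: p + a *: q)).
by rewrite (addrACA (a *: p + a *: q + a *: r)) -!scalerDr.
Qed.

Fact opp_linear (V : lmodType C) (a : C) (p p' : V) :
  - (a *: p + p') = a *: (- p) - p'.
Proof. by rewrite opprD scalerN. Qed.

Fact scale_linear (V : lmodType C) (a b : C) (p p' : V) :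
  b *: (a *: p + p') = a *: (b *: p) + b *: p'.
Proof. by rewrite scalerDr !scalerA mulrC. Qed.

Fact coef_linear (V : lmodType C) (a b c : C) (p : V) :
  (a * b + c) *: p = a *: (b *: p) + c *: p.
Proof. by rewrite scalerDl scalerA. Qed.

Fact addl_linear (a p p' n x x' : C) :
  (a * p + p') + n * (a * x + x') = a * (p + n * x) + (p' + n * x').
Proof. by ring. Qed.

Fact subl_linear (a p p' n x x' : C) :
  (a * p + p') - n * (a * x + x') = a * (p - n * x) + (p' - n * x').
Proof. by ring. Qed.

Lemma jcross_is_linear A : linear (@jcross R A).
Proof.
move=> a X Y; rewrite /jcross.
have -> : jtr (a *: X + Y) = a * jtr X + jtr Y by exact: linearP.
have -> : jform A (a *: X + Y) = a * jform A X + jform A Y by exact: linearP.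
have -> : jprod A (a *: X + Y) = a *: jprod A X + jprod A Y by exact: linearP.
rewrite -scale_linear; congr (_ *: _); move: (jtr A) (jform A) => t q.
have uE : t * (a * jtr X + jtr Y) - (a * q X + q Y)
    = a * (t * jtr X - q X) + (t * jtr Y - q Y) by ring.
rewrite uE !coef_linear (scale_linear _ 2) (scale_linear _ t) !opp_linear.
exact: sum4_linear.
Qed.

Fact Phi_fun_is_linear phi A B nu : linear (Phi_fun phi A B nu).
Proof.
move=> a [[[X Y] xi] eta] [[[X' Y'] xi'] eta'] /=.
congr (_, _, _, _).
- rewrite [phi _]linearP jcross_is_linear !scale_linear opp_linear coef_linear.
  exact: sum4_linear.
- rewrite [jadj phi _]linearP jcross_is_linear !scale_linear opp_linear.
  by rewrite coef_linear; exact: sum4_linear.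
- have -> : jform A (a *: Y + Y') = a * jform A Y + jform A Y'.
    exact: linearP.
  exact: addl_linear.
- have -> : jform B (a *: X + X') = a * jform B X + jform B X'.
    exact: linearP.
  exact: subl_linear.
Qed.
HB.instance Definition _ phi A B nu :=
  GRing.isLinear.Build C freud freud *:%R (Phi_fun phi A B nu)
    (Phi_fun_is_linear phi A B nu).

Definition Phi phi A B nu : 'End(freud) := linfun (Phi_fun phi A B nu).

Lemma PhiE phi A B nu P : Phi phi A B nu P = Phi_fun phi A B nu P.
Proof. exact: lfunE. Qed.

Definition fcross P Q : 'End(freud) :=
  let: (X, Y, xi, eta) := P in
  let: (Z, W, zeta, omega) := Q in
  Phi (- (2^-1 *: (vee X W + vee Z Y)))
      (- (4^-1 *: (2 *: jcross Y W - (xi : C) *: Z - (zeta : C) *: X)))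
      (4^-1 *: (2 *: jcross X Z - (eta : C) *: W - (omega : C) *: Y))
      (8^-1 * (jform X W + jform Z Y - 3 * (xi * omega + zeta * eta))).

Definition fherm P Q : C :=
  let: (X, Y, xi, eta) := P in
  let: (Z, W, zeta, omega) := Q in
  jherm X Z + jherm Y W + conjc xi * zeta + conjc eta * omega.

End Freudenthal.

Section E7.
Variable R : realType.
Local Notation freud := (freud R).

(* lker alpha == 0 says that the endomorphism alpha is bijective, and then *)
(* alpha^-1 is its inverse.                                                *)
Definition E7R : set 'End(freud) :=
  [set alpha : 'End(freud) | [/\ lker alpha == 0%VS,
    forall P Q, (alpha \o fcross P Q \o alpha^-1)%VF
                = fcross (alpha P) (alpha Q) &
    forall P Q, fherm (alpha P) (alpha Q) = fherm P Q]].

Lemma E7R_id : E7R \1%VF.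
Proof.
have k0 : lker (\1%VF : 'End(freud)) == 0%VS.
  by apply/lker0P => P Q; rewrite !id_lfunE.
split=> // P Q; rewrite ?id_lfunE //.
by apply/(lker0_conj _ _ k0); rewrite comp_lfun1l comp_lfun1r.
Qed.

Lemma E7R_comp alpha beta : E7R alpha -> E7R beta -> E7R (alpha \o beta)%VF.
Proof.
move=> [ka ca ha] [kb cb hb].
have k0 : lker (alpha \o beta)%VF == 0%VS.
  apply/lker0P => P Q; rewrite !comp_lfunE.
  by move/(lker0P ka)/(lker0P kb).
split=> // P Q; last by rewrite !comp_lfunE ha hb.
apply/(lker0_conj _ _ k0); rewrite !comp_lfunE -comp_lfunA.
have /(lker0_conj _ _ kb)-> := cb P Q.
by rewrite !comp_lfunA; have /(lker0_conj _ _ ka)-> := ca (beta P) (beta Q).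
Qed.

Lemma E7R_inv alpha : E7R alpha -> E7R (alpha^-1)%VF.
Proof.
move=> [ka ca ha].
have aK P : alpha (alpha^-1 P)%VF = P.
  by rewrite -comp_lfunE lker0_compfV // id_lfunE.
have k0 : lker (alpha^-1)%VF == 0%VS.
  by apply/lker0P; apply: can_inj aK.
split=> // P Q; last by rewrite -ha !aK.
apply/(lker0_conj _ _ k0); rewrite -{1}(aK P) -{1}(aK Q) -ca.
by rewrite !comp_lfunA lker0_compVf // comp_lfun1l.
Qed.

End E7.

(* A closed subgroup of a general linear group is an embedded            *)
(* submanifold of the ambient vector space.  A map between embedded      *)
(* submanifolds is smooth when around each point of its domain it is the *)
(* restriction of a smooth map between the ambient vector spaces.  The   *)
(* ambient real vector spaces are given by linear coordinate maps.       *)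

Section Smooth.
Context {R : realType}.

(* On an open subset of a finite-dimensional space, f is C^(k+1) exactly *)
(* when it is differentiable and all its directional derivatives are C^k. *)
Fixpoint Ck_on (V W : normedModType R) (U : set V) (k : nat) (f : V -> W) :
    Prop :=
  if k is k'.+1 then
    (forall x, U x -> differentiable f x) /\ forall v, Ck_on U k' ('D_v f)
  else forall x, U x -> {for x, continuous f}.

Definition smooth_on (V W : normedModType R) (U : set V) (f : V -> W) : Prop :=
  forall k, Ck_on U k f.

Definition smooth_map (V W : normedModType R) (A B : Type)
    (cA : A -> V) (cB : B -> W) (G : set A) (f : A -> B) : Prop :=
  forall a, G a -> exists (U : set V) (F : V -> W),
    [/\ open U, U (cA a), smooth_on U F &
        forall b, G b -> U (cA b) -> F (cA b) = cB (f b)].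

Definition lie_group_isomorphic (V W : normedModType R) (A B : Type)
    (mulA : A -> A -> A) (cA : A -> V) (G : set A)
    (mulB : B -> B -> B) (cB : B -> W) (H : set B) : Prop :=
  exists (f : A -> B) (g : B -> A),
    [/\ forall a, G a -> H (f a) /\ g (f a) = a,
        forall b, H b -> G (g b) /\ f (g b) = b,
        forall a a', G a -> G a' -> f (mulA a a') = mulB (f a) (f a'),
        smooth_map cA cB G f &
        smooth_map cB cA H g].

End Smooth.

Section Coordinates.
Variable R : realType.

Definition quat_coord (A : 'M[quat R]_3) :
    ('M[R]_3 * 'M[R]_3 * 'M[R]_3 * 'M[R]_3)%type :=
  (map_mx (@q1 R) A, map_mx (@qi R) A, map_mx (@qj R) A, map_mx (@qk R) A).

(* Another basis would change end_coord by a real linear automorphism of *)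
(* its target, hence not affect the smooth maps.                         *)
Definition end_coord (alpha : 'End(freud R)) :
    ('M[R]_(\dim {:freud R}) * 'M[R]_(\dim {:freud R}))%type :=
  let b := vbasis {:freud R} in
  let M := \matrix_(i, j) coord b j (alpha b`_i) in
  (map_mx (@complex.Re R) M, map_mx (@complex.Im R) M).

End Coordinates.

(* Main.v *)
(* Freud is realised as the space of traceless alternating 3-tensors on C^6,
   that is, of the linear maps tau P from rows to skew 6 x 6 matrices.  The
   symplectic group Sp(6, C) acts on these tensors, and it preserves the product
   because P x Q is, up to a constant, the element of the Lie algebra sp(6) whose
   entries are the symmetrised traces tr(tau P(a) J tau Q(b) J).

   Conversely, an automorphism alpha of the product is normalised by symplectic
   matrices.  The vectors Q with Q x Q = 0 and nonzero last entry are the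
   multiples of (Z, Z x Z, det Z, 1), so unipotent matrices reduce to the case
   where alpha fixes both lines (0, 0, 1, 0) and (0, 0, 0, 1), hence is block
   diagonal; then alpha acts on symmetric matrices and maps rank one matrices to
   rank one matrices, and a matrix g with alpha X = g X g^T is read off, up to
   signs, from the images of the diagonal units.  The Hermitian form cuts
   Sp(6, C) down to its unitary subgroup, which is Sp(3) for the embedding of
   quaternions z + w j as complex 2 x 2 blocks.

   The isomorphism is polynomial, and its inverse is locally rational: the left
   half of a symplectic matrix W near 1 is recovered from the quadratic
   expressions W_ai W_bj + W_aj W_bi, which are polarised forms of the images
   under W of (0, 0, 0, 1) and (0, Y, 0, 0). *)
From HB Require Import structures.
Require Import Defs.
From mathcomp Require Import all_boot all_order all_algebra.
From mathcomp Require Import all_classical all_reals all_analysis.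
From mathcomp Require Import complex ring.

Set Implicit Arguments.
Unset Strict Implicit.
Unset Printing Implicit Defensive.
Import Order.TTheory GRing.Theory Num.Theory.
Import numFieldNormedType.Exports.

Local Open Scope classical_set_scope.
Local Open Scope ring_scope.

(** No Lie algebra or connectedness argument enters: every automorphism of the product is brought to
    the identity by explicit matrices, which treats all components of the group at once. The tensors
    make equivariance visible: the matrix S of symmetrised traces of P and Q is symmetric and
    transforms as [U S U^T], so [S J] lies in sp(6) and is conjugated by U; comparing one block with
    the definition of the product gives the constant -1/16. Since -1 acts on 3-tensors as -1, it is
    not in the kernel, and the group obtained is Sp(3) rather than its quotient by the sign. The
    sign also shapes the inverse: quadratic expressions fix W only up to sign, so an odd one has to
    enter, namely the determinant of the upper left block of W, which is the last entry of the image
    of (0, 0, 0, 1). The resulting fraction has a denominator that may vanish, so near a general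
    point A0 it is applied after translating A0 to 1. *)

(** [Ck_on] iterates derivatives that are known only on an open set, so differentiability has to
    pass between functions that agree merely near the point. *)
Lemma differentiable_near_eq (R : realType) (V W : normedModType R) (f g : V -> W) x :
  (\forall y \near x, f y = g y) -> differentiable f x -> differentiable g x.
Proof.
move=> fg df; have [cdf e] := (diff_locallyP x f).1 df.
have fgx := nbhs_singleton fg.
have fg0 : \forall y \near 0, f (y + x) = g (y + x).
  by move: fg; rewrite (near_shift 0) subr0.
have e' : g \o shift x = cst (g x) + 'd f x +o_ 0 id.
  apply/eqaddoP => eps eps0; move/eqaddoP: e => /(_ eps eps0) h.
  near=> y; have fgy : f (y + x) = g (y + x) by near: y.
  have : `|(f \o shift x - (cst (f x) + 'd f x)) y| <= eps * `|y| by near: y.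
  by rewrite !fctE /= fgy fgx.
by apply/diff_locallyP; rewrite (diff_unique cdf e').
Unshelve. all: by end_near.
Qed.

(** * Smooth real and complex functions on an open set *)

Section SmoothCalculus.
Context {R : realType} {V : normedModType R}.
Variable U : set V.
Hypothesis Uop : open U.

Lemma Ck_on_ext (W : normedModType R) k (f g : V -> W) :
  (forall x, U x -> f x = g x) -> Ck_on U k f -> Ck_on U k g.
Proof.
elim: k f g => [|k IH] f g fg.
  move=> cf x Ux; have fgx : \forall y \near x, f y = g y.
    by apply: filterS (open_nbhs_nbhs (conj Uop Ux)) => y; exact: fg.
  rewrite /prop_for /continuous_at -(fg x Ux).
  exact: cvg_trans (near_eq_cvg fgx) (cf x Ux).
have fgx x : U x -> \forall y \near x, f y = g y.
  by move=> Ux; apply: filterS (open_nbhs_nbhs (conj Uop Ux)) => y; exact: fg.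
move=> [df Df]; split=> [x Ux|v].
  exact: differentiable_near_eq (fgx x Ux) (df x Ux).
by apply: IH (Df v) => x Ux; apply: near_eq_derive; exact: fgx.
Qed.

Lemma Ck_onW (W : normedModType R) k (f : V -> W) : Ck_on U k.+1 f -> Ck_on U k f.
Proof.
elim: k f => [|k IH] f [df Df].
  by move=> x Ux; apply: differentiable_continuous; exact: df.
by split=> // v; apply: IH; exact: Df.
Qed.

Lemma Ck_on_cst (W : normedModType R) k (w : W) : Ck_on U k (fun=> w).
Proof.
elim: k w => [|k IH] w; first by move=> x _; exact: cst_continuous.
split=> [x _|v]; first exact: differentiable_cst.
by apply: Ck_on_ext (IH 0) => x _; rewrite derive_cst.
Qed.

Lemma Ck_onD (W : normedModType R) k (f g : V -> W) :
  Ck_on U k f -> Ck_on U k g -> Ck_on U k (fun x => f x + g x).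
Proof.
elim: k f g => [|k IH] f g.
  by move=> cf cg x Ux; apply: continuousD; [exact: cf|exact: cg].
move=> [df Df] [dg Dg]; split=> [x Ux|v].
  by apply: differentiableD; [exact: df|exact: dg].
apply: Ck_on_ext (IH _ _ (Df v) (Dg v)) => x Ux.
by rewrite -deriveD //; apply: diff_derivable; [exact: df|exact: dg].
Qed.

Lemma Ck_onM k (f g : V -> R) :
  Ck_on U k f -> Ck_on U k g -> Ck_on U k (fun x => f x * g x).
Proof.
elim: k f g => [|k IH] f g.
  by move=> cf cg x Ux; apply: continuousM; [exact: cf|exact: cg].
move=> sf sg; have [[df Df] [dg Dg]] := (sf, sg); split=> [x Ux|v].
  by apply: differentiableM; [exact: df|exact: dg].
have h := Ck_onD (IH _ _ (Ck_onW sf) (Dg v)) (IH _ _ (Ck_onW sg) (Df v)).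
apply: Ck_on_ext h => x Ux.
by rewrite deriveM //; apply: diff_derivable; [exact: df|exact: dg].
Qed.

Lemma Ck_onZl (W : normedModType R) k (f : V -> R) (w : W) :
  Ck_on U k f -> Ck_on U k (fun x => f x *: w).
Proof.
elim: k f => [|k IH] f.
  by move=> cf x Ux; apply: continuousZl; exact: cf.
move=> [df Df]; split=> [x Ux|v].
  by apply: differentiableZl; exact: df.
apply: Ck_on_ext (IH _ (Df v)) => x Ux.
have dfx := df x Ux.
rewrite (deriveE v dfx) [RHS]deriveE; last exact: differentiableZl.
by rewrite diffZl.
Qed.

Lemma Ck_onV k (f : V -> R) : (forall x, U x -> f x != 0) ->
  Ck_on U k f -> Ck_on U k (fun x => (f x)^-1).
Proof.
move=> f0; elim: k => [|k IH].
  by move=> cf x Ux; apply: continuousV; [exact: f0|exact: cf].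
move=> sf; have [df Df] := sf; split=> [x Ux|v].
  by apply: differentiableV; [exact: df|exact: f0].
have s1 := IH (Ck_onW sf).
(* The derivative of [1/f] is [- f^-2 * 'D_v f]; with -1 as a constant factor, products and the
   induction hypothesis suffice. *)
have h := Ck_onM (Ck_on_cst k (-1 : R)) (Ck_onM (Ck_onM s1 s1) (Df v)).
apply: Ck_on_ext h => x Ux; rewrite deriveV ?f0 //; last by apply: diff_derivable; exact: df.
by rewrite mulN1r -expr2 exprVn scaleNr.
Qed.

Lemma Ck_on_linear k (f : V -> R) : linear f -> continuous f -> Ck_on U k f.
Proof.
move=> lf cf.
pose L := GRing.isLinear.Build R V R *:%R f lf.
pose F : {linear V -> R} := HB.pack f L.
case: k => [|k]; first by move=> x _; exact: cf.
split=> [x _|v]; first exact: (@linear_differentiable _ _ _ F x cf).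
apply: Ck_on_ext (Ck_on_cst k (f v)) => x _.
rewrite deriveE; last exact: (@linear_differentiable _ _ _ F x cf).
by rewrite (@diff_lin _ _ _ F x cf).
Qed.

Lemma smooth_on_sum (W : normedModType R) (I : Type) (r : seq I) (P : pred I)
  (f : I -> V -> W) : (forall i, smooth_on U (f i)) ->
  smooth_on U (fun x => \sum_(i <- r | P i) f i x).
Proof.
move=> sf k; elim: r => [|i r IH].
  by apply: Ck_on_ext (Ck_on_cst k 0) => x _; rewrite big_nil.
case Pi: (P i); last by apply: Ck_on_ext IH => x _; rewrite big_cons Pi.
by apply: Ck_on_ext (Ck_onD (sf i k) IH) => x _; rewrite big_cons Pi.
Qed.

Lemma smooth_on_ext (W : normedModType R) (f g : V -> W) :
  (forall x, U x -> f x = g x) -> smooth_on U f -> smooth_on U g.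
Proof. by move=> fg sf k; exact: Ck_on_ext fg (sf k). Qed.

(** Expanding [f x] in matrix units writes [T (f x)] as a finite sum of real functions times fixed
    vectors. *)
Lemma smooth_on_mx m n (W : normedModType R) (f : V -> 'M[R]_(m, n))
  (T : 'M[R]_(m, n) -> W) : linear T ->
  (forall i j, smooth_on U (fun x => f x i j)) -> smooth_on U (T \o f).
Proof.
move=> lT sf.
pose L := GRing.isLinear.Build R _ W *:%R T lT.
pose T' : {linear 'M[R]_(m, n) -> W} := HB.pack T L.
have h : smooth_on U (fun x => \sum_i \sum_j f x i j *: T (delta_mx i j)).
  apply: smooth_on_sum => i; apply: smooth_on_sum => j k.
  by apply: Ck_onZl; exact: sf.
apply: smooth_on_ext h => x _.
rewrite -[RHS]/(T' (f x)) [f x in RHS]matrix_sum_delta linear_sum.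
by apply: eq_bigr => i _; rewrite linear_sum; apply: eq_bigr => j _; rewrite linearZ.
Qed.

Definition csmooth (h : V -> R[i]) :=
  smooth_on U (fun x => complex.Re (h x)) /\ smooth_on U (fun x => complex.Im (h x)).

Lemma csmooth_ext h h' : (forall x, U x -> h x = h' x) -> csmooth h -> csmooth h'.
Proof.
by move=> e [s1 s2]; split; [apply: smooth_on_ext s1|apply: smooth_on_ext s2] => x Ux; rewrite e.
Qed.

Lemma csmooth_cst c : csmooth (fun=> c).
Proof. by split=> k; exact: Ck_on_cst. Qed.

Lemma csmoothD f g : csmooth f -> csmooth g -> csmooth (fun x => f x + g x).
Proof.
move=> [f1 f2] [g1 g2]; split=> k.
  by apply: Ck_on_ext (Ck_onD (f1 k) (g1 k)) => x _; case: (f x) => ??; case: (g x).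
by apply: Ck_on_ext (Ck_onD (f2 k) (g2 k)) => x _; case: (f x) => ??; case: (g x).
Qed.

Lemma csmoothM f g : csmooth f -> csmooth g -> csmooth (fun x => f x * g x).
Proof.
move=> [f1 f2] [g1 g2]; split=> k.
  apply: Ck_on_ext (Ck_onD (Ck_onM (f1 k) (g1 k))
    (Ck_onM (Ck_on_cst k (-1 : R)) (Ck_onM (f2 k) (g2 k)))) => x _.
  by case: (f x) => ??; case: (g x) => ??; rewrite /= mulN1r.
apply: Ck_on_ext (Ck_onD (Ck_onM (f1 k) (g2 k)) (Ck_onM (f2 k) (g1 k))) => x _.
by case: (f x) => ??; case: (g x).
Qed.

Lemma csmooth_sum (I : Type) (r : seq I) (P : pred I) (f : I -> V -> R[i]) :
  (forall i, csmooth (f i)) -> csmooth (fun x => \sum_(i <- r | P i) f i x).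
Proof.
move=> sf; elim: r => [|i r IH].
  by apply: csmooth_ext (csmooth_cst 0) => x _; rewrite big_nil.
case Pi: (P i); last by apply: csmooth_ext IH => x _; rewrite big_cons Pi.
by apply: csmooth_ext (csmoothD (sf i) IH) => x _; rewrite big_cons Pi.
Qed.

Lemma csmooth_prod (I : Type) (r : seq I) (P : pred I) (f : I -> V -> R[i]) :
  (forall i, csmooth (f i)) -> csmooth (fun x => \prod_(i <- r | P i) f i x).
Proof.
move=> sf; elim: r => [|i r IH].
  by apply: csmooth_ext (csmooth_cst 1) => x _; rewrite big_nil.
case Pi: (P i); last by apply: csmooth_ext IH => x _; rewrite big_cons Pi.
by apply: csmooth_ext (csmoothM (sf i) IH) => x _; rewrite big_cons Pi.
Qed.

Lemma csmooth_conj f : csmooth f -> csmooth (fun x => conjc (f x)).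
Proof.
move=> [f1 f2]; split=> k.
  by apply: Ck_on_ext (f1 k) => x _; case: (f x).
by apply: Ck_on_ext (Ck_onM (Ck_on_cst k (-1 : R)) (f2 k)) => x _; case: (f x) => ??; rewrite mulN1r.
Qed.

Lemma csmoothV f : (forall x, U x -> f x != 0) -> csmooth f -> csmooth (fun x => (f x)^-1).
Proof.
move=> f0 [f1 f2].
(* The squared modulus, the common denominator of both parts of the inverse. *)
pose n x := complex.Re (f x) * complex.Re (f x) + complex.Im (f x) * complex.Im (f x).
have n0 x : U x -> n x != 0.
  move=> Ux; apply: contra (f0 x Ux); rewrite /n; case: (f x) => a b /=.
  rewrite paddr_eq0 ?sqr_ge0 -?expr2 ?sqr_ge0 // !sqrf_eq0 => /andP[/eqP-> /eqP->].
  exact: eqxx.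
have sn k : Ck_on U k (fun x => (n x)^-1).
  by apply: Ck_onV n0 _; apply: Ck_onD; apply: Ck_onM; exact: f1 || exact: f2.
split=> k.
  apply: Ck_on_ext (Ck_onM (f1 k) (sn k)) => x _.
  by rewrite /n; case: (f x) => a b /=; rewrite -!expr2.
apply: Ck_on_ext (Ck_onM (Ck_on_cst k (-1 : R)) (Ck_onM (f2 k) (sn k))) => x _.
by rewrite /n; case: (f x) => a b /=; rewrite -!expr2 mulN1r.
Qed.

Definition mxsmooth m n (f : V -> 'M[R[i]]_(m, n)) := forall i j, csmooth (fun x => f x i j).

Lemma mxsmoothM m n p (f : V -> 'M[R[i]]_(m, n)) (g : V -> 'M[R[i]]_(n, p)) :
  mxsmooth f -> mxsmooth g -> mxsmooth (fun x => f x *m g x).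
Proof.
move=> sf sg i j; apply: csmooth_ext (csmooth_sum _ _ (fun k => csmoothM (sf i k) (sg k j))) => x _.
by rewrite mxE.
Qed.

Lemma csmooth_det n (f : V -> 'M[R[i]]_n) : mxsmooth f -> csmooth (fun x => \det (f x)).
Proof.
move=> sf; apply: csmooth_sum => s; apply: csmoothM; first exact: csmooth_cst.
by apply: csmooth_prod => i; exact: sf.
Qed.

Lemma csmooth_tr n (f : V -> 'M[R[i]]_n) : mxsmooth f -> csmooth (fun x => \tr (f x)).
Proof. by move=> sf; apply: csmooth_sum => i; exact: sf. Qed.

End SmoothCalculus.

(** * Explicit 3 x 3 matrices *)

Notation o0 := (@Ordinal 3 0 isT).
Notation o1 := (@Ordinal 3 1 isT).
Notation o2 := (@Ordinal 3 2 isT).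

Lemma ord3P (i : 'I_3) : [\/ i = o0, i = o1 | i = o2].
Proof.
by case: i => [[|[|[|//]]] h]; [apply: Or31|apply: Or32|apply: Or33];
  apply: val_inj.
Qed.

Lemma sum3 (V : nmodType) (f : 'I_3 -> V) :
  \sum_(i < 3) f i = f o0 + f o1 + f o2.
Proof.
rewrite !big_ord_recl big_ord0 addr0 addrA.
by congr (f _ + f _ + f _); apply: val_inj.
Qed.

Lemma ord3_eq : ((o0 == o0 = true) * (o0 == o1 = false) * (o0 == o2 = false)
  * (o1 == o0 = false) * (o1 == o1 = true) * (o1 == o2 = false)
  * (o2 == o0 = false) * (o2 == o1 = false) * (o2 == o2 = true))%type.
Proof. by []. Qed.

Ltac ord3 i := case: (ord3P i) => ->.

Section Explicit.
Variable F : comNzRingType.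
Implicit Types (x y : 'rV[F]_3) (M : 'M[F]_3).

(** Explicit entries let [ring3] turn a matrix identity into polynomial identities, one per
    entry. *)
Definition mx3 (a00 a01 a02 a10 a11 a12 a20 a21 a22 : F) : 'M[F]_3 := \matrix_(i, j)
  nth 0 (nth [::] [:: [:: a00; a01; a02]; [:: a10; a11; a12]; [:: a20; a21; a22]] i) j.
Definition rv3 (a0 a1 a2 : F) : 'rV[F]_3 := \row_j nth 0 [:: a0; a1; a2] j.

Lemma mx3E M : M = mx3 (M o0 o0) (M o0 o1) (M o0 o2) (M o1 o0) (M o1 o1) (M o1 o2)
  (M o2 o0) (M o2 o1) (M o2 o2).
Proof. by apply/matrixP => i j; rewrite mxE; ord3 i; ord3 j. Qed.

Lemma rv3E x : x = rv3 (x 0 o0) (x 0 o1) (x 0 o2).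
Proof. by apply/rowP => j; rewrite mxE; ord3 j. Qed.

Lemma sym_mx3E M : M^T = M -> M = mx3 (M o0 o0) (M o0 o1) (M o0 o2)
  (M o0 o1) (M o1 o1) (M o1 o2) (M o0 o2) (M o1 o2) (M o2 o2).
Proof. by move=> h; rewrite {1}[M]mx3E -{4 7 8}h !mxE. Qed.

Lemma mx3_ind (P : 'M[F]_3 -> Prop) :
  (forall a b c d e f g h i, P (mx3 a b c d e f g h i)) -> forall M, P M.
Proof. by move=> hP M; rewrite [M]mx3E. Qed.

Lemma sym_mx3_ind (P : 'M[F]_3 -> Prop) :
  (forall a b c d e f, P (mx3 a b c b d e c e f)) -> forall M, M^T = M -> P M.
Proof. by move=> hP M /sym_mx3E ->. Qed.

Lemma rv3_ind (P : 'rV[F]_3 -> Prop) : (forall a b c, P (rv3 a b c)) -> forall x, P x.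
Proof. by move=> hP x; rewrite [x]rv3E. Qed.

Section Ops.
Variables a00 a01 a02 a10 a11 a12 a20 a21 a22 b00 b01 b02 b10 b11 b12 b20 b21 b22 k a0 a1 a2 b0 b1 b2 : F.
Let A := mx3 a00 a01 a02 a10 a11 a12 a20 a21 a22.
Let B := mx3 b00 b01 b02 b10 b11 b12 b20 b21 b22.
Let x := rv3 a0 a1 a2.
Let y := rv3 b0 b1 b2.

Ltac ent3 := let i := fresh "i" in let j := fresh "j" in apply/matrixP => i j; ord3 i; ord3 j; rewrite !(mxE, sum3) /=.

Lemma mul_mx3 : A *m B = mx3 (a00 * b00+a01 * b10+a02 * b20) (a00 * b01+a01 * b11+a02 * b21) (a00 * b02+a01 * b12+a02 * b22) (a10 * b00+a11 * b10+a12 * b20) (a10 * b01+a11 * b11+a12 * b21) (a10 * b02+a11 * b12+a12 * b22) (a20 * b00+a21 * b10+a22 * b20) (a20 * b01+a21 * b11+a22 * b21) (a20 * b02+a21 * b12+a22 * b22).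
Proof. by ent3. Qed.

Lemma add_mx3 : A + B = mx3 (a00 + b00) (a01 + b01) (a02 + b02) (a10 + b10) (a11 + b11) (a12 + b12) (a20 + b20) (a21 + b21) (a22 + b22).
Proof. by ent3. Qed.

Lemma opp_mx3 : - A = mx3 (- a00) (- a01) (- a02) (- a10) (- a11) (- a12) (- a20) (- a21) (- a22).
Proof. by ent3. Qed.

Lemma scale_mx3 : k *: A = mx3 (k * a00) (k * a01) (k * a02) (k * a10) (k * a11) (k * a12) (k * a20) (k * a21) (k * a22).
Proof. by ent3. Qed.

Lemma tr_mx3 : A^T = mx3 (a00) (a10) (a20) (a01) (a11) (a21) (a02) (a12) (a22).
Proof. by ent3. Qed.

Lemma scalar_mx3 : k%:M = mx3 (k) (0) (0) (0) (k) (0) (0) (0) (k).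
Proof. by ent3. Qed.

Lemma mxtrace_mx3 : \tr A = a00 + a11 + a22.
Proof. by rewrite /mxtrace sum3 !mxE. Qed.

Lemma mul_rv3_mx3 : x *m A = rv3 (a0 * a00+a1 * a10+a2 * a20) (a0 * a01+a1 * a11+a2 * a21) (a0 * a02+a1 * a12+a2 * a22).
Proof. by apply/rowP => j; ord3 j; rewrite !(mxE, sum3). Qed.

Lemma add_rv3 : x + y = rv3 (a0 + b0) (a1 + b1) (a2 + b2).
Proof. by apply/rowP => j; ord3 j; rewrite !mxE. Qed.

Lemma opp_rv3 : - x = rv3 (- a0) (- a1) (- a2).
Proof. by apply/rowP => j; ord3 j; rewrite !mxE. Qed.

Lemma scale_rv3 : k *: x = rv3 (k * a0) (k * a1) (k * a2).
Proof. by apply/rowP => j; ord3 j; rewrite !mxE. Qed.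

Lemma dot_rv3 : (x *m y^T) 0 0 = a0 * b0 + a1 * b1 + a2 * b2.
Proof. by rewrite !(mxE, sum3). Qed.

End Ops.

Lemma det3 M : \det M = M o0 o0 * (M o1 o1 * M o2 o2 - M o1 o2 * M o2 o1)
  - M o0 o1 * (M o1 o0 * M o2 o2 - M o1 o2 * M o2 o0)
  + M o0 o2 * (M o1 o0 * M o2 o1 - M o1 o1 * M o2 o0).
Proof.
rewrite (expand_det_row _ o0) sum3 /cofactor.
rewrite !(expand_det_row _ (@Ordinal 2 0 isT)) !big_ord_recl !big_ord0.
rewrite /cofactor !det_mx11 !mxE /=.
repeat match goal with
| |- context [fun_of_matrix M (lift ?a ?b) ?c] =>
  let n := eval compute in (nat_of_ord (lift a b)) in
  rewrite (_ : lift a b = @Ordinal 3 n isT); last exact: val_inj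
| |- context [fun_of_matrix M ?c (lift ?a ?b)] =>
  let n := eval compute in (nat_of_ord (lift a b)) in
  rewrite (_ : lift a b = @Ordinal 3 n isT); last exact: val_inj
end.
by rewrite /bump /= !expr0 expr1 sqrrN expr1n; ring.
Qed.

Lemma det_mx3 a00 a01 a02 a10 a11 a12 a20 a21 a22 : \det (mx3 a00 a01 a02 a10 a11 a12 a20 a21 a22) =
  a00 * (a11 * a22 - a12 * a21) - a01 * (a10 * a22 - a12 * a20)
  + a02 * (a10 * a21 - a11 * a20).
Proof. by rewrite det3 !mxE. Qed.

(** Entry (j, k) is the sum over i of [x_i eps_ijk], with eps the Levi-Civita symbol; thus
    [y *m crossmx x] is the cross product of x and y. *)
Definition crossmx x : 'M[F]_3 := \matrix_(i, j)
  match nat_of_ord i, nat_of_ord j with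
  | 0%N, 1%N => x 0 o2 | 0%N, 2%N => - x 0 o1 | 1%N, 0%N => - x 0 o2
  | 1%N, 2%N => x 0 o0 | 2%N, 0%N => x 0 o1 | 2%N, 1%N => - x 0 o0
  | _, _ => 0
  end.

Lemma crossmx_rv3 a0 a1 a2 :
  crossmx (rv3 a0 a1 a2) = mx3 0 a2 (- a1) (- a2) 0 a0 a1 (- a0) 0.
Proof. by apply/matrixP => i j; ord3 i; ord3 j; rewrite !mxE /= ?mxE. Qed.

End Explicit.

Ltac calc3 := rewrite ?(mul_mx3, add_mx3, opp_mx3, scale_mx3, tr_mx3, scalar_mx3,
  mul_rv3_mx3, add_rv3, opp_rv3, scale_rv3, crossmx_rv3, mxtrace_mx3, det_mx3, dot_rv3).
Ltac ring3 := calc3; (congr mx3 || congr rv3 || idtac); ring.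

Ltac gen3 x := elim/rv3_ind: x => *.
Ltac genm3 M := elim/mx3_ind: M => *.
Ltac gens3 M h := move: M h; apply: sym_mx3_ind => *.

(** * Cross product matrices and the tensor of an element of [freud] *)

Section Cross.
Variable F : comNzRingType.
Implicit Types (x y : 'rV[F]_3) (A B M X Y Z W : 'M[F]_3).

Lemma tr_crossmx x : (crossmx x)^T = - crossmx x.
Proof. by gen3 x; ring3. Qed.

Lemma crossmx_is_linear : linear (@crossmx F).
Proof. by move=> a x y; gen3 x; gen3 y; ring3. Qed.
HB.instance Definition _ := GRing.isLinear.Build F _ _ *:%R (@crossmx F) crossmx_is_linear.

(** Applying M to all three indices of the Levi-Civita symbol multiplies it by [\det M]. *)
Lemma crossmx_conj M x :
  M *m crossmx (x *m M) *m M^T = \det M *: crossmx x.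
Proof. by gen3 x; genm3 M; ring3. Qed.

(* Twice the Freudenthal product; fr M M is twice the adjugate of M. *)
Definition fr X Y : 'M[F]_3 := X *m Y + Y *m X - \tr X *: Y - \tr Y *: X
  + (\tr X * \tr Y - \tr (X *m Y))%:M.

(** This is [crossmx_conj] with a factor M cancelled, [fr M M] being twice the adjugate; as a
    polynomial identity it also covers singular M. *)
Lemma fr_crossmxl M x : 2 *: (crossmx (x *m M) *m M^T) = fr M M *m crossmx x.
Proof. by gen3 x; genm3 M; rewrite /fr; ring3. Qed.

Lemma fr_crossmx M x : 2 *: (M *m crossmx x *m M^T) = crossmx (x *m fr M M).
Proof. by gen3 x; genm3 M; rewrite /fr; ring3. Qed.

Lemma frC X Y : fr X Y = fr Y X.
Proof. by genm3 X; genm3 Y; rewrite /fr; ring3. Qed.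

Lemma tr_frmx X Y : (fr X Y)^T = fr X^T Y^T.
Proof. by genm3 X; genm3 Y; rewrite /fr; ring3. Qed.

Section Form.
Implicit Types (xi eta : F) (u v : 'rV[F]_(3 + 3)).

(** The components of the alternating tensor are sorted by how many of the three indices lie in the
    second half: none gives eta, one gives the rows of X, two give the rows of Y, three give xi. The
    row u is contracted with the first index. *)
Definition trif X Y xi eta u : 'M[F]_(3 + 3) :=
  let u0 := lsubmx u in let u1 := rsubmx u in
  block_mx (crossmx (eta *: u0 + u1 *m X)) (crossmx u0 *m X + Y *m crossmx u1)
    (X *m crossmx u0 + crossmx u1 *m Y) (crossmx (xi *: u1 + u0 *m Y)).

Definition J6 : 'M[F]_(3 + 3) := block_mx 0 1%:M (- 1%:M) 0.

Lemma trif_row X Y xi eta (u0 u1 : 'rV[F]_3) : trif X Y xi eta (row_mx u0 u1) =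
  block_mx (crossmx (eta *: u0 + u1 *m X)) (crossmx u0 *m X + Y *m crossmx u1)
    (X *m crossmx u0 + crossmx u1 *m Y) (crossmx (xi *: u1 + u0 *m Y)).
Proof. by rewrite /trif row_mxKl row_mxKr. Qed.

(* The derivative of the action of U on forms, in the direction N. *)
Definition dact (N : 'M[F]_(3 + 3)) (t : 'rV[F]_(3 + 3) -> 'M[F]_(3 + 3)) u :=
  N *m t u + t (u *m N) + t u *m N^T.

(** The matrices [block_mx n b c (- n^T)] with b and c symmetric form sp(6). The result has the
    shape of [Phi]: b and c act as B and A do there, and n carries both phi and nu. *)
Lemma dact_trif n b c X Y xi eta u :
  b^T = b -> c^T = c -> X^T = X -> Y^T = Y ->
  dact (block_mx n b c (- n^T)) (trif X Y xi eta) u =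
  trif (\tr n *: X - n^T *m X - X *m n + fr b Y + eta *: c)
    (- \tr n *: Y + n *m Y + Y *m n^T + fr c X + xi *: b)
    (\tr (c *m Y) - \tr n * xi) (\tr (b *m X) + \tr n * eta) u.
Proof.
move=> hb hc hX hY; rewrite -[u]hsubmxK; move: (lsubmx u) (rsubmx u) => u0 u1.
rewrite /dact mul_row_block !trif_row tr_block_mx !mulmx_block !add_block_mx.
move: b hb; apply: sym_mx3_ind => *; move: c hc; apply: sym_mx3_ind => *.
gens3 X hX; gens3 Y hY; genm3 n; gen3 u0; gen3 u1; rewrite /fr.
by congr block_mx; ring3.
Qed.

Lemma mx11D (A B : 'M[F]_1) : (A + B) 0 0 = A 0 0 + B 0 0.
Proof. by rewrite mxE. Qed.

(** The four terms are the blocks of a bilinear form in (u0, u1) and (v0, v1); the first and the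
    last are -16 B and 16 A for the B and A of the product. *)
Lemma tr_trifJ2 X Y xi eta Z W zeta omega (u0 u1 v0 v1 : 'rV[F]_3) :
  X^T = X -> Y^T = Y -> Z^T = Z -> W^T = W ->
  let t := trif X Y xi eta (row_mx u0 u1) *m J6 in
  let s := trif Z W zeta omega (row_mx v0 v1) *m J6 in
  let t' := trif X Y xi eta (row_mx v0 v1) *m J6 in
  let s' := trif Z W zeta omega (row_mx u0 u1) *m J6 in
  \tr (t *m s) + \tr (s' *m t') =
  (u0 *m (- 4 *: (fr X Z - eta *: W - omega *: Y)) *m v0^T
  + u0 *m (4 *: (W *m X + Y *m Z) + (2 * (xi * omega + zeta * eta)
       - 2 * \tr (W *m X + Y *m Z))%:M) *m v1^T
  + u1 *m (4 *: (X *m W + Z *m Y) + (2 * (xi * omega + zeta * eta)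
       - 2 * \tr (W *m X + Y *m Z))%:M) *m v0^T
  + u1 *m (- 4 *: (fr Y W - xi *: Z - zeta *: X)) *m v1^T) 0 0.
Proof.
move=> hX hY hZ hW; rewrite /= !trif_row /J6 !mulmx_block !mxtrace_block.
rewrite !(mulmx0, mulmx1, mulmxN, add0r, addr0).
rewrite !mx11D.
gens3 X hX; gens3 Y hY; gens3 Z hZ; gens3 W hW.
gen3 u0; gen3 u1; gen3 v0; gen3 v1; rewrite /fr.
calc3.
ring.
Qed.

End Form.
End Cross.

(** * Traceless alternating tensors and their components *)

Section Tensors.
Variable F : fieldType.
Hypothesis two_neq0 : 2 != 0 :> F.
Local Notation rv6 := 'rV[F]_(3 + 3).
Local Notation mx6 := 'M[F]_(3 + 3).
Implicit Types (u v : rv6) (t : rv6 -> mx6) (U N : mx6).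

(** The second clause is skewness in the last two indices, the third skewness in the first two, and
    the fourth says that the contraction with the symplectic form vanishes. *)
Definition is_tens t := [/\ linear t, forall u, (t u)^T = - t u,
  forall u v, v *m t u = - (u *m t v) & forall u, \tr (J6 F *m t u) = 0].

Lemma trif_linear (X Y : 'M[F]_3) xi eta : linear (trif X Y xi eta).
Proof.
move=> a u v; rewrite -[u]hsubmxK -[v]hsubmxK scale_row_mx add_row_mx.
move: (lsubmx u) (rsubmx u) (lsubmx v) (rsubmx v) => u0 u1 v0 v1.
rewrite !trif_row scale_block_mx add_block_mx.
genm3 X; genm3 Y; gen3 u0; gen3 u1; gen3 v0; gen3 v1.
by congr block_mx; ring3.
Qed.

Lemma trif_tens (X Y : 'M[F]_3) xi eta : X^T = X -> Y^T = Y ->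
  is_tens (trif X Y xi eta).
Proof.
move=> hX hY; split; first exact: trif_linear.
- move=> u; rewrite /trif; move: (lsubmx u) (rsubmx u) => u0 u1.
  rewrite tr_block_mx opp_block_mx; gens3 X hX; gens3 Y hY; gen3 u0; gen3 u1.
  by congr block_mx; ring3.
- move=> u v; rewrite -[u]hsubmxK -[v]hsubmxK.
  move: (lsubmx u) (rsubmx u) (lsubmx v) (rsubmx v) => u0 u1 v0 v1.
  rewrite !trif_row !mul_row_block opp_row_mx.
  gens3 X hX; gens3 Y hY; gen3 u0; gen3 u1; gen3 v0; gen3 v1.
  by congr row_mx; ring3.
- move=> u; rewrite /trif; move: (lsubmx u) (rsubmx u) => u0 u1.
  rewrite mulmx_block mxtrace_block !(mul0mx, mul1mx, add0r, addr0) mulNmx mul1mx.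
  by gens3 X hX; gens3 Y hY; gen3 u0; gen3 u1; ring3.
Qed.

Definition crossvec (M : 'M[F]_3) : 'rV[F]_3 := rv3 (M o1 o2) (M o2 o0) (M o0 o1).

Lemma crossmxK x : crossvec (crossmx x) = x.
Proof. by gen3 x; rewrite /crossvec crossmx_rv3 !mxE. Qed.

Lemma crossvecK (M : 'M[F]_3) : M^T = - M -> crossmx (crossvec M) = M.
Proof.
move=> /matrixP h; have hM i j : M j i = - M i j by have := h i j; rewrite !mxE.
have d i : M i i = 0.
  by apply/eqP; have /eqP := hM i i; rewrite -addr_eq0 -mulr2n -mulr_natl mulf_eq0 (negPf two_neq0).
rewrite /crossvec crossmx_rv3 [RHS]mx3E !d.
by rewrite (hM o1 o0) (hM o2 o0) (hM o2 o1); congr mx3; rewrite ?opprK.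
Qed.

Definition e0 i : rv6 := row_mx (delta_mx 0 i) 0.
Definition e1 i : rv6 := row_mx 0 (delta_mx 0 i).

(** These four functions read the parameters of [trif] back from a tensor; [compxi] and [competa]
    take the component with indices 0, 1, 2 of one half. *)
Definition compX t : 'M[F]_3 := \matrix_i crossvec (ulsubmx (t (e1 i))).
Definition compY t : 'M[F]_3 := \matrix_i crossvec (drsubmx (t (e0 i))).
Definition compxi t : F := crossvec (drsubmx (t (e1 o0))) 0 o0.
Definition competa t : F := crossvec (ulsubmx (t (e0 o0))) 0 o0.

Fact crossmx_row (X : 'M[F]_3) i j k :
  (crossmx (delta_mx 0 i) *m X^T) j k = crossmx (row k X) i j.
Proof. by ord3 i; ord3 j; rewrite !(mxE, sum3) /= ?mxE /=; ring. Qed.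

Fact row_crossmx (Y : 'M[F]_3) i j k :
  (Y *m crossmx (delta_mx 0 i)) j k = - crossmx (row j Y) i k.
Proof. by ord3 i; ord3 k; rewrite !(mxE, sum3) /= ?mxE /=; ring. Qed.

(** Each sum is, up to sign, an off-diagonal entry of [X - X^T]. So the trace condition, which cuts
    the alternating tensors from dimension 20 to 14, amounts to the symmetry of X and Y. *)
Fact crossmx_sum_sym (X : 'M[F]_3) :
  (forall j, \sum_i crossmx (row i X) j i = 0) -> X^T = X.
Proof.
elim/mx3_ind: X => x00 x01 x02 x10 x11 x12 x20 x21 x22 h.
move: (h o0) (h o1) (h o2); rewrite !sum3 !mxE /= ?mxE /= => h0 h1 h2.
have e12 : x12 = x21 by apply/eqP; rewrite -subr_eq0 -[X in _ == X]h0; apply/eqP; ring.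
have e20 : x20 = x02 by apply/eqP; rewrite -subr_eq0 -[X in _ == X]h1; apply/eqP; ring.
have e01 : x01 = x10 by apply/eqP; rewrite -subr_eq0 -[X in _ == X]h2; apply/eqP; ring.
by rewrite tr_mx3 e12 e20 e01.
Qed.

Section Comp.
Variables (t : rv6 -> mx6) (ht : is_tens t).
Let T a b c := t (delta_mx 0 a) b c.
Let l i : 'I_(3 + 3) := lshift 3 i.
Let r i : 'I_(3 + 3) := rshift 3 i.

Let neg0 (x : F) : x = - x -> x = 0.
Proof.
move=> /eqP; rewrite -addr_eq0 -mulr2n -mulr_natl mulf_eq0 (negPf two_neq0).
by move=> /eqP.
Qed.

Fact T_skew a b c : T a b c = - T a c b.
Proof.
by case: ht => _ /(_ (delta_mx 0 a)) /matrixP /(_ c b) + _ _; rewrite /T !mxE.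
Qed.

Fact T_swap a b c : T a b c = - T b a c.
Proof.
have rE d (M : mx6) : ((delta_mx 0 d : rv6) *m M) 0 c = M d c by rewrite -rowE mxE.
case: ht => _ _ /(_ (delta_mx 0 a) (delta_mx 0 b)) /rowP /(_ c) + _.
by rewrite [RHS]mxE !rE.
Qed.

Fact T_trace a : \sum_i T a (r i) (l i) = 0.
Proof.
apply: neg0.
case: ht => _ _ _ /(_ (delta_mx 0 a)).
rewrite -[t _]submxK /J6 mulmx_block mxtrace_block.
rewrite !(mul0mx, mul1mx, mulNmx, add0r, addr0).
move=> /eqP; rewrite linearN /= subr_eq0 => /eqP h.
have -> : \sum_i T a (r i) (l i) = \tr (dlsubmx (t (delta_mx 0 a))).
  by apply: eq_bigr => i _; rewrite !mxE.
rewrite {1}h -sumrN; apply: eq_bigr => i _; rewrite !mxE.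
exact: T_skew.
Qed.

Fact e0E i : e0 i = delta_mx 0 (l i).
Proof. by rewrite /e0 /l delta_mx_lshift. Qed.
Fact e1E i : e1 i = delta_mx 0 (r i).
Proof. by rewrite /e1 /r delta_mx_rshift. Qed.

Fact T_rll i j k : T (r i) (l j) (l k) = crossmx (row i (compX t)) j k.
Proof.
rewrite rowK crossvecK; last by apply/matrixP => a b; rewrite !mxE e1E; exact: T_skew.
by rewrite !mxE e1E.
Qed.

Fact T_lrr i j k : T (l i) (r j) (r k) = crossmx (row i (compY t)) j k.
Proof.
rewrite rowK crossvecK; last by apply/matrixP => a b; rewrite !mxE e0E; exact: T_skew.
by rewrite !mxE e0E.
Qed.

Fact T_cyc a b c : T a b c = T b c a.
Proof. by rewrite T_swap T_skew opprK. Qed.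

Fact alt3 (f : 'I_3 -> 'I_3 -> 'I_3 -> F) :
  (forall i j k, f i j k = - f i k j) -> (forall i j k, f i j k = - f j i k) ->
  forall i j k, f i j k = f o0 o1 o2 * crossmx (delta_mx 0 i) j k.
Proof.
move=> f1 f2 i j k.
have d1 a b : f a b b = 0 by apply: neg0; exact: f1.
have d2 a b : f a a b = 0 by apply: neg0; exact: f2.
have d3 a b : f a b a = 0 by rewrite f1 d2 oppr0.
have c a b c : f a b c = f b c a by rewrite f2 f1 opprK.
ord3 i; ord3 j; ord3 k; rewrite !mxE /= ?(d1, d2, d3) ?mxE /= ?(mulr0n, mulr1n) ?(oppr0, mulr0, mulr1, mulrN1) //.
by rewrite f1 c.
Qed.

Fact T_lll i j k : T (l i) (l j) (l k) = competa t * crossmx (delta_mx 0 i) j k.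
Proof.
rewrite (@alt3 (fun i j k => T (l i) (l j) (l k))) //.
- by congr (_ * _); rewrite /competa /crossvec !mxE /= ?mxE e0E.
- by move=> *; exact: T_skew.
- by move=> *; exact: T_swap.
Qed.

Fact T_rrr i j k : T (r i) (r j) (r k) = compxi t * crossmx (delta_mx 0 i) j k.
Proof.
rewrite (@alt3 (fun i j k => T (r i) (r j) (r k))) //.
- by congr (_ * _); rewrite /compxi /crossvec !mxE /= ?mxE e1E.
- by move=> *; exact: T_skew.
- by move=> *; exact: T_swap.
Qed.

Lemma compX_sym : (compX t)^T = compX t.
Proof.
have h j : \sum_i crossmx (row i (compX t)) j i = 0.
  rewrite -[RHS]oppr0 -[in RHS](T_trace (l j)) -sumrN; apply: eq_bigr => i _.
  by rewrite -T_rll T_swap.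
exact: crossmx_sum_sym.
Qed.

Lemma compY_sym : (compY t)^T = compY t.
Proof.
have h j : \sum_i crossmx (row i (compY t)) j i = 0.
  rewrite -[RHS](T_trace (r j)); apply: eq_bigr => i _.
  by rewrite -T_lrr T_cyc.
exact: crossmx_sum_sym.
Qed.

Lemma trif_comp u : trif (compX t) (compY t) (compxi t) (competa t) u = t u.
Proof.
have [lin sk _ _] := ht.
have tl : linear (trif (compX t) (compY t) (compxi t) (competa t)).
  exact: trif_linear.
pose Lt := GRing.isLinear.Build F rv6 mx6 *:%R t lin.
pose Lr := GRing.isLinear.Build F rv6 mx6 *:%R _ tl.
pose f : {linear rv6 -> mx6} := HB.pack t Lt.
pose g : {linear rv6 -> mx6} := HB.pack (trif (compX t) (compY t) (compxi t) (competa t)) Lr.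
suff h a : g (delta_mx 0 a) = f (delta_mx 0 a).
  rewrite -[LHS]/(g u) -[RHS]/(f u) [u]row_sum_delta !linear_sum.
  by apply: eq_bigr => a _; rewrite !linearZ h.
(* Skewness determines the lower left block from the upper right one, so three blocks are
   compared. *)
have sub00 (A B : mx6) : ulsubmx A = ulsubmx B -> ursubmx A = ursubmx B ->
    drsubmx A = drsubmx B -> A^T = - A -> B^T = - B -> A = B.
  move=> hl hr hd hA hB; rewrite -[A]submxK -[B]submxK; congr block_mx => //.
  apply: trmx_inj; rewrite !trmx_dlsub hA hB.
  by apply/matrixP => i j; move/matrixP: hr => /(_ i j); rewrite !mxE => ->.
have trB : forall u, (g u)^T = - g u.
  by case: (@trif_tens (compX t) (compY t) (compxi t) (competa t) compX_sym compY_sym).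
case: (split_ordP a) => i -> ; rewrite -?/(l i) -?/(r i) -?e0E -?e1E;
  (apply: sub00; [| | |exact: trB|exact: sk]);
  rewrite /f /g /= trif_row ?(block_mxKul, block_mxKur, block_mxKdr);
  rewrite !(mul0mx, linear0, mulmx0, addr0, add0r) -?rowE; apply/matrixP => j k.
- by rewrite linearZ [LHS]mxE -T_lll e0E !mxE.
- by rewrite -[compX t]compX_sym crossmx_row -T_rll T_cyc e0E !mxE.
- by rewrite -T_lrr e0E !mxE.
- by rewrite -T_rll e1E !mxE.
- by rewrite row_crossmx -T_lrr -T_swap e1E !mxE.
- by rewrite linearZ [LHS]mxE -T_rrr e1E !mxE.
Qed.

End Comp.
End Tensors.

(** * The symplectic action on tensors *)

Section Action.
Variable F : fieldType.
Local Notation rv6 := 'rV[F]_(3 + 3).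
Local Notation mx6 := 'M[F]_(3 + 3).
Implicit Types (u v : rv6) (t s : rv6 -> mx6) (U V N S : mx6).
Local Notation J := (J6 F).

Definition symp U := U^T *m J *m U = J.

(** U is applied to all three indices; this is a left action. *)
Definition act U t u := U *m t (u *m U) *m U^T.

Definition trform t s u v : F :=
  \tr (t u *m J *m (s v *m J)) + \tr (s u *m J *m (t v *m J)).
Definition trmat t s : mx6 := \matrix_(a, b) trform t s (delta_mx 0 a) (delta_mx 0 b).

Lemma J6_sqr : J *m J = - 1%:M.
Proof.
rewrite /J6 mulmx_block !(mul0mx, mulmx0, mul1mx, mulmx1, add0r, addr0).
by rewrite (@scalar_mx_block _ 3 3) opp_block_mx !oppr0.
Qed.

Lemma J6_tr : J^T = - J.
Proof. by rewrite /J6 tr_block_mx opp_block_mx !trmx0 linearN /= !trmx1 oppr0 opprK. Qed.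

Lemma symp_mulV U : symp U -> U *m (- J *m U^T *m J) = 1%:M.
Proof.
move=> h; apply: mulmx1C.
by rewrite !mulNmx -!mulmxA (mulmxA _ J) h J6_sqr opprK.
Qed.

Lemma symp_tr U : symp U -> U *m J *m U^T = J.
Proof.
move=> /symp_mulV h.
have e : U *m J *m U^T *m J = J *m J.
  by rewrite J6_sqr -h !mulNmx mulmxN opprK !mulmxA.
rewrite -[LHS]mulmx1 -[X in _ *m X]opprK -J6_sqr mulmxN mulmxA e.
by rewrite -mulmxA J6_sqr mulmxN mulmx1 opprK.
Qed.

Lemma symp_mul U V : symp U -> symp V -> symp (U *m V).
Proof.
move=> hU hV; rewrite /symp trmx_mul -!mulmxA (mulmxA J) (mulmxA _ (J *m U)).
by rewrite (mulmxA U^T) hU mulmxA.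
Qed.

Lemma symp1 : symp 1%:M.
Proof. by rewrite /symp trmx1 mul1mx mulmx1. Qed.

Lemma symp_transp U : symp U -> symp U^T.
Proof. by rewrite /symp trmxK; exact: symp_tr. Qed.

Lemma act_tens U t : symp U -> is_tens t -> is_tens (act U t).
Proof.
move=> hU [lin sk sw tr0]; split.
- move=> a u v; rewrite /act mulmxDl -scalemxAl lin mulmxDr mulmxDl.
  by rewrite -scalemxAr -scalemxAl.
- by move=> u; rewrite /act !trmx_mul trmxK sk mulNmx mulmxN mulmxA.
- by move=> u v; rewrite /act !mulmxA sw !mulNmx.
- by move=> u; rewrite /act !mulmxA mxtrace_mulC !mulmxA hU; exact: tr0.
Qed.

Lemma act_mul U V t u : act (U *m V) t u = act U (act V t) u.
Proof. by rewrite /act trmx_mul !mulmxA. Qed.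

Lemma act1 t u : act 1%:M t u = t u.
Proof. by rewrite /act trmx1 mul1mx !mulmx1. Qed.

Lemma trform_mat t s u v : is_tens t -> is_tens s ->
  trform t s u v = (u *m trmat t s *m v^T) 0 0.
Proof.
move=> [lt _ _ _] [ls _ _ _].
have lin1 w : scalar (trform t s ^~ w).
  move=> a x y; rewrite /trform lt ls !mulmxDl -!scalemxAl !linearD !linearZ /=.
  by rewrite mulrDr addrACA.
have lin2 w : scalar (trform t s w).
  move=> a x y; rewrite /trform lt ls !mulmxDl -!scalemxAl !mulmxDr -!scalemxAr.
  by rewrite !linearD !linearZ /= mulrDr addrACA.
have sum1 w (x : rv6) : trform t s x w = \sum_a x 0 a * trform t s (delta_mx 0 a) w.
  pose L := GRing.isLinear.Build F rv6 F *%R _ (lin1 w).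
  pose f : {linear rv6 -> F | *%R} := HB.pack (trform t s ^~ w) L.
  rewrite -[LHS]/(f x) {1}[x]row_sum_delta linear_sum; apply: eq_bigr => a _.
  by rewrite linearZ.
have sum2 w (x : rv6) : trform t s w x = \sum_a x 0 a * trform t s w (delta_mx 0 a).
  pose L := GRing.isLinear.Build F rv6 F *%R _ (lin2 w).
  pose f : {linear rv6 -> F | *%R} := HB.pack (trform t s w) L.
  rewrite -[LHS]/(f x) {1}[x]row_sum_delta linear_sum; apply: eq_bigr => a _.
  by rewrite linearZ.
rewrite sum1 -mulmxA mxE; apply: eq_bigr => a _; rewrite sum2 mxE.
by congr (_ * _); apply: eq_bigr => b _; rewrite !mxE mulrC.
Qed.

Lemma trform_act U t s u v : symp U ->
  trform (act U t) (act U s) u v = trform t s (u *m U) (v *m U).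
Proof.
move=> hU; rewrite /trform /act.
have h A B : \tr (U *m A *m U^T *m J *m (U *m B *m U^T *m J)) = \tr (A *m J *m (B *m J)).
  transitivity (\tr (U *m (A *m (U^T *m J *m U) *m B *m (U^T *m J)))).
    by rewrite !mulmxA.
  by rewrite mxtrace_mulC hU -[X in \tr X]mulmxA hU !mulmxA.
by rewrite !h.
Qed.

Lemma trmat_act U t s : symp U -> is_tens t -> is_tens s ->
  trmat (act U t) (act U s) = U *m trmat t s *m U^T.
Proof.
move=> hU ht hs; apply/matrixP => a b; rewrite mxE trform_act // trform_mat //.
rewrite trmx_mul !mulmxA -(mulmxA (delta_mx 0 a)) -(mulmxA (delta_mx 0 a)).
by rewrite -rowE trmx_delta -colE !mxE.
Qed.

(** For symplectic U one has [U S U^T J U = U (S J)], so [U S U^T J] is the conjugate of [S J] by U.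
    Together with [trmat_act] this yields the equivariance of the product. *)
Lemma dact_act U S t u : symp U -> is_tens t ->
  dact (U *m S *m U^T *m J) (act U t) u = act U (dact (S *m J) t) u.
Proof.
move=> hU ht; rewrite /dact /act.
have e : U *m S *m U^T *m J *m U = U *m (S *m J) by rewrite -!mulmxA (mulmxA U^T) hU.
rewrite !mulmxDr !mulmxDl; congr (_ + _ + _).
- by rewrite 2!mulmxA e !mulmxA.
- by rewrite -(mulmxA u) e mulmxA.
- by rewrite -[LHS]mulmxA -trmx_mul e trmx_mul !mulmxA.
Qed.

End Action.

(** * The product as the action of an element of sp(6) *)

Fact row_block_row (F : comNzRingType) (u0 u1 v0 v1 : 'rV[F]_3) (A B D E : 'M[F]_3) :
  row_mx u0 u1 *m block_mx A B D E *m (row_mx v0 v1)^T =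
  u0 *m A *m v0^T + u0 *m B *m v1^T + u1 *m D *m v0^T + u1 *m E *m v1^T.
Proof.
by rewrite tr_row_mx mul_row_block mul_row_col !mulmxDl addrACA addrA.
Qed.

Fact opp_scale_add_lfunE (K : fieldType) (V : vectType K) (k : K) (f g : 'End(V)) v :
  (- (k *: (f + g))) v = - (k *: (f v + g v)).
Proof. by rewrite opp_lfunE scale_lfunE add_lfunE. Qed.

Section Weights.
Variable F : numFieldType.
Implicit Types (X Y Z W V : 'M[F]_3).

Let trD X Y : (X + Y)^T = X^T + Y^T. Proof. exact: linearD. Qed.
Let trZ k X : (k *: X)^T = k *: X^T. Proof. exact: linearZ. Qed.

(** Brings the matrix of traces times J to the block shape that [dact_trif] expects. *)
Fact scale_block_J6 X Y Z W A B (k c : F) :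
  X^T = X -> Y^T = Y -> Z^T = Z -> W^T = W ->
  - k *: (block_mx A (4 *: (W *m X + Y *m Z) + c%:M) (4 *: (X *m W + Z *m Y) + c%:M) B *m J6 F)
  = block_mx (k *: (4 *: (W *m X + Y *m Z) + c%:M)) (- k *: A) (k *: B)
      (- (k *: (4 *: (W *m X + Y *m Z) + c%:M))^T).
Proof.
move=> hX hY hZ hW; rewrite /J6 mulmx_block.
rewrite !(mul0mx, mulmx0, mulmxN, mulmx1, add0r, addr0) scale_block_mx.
rewrite trZ trD trZ trD !trmx_mul hX hY hZ hW tr_scalar_mx.
by rewrite !scaleNr !scalerN !opprK.
Qed.

(** Here n is the upper left block of the sp(6) element attached to the product, and q stands for
    [xi * omega + zeta * eta]; the right side is then [- nu]. *)
Fact dact_weight X Y Z W q :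
  let n := 16^-1 *: (4 *: (W *m X + Y *m Z) + (2 * q - 2 * \tr (W *m X + Y *m Z))%:M) in
  \tr n = - (8^-1 * (\tr (X *m W) + \tr (Z *m Y) - 3 * q)).
Proof.
move=> n; rewrite /n mxtraceZ !mxtraceD mxtraceZ mxtrace_scalar !mxtraceD.
by rewrite (mxtrace_mulC W) (mxtrace_mulC Y) -mulr_natl; field.
Qed.

(** The right side is [phi V - 3^-1 nu V] for the phi and nu of the product, with the [vee]
    operators expanded into matrix products. *)
Fact dact_weightX X Y Z W V q : X^T = X -> Y^T = Y -> Z^T = Z -> W^T = W ->
  let n := 16^-1 *: (4 *: (W *m X + Y *m Z) + (2 * q - 2 * \tr (W *m X + Y *m Z))%:M) in
  let q1 := \tr (X *m W) in let q2 := \tr (Z *m Y) in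
  \tr n *: V - n^T *m V - V *m n =
  - (2^-1 *: ((2^-1 *: (X *m W *m V + V *m W *m X) - (3^-1 * q1) *: V)
       + (2^-1 *: (Z *m Y *m V + V *m Y *m Z) - (3^-1 * q2) *: V)))
  - (3^-1 * (8^-1 * (q1 + q2 - 3 * q))) *: V.
Proof.
move=> hX hY hZ hW n q1 q2.
have tn : \tr n = - (8^-1 * (q1 + q2 - 3 * q)) by exact: dact_weight.
have nT : n^T = 16^-1 *: (4 *: (X *m W + Z *m Y) + (2 * q - 2 * (q1 + q2))%:M).
  rewrite /n trZ trD trZ trD !trmx_mul hX hY hZ hW.
  by rewrite tr_scalar_mx mxtraceD (mxtrace_mulC W) (mxtrace_mulC Y).
have nE : n = 16^-1 *: (4 *: (W *m X + Y *m Z) + (2 * q - 2 * (q1 + q2))%:M).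
  by rewrite /n mxtraceD (mxtrace_mulC W) (mxtrace_mulC Y).
rewrite tn nT nE -scalemxAl -scalemxAr !(mulmxDl, mulmxDr) -!scalemxAl -!scalemxAr.
rewrite !(mulmxDl, mulmxDr) mul_scalar_mx mul_mx_scalar !mulmxA.
move: (X *m W *m V) (V *m W *m X) (Z *m Y *m V) (V *m Y *m Z) => a b c d.
by apply/matrixP => i j; rewrite !mxE; field.
Qed.

Fact dact_weightY X Y Z W V q : X^T = X -> Y^T = Y -> Z^T = Z -> W^T = W ->
  let n := 16^-1 *: (4 *: (W *m X + Y *m Z) + (2 * q - 2 * \tr (W *m X + Y *m Z))%:M) in
  let q1 := \tr (X *m W) in let q2 := \tr (Z *m Y) in
  - \tr n *: V + n *m V + V *m n^T =
  - - (2^-1 *: ((2^-1 *: (W *m X *m V + V *m X *m W) - (3^-1 * q1) *: V)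
       + (2^-1 *: (Y *m Z *m V + V *m Z *m Y) - (3^-1 * q2) *: V)))
  + (3^-1 * (8^-1 * (q1 + q2 - 3 * q))) *: V.
Proof.
move=> hX hY hZ hW n q1 q2.
(* Transposition exchanges the arguments of [vee], which amounts to swapping X with W and Y with
   Z. *)
have := @dact_weightX W Z Y X V q hW hZ hY hX.
rewrite /= (mxtrace_mulC W X) (mxtrace_mulC Y Z) -/q1 -/q2.
have -> : 16^-1 *: (4 *: (X *m W + Z *m Y) + (2 * q - 2 * \tr (X *m W + Z *m Y))%:M) = n^T.
  rewrite /n [in RHS]trZ [in RHS]trD [in RHS]trZ [in RHS]trD !trmx_mul hX hY hZ hW.
  by rewrite tr_scalar_mx !mxtraceD (mxtrace_mulC W) (mxtrace_mulC Y).
rewrite mxtrace_tr trmxK => h.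
transitivity (- (\tr n *: V - n *m V - V *m n^T)).
  by rewrite scaleNr !opprD !opprK.
by rewrite h [LHS]opprD [X in _ + X]opprK.
Qed.

End Weights.

Section FreudForm.
Variable R : realType.
Local Notation C := R[i].
Local Notation rv6 := 'rV[C]_(3 + 3).
Local Notation mx6 := 'M[C]_(3 + 3).
Implicit Types (X Y Z W : jordan R) (P Q : freud R).
Local Notation J := (J6 C).

Definition tau P : rv6 -> mx6 :=
  let: (X, Y, xi, eta) := P in trif (vsval X) (vsval Y) xi eta.

Lemma tau_tens P : is_tens (tau P).
Proof. by case: P => [[[X Y] xi] eta]; apply: trif_tens; exact: jordan_tr. Qed.

Lemma vsvalD X Y : vsval (X + Y) = vsval X + vsval Y. Proof. exact: linearD. Qed.
Lemma vsvalN X : vsval (- X) = - vsval X. Proof. exact: linearN. Qed.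
Lemma vsvalZ (k : C) X : vsval (k *: X) = k *: vsval X. Proof. exact: linearZ. Qed.
Definition vsvalE := (vsvalD, vsvalN, vsvalZ).

Lemma vsval_jcross X Y : vsval (jcross X Y) = 2^-1 *: fr (vsval X) (vsval Y).
Proof.
rewrite /jcross vsvalZ; congr (_ *: _).
rewrite !vsvalE vsval_jid vsval_jprod.
by rewrite scalerA divff ?pnatr_eq0 // scale1r /fr jform_tr scalemx1.
Qed.

Lemma jform_nondeg X : (forall Y, jform X Y = 0) -> X = 0.
Proof.
move=> h; apply: subvs_inj; rewrite linear0; apply/matrixP => i j.
have := h (jsym (delta_mx i j)); rewrite jformC jform_jsym (bigD1 i) //= (bigD1 j) //=.
rewrite !mxE !eqxx mul1r !big1 ?addr0 => [->|k ki|k kj] //.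
  by rewrite big1 // => k' _; rewrite mxE (negPf ki) mul0r.
by rewrite mxE (negPf kj) andbF mul0r.
Qed.

Lemma jformD X Y Z : jform X (Y + Z) = jform X Y + jform X Z. Proof. exact: linearD. Qed.
Lemma jformN X Y : jform X (- Y) = - jform X Y. Proof. exact: linearN. Qed.
Lemma jformZ X k Y : jform X (k *: Y) = k * jform X Y. Proof. exact: linearZ. Qed.

Lemma jform_ext X Y : (forall Z, jform X Z = jform Y Z) -> X = Y.
Proof.
move=> h; apply/eqP; rewrite -subr_eq0; apply/eqP; apply: jform_nondeg => Z.
by rewrite jformC jformD jformN !(jformC Z) h subrr.
Qed.

Lemma jadj_eq (phi psi : 'End(jordan R)) :
  (forall X Y, jform (psi X) Y = jform X (phi Y)) -> jadj phi = psi.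
Proof. by move=> h; apply/lfunP => X; apply: jform_ext => Y; rewrite jadjP h. Qed.

(* Unification otherwise unfolds these into matrices of linear maps. *)
Local Opaque vee jadj.

Lemma jform_vee X Y Z W : jform (vee X W Z) Y = jform Z (vee W X Y).
Proof.
have trB (A B : 'M[C]_3) : \tr (A - B) = \tr A - \tr B by exact: raddfB.
rewrite !jform_tr !vsval_vee (jformC W).
move: (vsval X) (vsval Y) (vsval Z) (vsval W) => x y z w.
rewrite mulmxBl mulmxBr -!scalemxAl -!scalemxAr mulmxDl mulmxDr.
rewrite !trB !mxtraceZ !mxtraceD; congr (_ * _ - _); rewrite addrC; congr (_ + _).
  by rewrite !mulmxA.
by rewrite -!mulmxA mxtrace_mulC -!mulmxA mxtrace_mulC -!mulmxA.
Qed.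

Lemma jadj_vee X W : jadj (vee X W) = vee W X.
Proof. by apply: jadj_eq => U V; exact: jform_vee. Qed.

Lemma jadj_opp_scale_add (k : C) (f g : 'End(jordan R)) :
  jadj (- (k *: (f + g))) = - (k *: (jadj f + jadj g)).
Proof.
apply: jadj_eq => U V; rewrite !opp_scale_add_lfunE.
rewrite jformC (jformN V) (jformZ V) (jformD V) (jformN U) (jformZ U) (jformD U).
have jadjP' h : jform V (jadj h U) = jform U (h V) := etrans (jformC _ _) (jadjP h U V).
exact (f_equal2 (fun a b : C => - (k * (a + b))) (jadjP' f) (jadjP' g)).
Qed.

Lemma jadj_vees X Y Z W :
  jadj (- (2^-1 *: (vee X W + vee Z Y))) = - (2^-1 *: (vee W X + vee Y Z)).
Proof.
exact: etrans (jadj_opp_scale_add _ _ _) (congr1 (fun h => - (2^-1 *: h))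
  (f_equal2 (fun a b => a + b) (jadj_vee X W) (jadj_vee Z Y))).
Qed.

Fact vsval_opp_scale_add (k : C) (f g : 'End(jordan R)) U :
  vsval ((- (k *: (f + g))) U) = - (k *: (vsval (f U) + vsval (g U))).
Proof. by rewrite opp_scale_add_lfunE vsvalN vsvalZ vsvalD. Qed.

Fact vsval_vees X Y Z W U : vsval ((- (2^-1 *: (vee X W + vee Z Y))) U) =
  - (2^-1 *: ((2^-1 *: (vsval X *m vsval W *m vsval U + vsval U *m vsval W *m vsval X)
                 - (3^-1 * \tr (vsval X *m vsval W)) *: vsval U)
       + (2^-1 *: (vsval Z *m vsval Y *m vsval U + vsval U *m vsval Y *m vsval Z)
                 - (3^-1 * \tr (vsval Z *m vsval Y)) *: vsval U))).
Proof.
apply: etrans (vsval_opp_scale_add _ _ _ _) _.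
have h A B : vsval (vee A B U) = 2^-1 *: (vsval A *m vsval B *m vsval U
    + vsval U *m vsval B *m vsval A) - (3^-1 * \tr (vsval A *m vsval B)) *: vsval U.
  by rewrite vsval_vee jform_tr.
exact (f_equal2 (fun a b => - (2^-1 *: (a + b))) (h X W) (h Z Y)).
Qed.

Lemma dactZ k N (t : rv6 -> mx6) u : is_tens t -> dact (k *: N) t u = k *: dact N t u.
Proof.
move=> [lin _ _ _]; rewrite /dact !scalerDr -scalemxAl -scalemxAr linearZ /= -scalemxAr.
congr (_ + _ + _); have := lin k (u *m N) 0; rewrite addr0 => ->.
by have := lin 1 0 0; rewrite !scale1r addr0 -{1}[t 0]addr0 => /addrI <-; rewrite addr0.
Qed.

Lemma trmat_tau X Y xi eta Z W zeta omega :
  trmat (tau (X, Y, xi, eta)) (tau (Z, W, zeta, omega)) = 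
  block_mx (- 4 *: (fr (vsval X) (vsval Z) - eta *: vsval W - omega *: vsval Y))
   (4 *: (vsval W *m vsval X + vsval Y *m vsval Z) + (2 * (xi * omega + zeta * eta)
       - 2 * \tr (vsval W *m vsval X + vsval Y *m vsval Z))%:M)
   (4 *: (vsval X *m vsval W + vsval Z *m vsval Y) + (2 * (xi * omega + zeta * eta)
       - 2 * \tr (vsval W *m vsval X + vsval Y *m vsval Z))%:M)
   (- 4 *: (fr (vsval Y) (vsval W) - xi *: vsval Z - zeta *: vsval X)).
Proof.
apply/matrixP => a b; rewrite mxE /trform.
rewrite -[delta_mx 0 a : rv6]hsubmxK -[delta_mx 0 b : rv6]hsubmxK.
rewrite tr_trifJ2; try exact: jordan_tr.
by rewrite -row_block_row !hsubmxK -rowE trmx_delta -colE !mxE.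
Qed.

Fact vsval_weight X Y Z W : vsval (X - Y + Z + W) = vsval X - vsval Y + vsval Z + vsval W.
Proof. by rewrite !vsvalD vsvalN. Qed.

(** In this form every ingredient of the product is natural under symplectic matrices. The upper
    right block fixes the constant: [- 16^-1 * (- 4)] is [4^-1], the factor in front of B. *)
Lemma tau_cross P Q R0 u :
  tau (fcross P Q R0) u = - 16^-1 *: dact (trmat (tau P) (tau Q) *m J) (tau R0) u.
Proof.
rewrite -dactZ; last exact: tau_tens.
case: P Q R0 => [[[X Y] xi] eta] [[[Z W] zeta] omega] [[[X1 Y1] xi1] eta1].
rewrite trmat_tau.
rewrite scale_block_J6; try exact: jordan_tr.
set S01 := 4 *: _ + _.
rewrite /fcross.
set A := - (4^-1 *: _); set B := 4^-1 *: (2 *: _ - _ - _).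
have e4 : - 16^-1 * (- 4) = 4^-1 :> C.
  rewrite mulrNN; apply: (@mulfI _ 4); rewrite ?pnatr_eq0 // mulrCA mulfV ?pnatr_eq0 //.
  rewrite -natrM. by rewrite mulVf ?pnatr_eq0.
have v2 (V V' : jordan R) : vsval ((2 : C) *: jcross V V') = fr (vsval V) (vsval V').
  by rewrite vsvalZ vsval_jcross scalerA divff ?scale1r ?pnatr_eq0.
have BE : - 16^-1 *: (- 4 *: (fr (vsval X) (vsval Z) - eta *: vsval W - omega *: vsval Y)) = vsval B.
  by rewrite scalerA e4 /B vsvalZ !(vsvalD, vsvalN) v2 !vsvalZ.
have AE : 16^-1 *: ((- 4 *: (fr (vsval Y) (vsval W) - xi *: vsval Z - zeta *: vsval X))) = vsval A.
  by rewrite -[LHS]opprK -scaleNr scalerA e4 /A vsvalN vsvalZ !(vsvalD, vsvalN) v2 !vsvalZ.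
rewrite BE AE.
rewrite {2}/tau dact_trif; try exact: jordan_tr.
rewrite PhiE /tau /Phi_fun; f_equal.
- refine (etrans (vsval_weight _ _ _ _) _).
  refine (etrans (f_equal4 (fun a b c d => a - b + c + d) (vsval_vees X Y Z W X1)
    (vsvalZ _ X1) (v2 B Y1) (vsvalZ eta1 A)) _).
  refine (f_equal (fun m => m + fr (vsval B) (vsval Y1) + eta1 *: vsval A) _).
  rewrite !jform_tr; apply: esym.
  by apply: dact_weightX; exact: jordan_tr.
- rewrite jadj_vees; refine (etrans (vsval_weight _ _ _ _) _).
  refine (etrans (f_equal4 (fun a b c d => a - b + c + d) (v2 A X1)
    (vsval_vees W Z Y X Y1) (vsvalZ _ Y1) (vsvalZ xi1 B)) _).
  refine (f_equal (fun m => m + xi1 *: vsval B) _).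
  rewrite [RHS]addrC -[LHS]addrA.
  refine (f_equal (fun m => fr (vsval A) (vsval X1) + m) _).
  rewrite !jform_tr (mxtrace_mulC (vsval W) (vsval X)) (mxtrace_mulC (vsval Y) (vsval Z)).
  apply: esym; rewrite /S01.
  by apply: dact_weightY; exact: jordan_tr.
- by rewrite -jform_tr /S01 dact_weight !jform_tr mulNr opprK.
- by rewrite -jform_tr /S01 dact_weight !jform_tr mulNr.
Qed.

End FreudForm.

(** * Unipotent and block diagonal matrices acting on tensors *)

Section Values.
Variable F : fieldType.
Implicit Types (u v : 'rV[F]_(3 + 3)) (A B X Y : 'M[F]_3).

Definition upU B : 'M[F]_(3 + 3) := block_mx 1%:M B 0 1%:M.
Definition lowU B : 'M[F]_(3 + 3) := block_mx 1%:M 0 B 1%:M.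
Definition diagU A B : 'M[F]_(3 + 3) := block_mx A 0 0 B.

Lemma upU_symp B : B^T = B -> symp (upU B).
Proof.
move=> h; rewrite /symp /upU /J6 tr_block_mx !mulmx_block h !trmx1 !trmx0.
rewrite !(mul0mx, mulmx0, mul1mx, mulmx1, add0r, addr0, mulNmx, mulmxN).
by rewrite ?(subrr, addNr, oppr0, addrN).
Qed.

Lemma lowU_symp B : B^T = B -> symp (lowU B).
Proof.
move=> h; rewrite /symp /lowU /J6 tr_block_mx !mulmx_block h !trmx1 !trmx0.
rewrite !(mul0mx, mulmx0, mul1mx, mulmx1, add0r, addr0, mulNmx, mulmxN).
by rewrite ?(subrr, addNr, oppr0, addrN).
Qed.

Lemma diagU_symp A B : A^T *m B = 1%:M -> symp (diagU A B).
Proof.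
move=> h; have h' : B^T *m A = 1%:M by rewrite -[A]trmxK -trmx_mul h trmx1.
rewrite /symp /diagU /J6 tr_block_mx !mulmx_block !trmx0.
rewrite !(mul0mx, mulmx0, mul1mx, mulmx1, add0r, addr0, mulNmx, mulmxN).
by rewrite h h'.
Qed.

Hypothesis two_neq0 : 2 != 0 :> F.

Lemma fr_half_crossmxl B x : B^T = B ->
  crossmx (x *m B) *m B = 2^-1 *: fr B B *m crossmx x.
Proof.
move=> h; rewrite -scalemxAl -fr_crossmxl h scalerA mulVf // scale1r //.
Qed.

Lemma fr_half_crossmx B x : B^T = B ->
  B *m crossmx x *m B = crossmx (x *m (2^-1 *: fr B B)).
Proof.
move=> h; rewrite -scalemxAr linearZ /= -fr_crossmx h scalerA mulVf // scale1r //.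
Qed.

Lemma crossmx_half_fr B x : B^T = B ->
  B *m crossmx (x *m B) = crossmx x *m (2^-1 *: fr B B).
Proof.
move=> h; apply: trmx_inj; rewrite !trmx_mul !tr_crossmx linearZ /= tr_frmx h.
by rewrite mulNmx fr_half_crossmxl // -mulmxN.
Qed.

(** Applying the unipotent matrix to the three indices of the pure eta component produces terms of
    degree 0 to 3 in B; those of degree 2 and 3 are the adjugate and the determinant. *)
Lemma act_lowU B u : B^T = B ->
  act (lowU B) (trif 0 0 0 1) u = trif B (2^-1 *: fr B B) (\det B) 1 u.
Proof.
move=> h; rewrite -[u]hsubmxK; move: (lsubmx u) (rsubmx u) => u0 u1.
rewrite /act /lowU mul_row_block !trif_row tr_block_mx !mulmx_block h !trmx1 !trmx0.
rewrite !(mul0mx, mulmx0, mul1mx, mulmx1, add0r, addr0, scale0r, scale1r, linear0).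
have KD (x y : 'rV[F]_3) : crossmx (x + y) = crossmx x + crossmx y by exact: linearD.
congr block_mx => //.
- by rewrite KD mulmxDl fr_half_crossmxl.
- by rewrite KD mulmxDr crossmx_half_fr.
- rewrite !KD mulmxDr mulmxDl addrC linearZ /=; congr (_ + _).
    by rewrite -crossmx_conj h.
  by rewrite fr_half_crossmx.
Qed.

Lemma act_upU B u : B^T = B ->
  act (upU B) (trif 0 0 1 0) u = trif (2^-1 *: fr B B) B 1 (\det B) u.
Proof.
move=> h; rewrite -[u]hsubmxK; move: (lsubmx u) (rsubmx u) => u0 u1.
rewrite /act /upU mul_row_block !trif_row tr_block_mx !mulmx_block h !trmx1 !trmx0.
rewrite !(mul0mx, mulmx0, mul1mx, mulmx1, add0r, addr0, scale0r, scale1r, linear0).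
have KD (x y : 'rV[F]_3) : crossmx (x + y) = crossmx x + crossmx y by exact: linearD.
congr block_mx.
- rewrite !KD mulmxDr mulmxDl linearZ /=; congr (_ + _).
    by rewrite -crossmx_conj h.
  by rewrite fr_half_crossmx.
- by rewrite KD mulmxDr crossmx_half_fr.
- by rewrite KD mulmxDl fr_half_crossmxl.
- by rewrite addrC.
Qed.

Lemma act_upU0 B u : act (upU B) (trif 0 0 0 1) u = trif 0 0 0 1 u.
Proof.
rewrite -[u]hsubmxK; move: (lsubmx u) (rsubmx u) => u0 u1.
rewrite /act /upU mul_row_block !trif_row tr_block_mx !mulmx_block !trmx1 !trmx0.
by rewrite !(mul0mx, mulmx0, mul1mx, mulmx1, add0r, addr0, scale0r, scale1r, linear0).
Qed.

(** Conjugating [crossmx x] by A gives [\det A] times the cross matrix of [x A^-1], and [A^-1] is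
    [B^T]; this is the source of the determinant factors. *)
Lemma act_diagU A B X Y xi eta u : A^T *m B = 1%:M ->
  act (diagU A B) (trif X Y xi eta) u =
  trif (\det A *: (B *m X *m B^T)) (\det B *: (A *m Y *m A^T)) (\det B * xi) (\det A * eta) u.
Proof.
move=> h; have h' : B^T *m A = 1%:M by rewrite -[A]trmxK -trmx_mul h trmx1.
have hA : A *m B^T = 1%:M by exact: mulmx1C.
have hB : B *m A^T = 1%:M by exact: mulmx1C.
have KA x : A *m crossmx x *m A^T = \det A *: crossmx (x *m B^T).
  by rewrite -crossmx_conj -(mulmxA x) h' mulmx1.
have KB x : B *m crossmx x *m B^T = \det B *: crossmx (x *m A^T).
  by rewrite -crossmx_conj -(mulmxA x) h mulmx1.
rewrite -[u]hsubmxK; move: (lsubmx u) (rsubmx u) => u0 u1.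
rewrite /act /diagU mul_row_block !trif_row tr_block_mx !mulmx_block !trmx0.
rewrite !(mul0mx, mulmx0, add0r, addr0).
have KZ k (x : 'rV[F]_3) : k *: crossmx x = crossmx (k *: x) by rewrite linearZ.
have KA1 x : A *m crossmx (x *m A) = \det A *: (crossmx x *m B).
  by rewrite scalemxAl -crossmx_conj -[RHS]mulmxA h mulmx1.
have KB1 x : B *m crossmx (x *m B) = \det B *: (crossmx x *m A).
  by rewrite scalemxAl -crossmx_conj -[RHS]mulmxA h' mulmx1.
have KA2 x : crossmx (x *m A) *m A^T = \det A *: (B^T *m crossmx x).
  by rewrite scalemxAr -crossmx_conj !mulmxA h' mul1mx.
have KB2 x : crossmx (x *m B) *m B^T = \det B *: (A^T *m crossmx x).
  by rewrite scalemxAr -crossmx_conj !mulmxA h mul1mx.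
congr block_mx.
- rewrite KA KZ; congr crossmx.
  rewrite mulmxDl -scalemxAl -(mulmxA u0) hA mulmx1 scalerDr scalerA -scalemxAr.
  by rewrite !mulmxA.
- rewrite mulmxDr mulmxDl; congr (_ + _).
    by rewrite mulmxA KA1 -!scalemxAl -!scalemxAr !mulmxA.
  by rewrite -!mulmxA KB2 -!scalemxAl -!scalemxAr !mulmxA.
- rewrite mulmxDr mulmxDl; congr (_ + _).
    by rewrite -!mulmxA KA2 -!scalemxAl -!scalemxAr !mulmxA.
  by rewrite mulmxA KB1 -!scalemxAl -!scalemxAr !mulmxA.
- rewrite KB KZ; congr crossmx.
  rewrite mulmxDl -scalemxAl -(mulmxA u1) hB mulmx1 scalerDr scalerA -scalemxAr.
  by rewrite !mulmxA.
Qed.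

End Values.

(** * The contraction of two tensors and complex conjugation *)

Section BilinearForm.
Variable F : fieldType.
Implicit Types (t s : 'rV[F]_(3 + 3) -> 'M[F]_(3 + 3)) (X Y Z W : 'M[F]_3).

(** The full contraction over all three indices. *)
Definition bform t s : F := \sum_a \tr ((t (delta_mx 0 a))^T *m s (delta_mx 0 a)).

Fact delta_rv3 : (delta_mx 0 o0 = rv3 1 0 0 :> 'rV[F]_3) *
  (delta_mx 0 o1 = rv3 0 1 0 :> 'rV[F]_3) * (delta_mx 0 o2 = rv3 0 0 1 :> 'rV[F]_3).
Proof. by split; [split|]; apply/rowP => j; ord3 j; rewrite !mxE. Qed.

Fact mxtrace_tr_block (A B D E A' B' D' E' : 'M[F]_3) :
  \tr ((block_mx A B D E)^T *m block_mx A' B' D' E') =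
  \tr (A^T *m A') + \tr (D^T *m D') + \tr (B^T *m B') + \tr (E^T *m E').
Proof. by rewrite tr_block_mx mulmx_block mxtrace_block !mxtraceD addrA. Qed.

Fact bform_term0 X Y xi eta Z W zeta omega (u : 'rV[F]_3) :
  \tr ((trif X Y xi eta (row_mx u 0))^T *m trif Z W zeta omega (row_mx u 0)) =
  \tr ((crossmx (eta *: u))^T *m crossmx (omega *: u))
  + \tr ((X *m crossmx u)^T *m (Z *m crossmx u))
  + \tr ((crossmx u *m X)^T *m (crossmx u *m Z))
  + \tr ((crossmx (u *m Y))^T *m crossmx (u *m W)).
Proof.
rewrite !trif_row mxtrace_tr_block.
by rewrite !(mul0mx, linear0, mulmx0, addr0, add0r, scaler0).
Qed.

Fact bform_term1 X Y xi eta Z W zeta omega (u : 'rV[F]_3) :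
  \tr ((trif X Y xi eta (row_mx 0 u))^T *m trif Z W zeta omega (row_mx 0 u)) =
  \tr ((crossmx (xi *: u))^T *m crossmx (zeta *: u))
  + \tr ((Y *m crossmx u)^T *m (W *m crossmx u))
  + \tr ((crossmx u *m Y)^T *m (crossmx u *m W))
  + \tr ((crossmx (u *m X))^T *m crossmx (u *m Z)).
Proof.
rewrite !trif_row mxtrace_tr_block.
rewrite !(mul0mx, linear0, mulmx0, addr0, add0r, scaler0).
move: (\tr _) (\tr _) (\tr _) (\tr _) => a b c d.
by ring.
Qed.

Fact bform_half X Y Z W (eta omega : F) :
  X^T = X -> Y^T = Y -> Z^T = Z -> W^T = W ->
  \sum_i (\tr ((crossmx (eta *: delta_mx 0 i))^T *m crossmx (omega *: delta_mx 0 i))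
  + \tr ((X *m crossmx (delta_mx 0 i))^T *m (Z *m crossmx (delta_mx 0 i)))
  + \tr ((crossmx (delta_mx 0 i) *m X)^T *m (crossmx (delta_mx 0 i) *m Z))
  + \tr ((crossmx (delta_mx 0 i *m Y))^T *m crossmx (delta_mx 0 i *m W))) =
  6 * (eta * omega) + 4 * \tr (X *m Z) + 2 * \tr (Y *m W).
Proof.
move=> hX hY hZ hW; rewrite sum3 !delta_rv3.
gens3 X hX; gens3 Y hY; gens3 Z hZ; gens3 W hW.
by calc3; ring.
Qed.

(** The factor 6 counts the orderings of the three indices. *)
Lemma bform_trif X Y xi eta Z W zeta omega :
  X^T = X -> Y^T = Y -> Z^T = Z -> W^T = W ->
  bform (trif X Y xi eta) (trif Z W zeta omega) =
  6 * (\tr (X *m Z) + \tr (Y *m W) + xi * zeta + eta * omega).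
Proof.
move=> hX hY hZ hW; rewrite /bform big_split_ord /=.
under eq_bigr => i _ do rewrite delta_mx_lshift bform_term0.
rewrite (bform_half eta omega hX hY hZ hW).
under eq_bigr => i _ do rewrite delta_mx_rshift bform_term1.
rewrite (bform_half xi zeta hY hX hW hZ).
by ring.
Qed.

Lemma tens_sum t u : is_tens t -> t u = \sum_a u 0 a *: t (delta_mx 0 a).
Proof.
case=> lin _ _ _.
pose L := GRing.isLinear.Build F _ _ *:%R t lin.
pose f : {linear 'rV[F]_(3 + 3) -> 'M[F]_(3 + 3)} := HB.pack t L.
rewrite -[LHS]/(f u) {1}[u]row_sum_delta linear_sum.
by apply: eq_bigr => a _; rewrite linearZ.
Qed.

(** A matrix moved across the contraction is transposed, on each of the three indices. *)
Lemma bform_act V t s : is_tens t -> is_tens s ->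
  bform (act V t) s = bform t (act V^T s).
Proof.
move=> ht hs; rewrite /bform /act.
transitivity (\sum_a \sum_b V a b * \tr (V *m (t (delta_mx 0 b))^T *m V^T *m s (delta_mx 0 a))).
  apply: eq_bigr => a _; rewrite (tens_sum (_ *m V)) // !trmx_mul trmxK.
  rewrite linear_sum mulmx_suml mulmx_sumr mulmx_suml linear_sum /=.
  apply: eq_bigr => b _; rewrite -rowE mxE linearZ /= -scalemxAl -scalemxAr -scalemxAl linearZ /=.
  by rewrite !mulmxA.
rewrite exchange_big /=; apply: eq_bigr => b _.
rewrite (tens_sum (_ *m V^T)) // trmxK mulmx_sumr mulmx_suml mulmx_sumr linear_sum /=.
apply: eq_bigr => a _; rewrite -rowE !mxE -scalemxAr -scalemxAl -scalemxAr linearZ /=.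
by rewrite -!mulmxA mxtrace_mulC -!mulmxA.
Qed.

Fact trif_params a X X' Y Y' xi xi' eta eta' u :
  trif (a *: X + X') (a *: Y + Y') (a * xi + xi') (a * eta + eta') u =
  a *: trif X Y xi eta u + trif X' Y' xi' eta' u.
Proof.
rewrite -[u]hsubmxK; move: (lsubmx u) (rsubmx u) => u0 u1.
rewrite !trif_row scale_block_mx add_block_mx.
genm3 X; genm3 X'; genm3 Y; genm3 Y'; gen3 u0; gen3 u1.
by congr block_mx; ring3.
Qed.

Fact compX_trif X Y xi eta : compX (trif X Y xi eta) = X.
Proof.
apply/row_matrixP => i; rewrite rowK /e1 trif_row block_mxKul crossmxK.
by rewrite scaler0 add0r rowE.
Qed.

Fact compY_trif X Y xi eta : compY (trif X Y xi eta) = Y.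
Proof.
apply/row_matrixP => i; rewrite rowK /e0 trif_row block_mxKdr crossmxK.
by rewrite scaler0 add0r rowE.
Qed.

Fact compxi_trif X Y xi eta : compxi (trif X Y xi eta) = xi.
Proof.
by rewrite /compxi /e1 trif_row block_mxKdr crossmxK !mxE big1 ?addr0 ?mulr1 // => k _; rewrite mxE mul0r.
Qed.

Fact competa_trif X Y xi eta : competa (trif X Y xi eta) = eta.
Proof.
by rewrite /competa /e0 trif_row block_mxKul crossmxK !mxE big1 ?addr0 ?mulr1 // => k _; rewrite mxE mul0r.
Qed.

Section CompLinear.
Variables (a : F) (r t s : 'rV[F]_(3 + 3) -> 'M[F]_(3 + 3)).
Hypothesis rE : forall u, r u = a *: t u + s u.

Fact compX_lin : compX r = a *: compX t + compX s.
Proof. by apply/matrixP => i j; rewrite !mxE rE; ord3 j; rewrite /= !mxE. Qed.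
Fact compY_lin : compY r = a *: compY t + compY s.
Proof. by apply/matrixP => i j; rewrite !mxE rE; ord3 j; rewrite /= !mxE. Qed.
Fact compxi_lin : compxi r = a * compxi t + compxi s.
Proof. by rewrite /compxi /crossvec rE !mxE. Qed.
Fact competa_lin : competa r = a * competa t + competa s.
Proof. by rewrite /competa /crossvec rE !mxE. Qed.
End CompLinear.

Variable f : {rmorphism F -> F}.

Fact map_crossmx x : map_mx f (crossmx x) = crossmx (map_mx f x).
Proof.
apply/matrixP => i j; ord3 i; ord3 j; rewrite !mxE /= ?mxE ?rmorphN ?rmorph0 //.
Qed.

Lemma map_trif X Y xi eta u : map_mx f (trif X Y xi eta u) =
  trif (map_mx f X) (map_mx f Y) (f xi) (f eta) (map_mx f u).
Proof.
rewrite -[u]hsubmxK map_row_mx; move: (lsubmx u) (rsubmx u) => u0 u1.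
by rewrite !trif_row map_block_mx !map_crossmx !map_mxD !map_mxM !map_mxZ !map_crossmx.
Qed.

Lemma map_symp U : symp U -> symp (map_mx f U).
Proof.
rewrite /symp => h; rewrite map_trmx.
have hJ : map_mx f (J6 F) = J6 F.
  by rewrite /J6 map_block_mx map_mxN !map_mx0 !map_mx1.
by rewrite -{1}hJ -!map_mxM h hJ.
Qed.

End BilinearForm.

(** * The symplectic action on [freud] *)

Section GroupAction.
Variable R : realType.
Local Notation C := R[i].
Local Notation rv6 := 'rV[C]_(3 + 3).
Local Notation mx6 := 'M[C]_(3 + 3).
Implicit Types (t : rv6 -> mx6) (U V : mx6) (P Q : freud R) (X Y : jordan R).

Fact C2_neq0 : 2 != 0 :> C. Proof. by rewrite pnatr_eq0. Qed.

Lemma vsval_jsymK (M : 'M[C]_3) : M^T = M -> vsval (jsym M) = M.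
Proof. by move=> h; rewrite vsval_jsym h half_dblZ. Qed.

Lemma jsymK X : jsym (vsval X) = X.
Proof. by apply: subvs_inj; rewrite vsval_jsymK // jordan_tr. Qed.

Definition pi t : freud R := (jsym (compX t), jsym (compY t), compxi t, competa t).

Lemma tau_pi t : is_tens t -> tau (pi t) = t.
Proof.
move=> ht; apply: funext => u; rewrite /tau /pi.
rewrite (vsval_jsymK (compX_sym C2_neq0 ht)) (vsval_jsymK (compY_sym C2_neq0 ht)).
exact: (trif_comp C2_neq0 ht).
Qed.

Lemma tauK P : pi (tau P) = P.
Proof.
case: P => [[[X Y] xi] eta].
by rewrite /pi /tau compX_trif compY_trif compxi_trif competa_trif !jsymK.
Qed.

Lemma tau_inj P Q : tau P = tau Q -> P = Q.
Proof. by move=> h; rewrite -(tauK P) h tauK. Qed.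

Lemma tau_linear a P Q u : tau (a *: P + Q) u = a *: tau P u + tau Q u.
Proof.
case: P Q => [[[X Y] xi] eta] [[[X' Y'] xi'] eta'].
refine (etrans (_ : _ = trif (vsval (a *: X + X')) (vsval (a *: Y + Y'))
  (a * xi + xi') (a * eta + eta') u) _) => //.
by rewrite !vsvalD !vsvalZ trif_params.
Qed.

Lemma pi_linear a r t s : (forall u, r u = a *: t u + s u) -> pi r = a *: pi t + pi s.
Proof.
move=> h; rewrite /pi (compX_lin h) (compY_lin h) (compxi_lin h) (competa_lin h).
by rewrite !(jsym_is_linear a).
Qed.

(** Through [pi] this is linear for every matrix U, also where the transformed tensor leaves the
    image of [tau]; for symplectic U it stays in that image, and [tau_gact] holds. *)
Definition lact U P := pi (act U (tau P)).

Fact lact_is_linear U : linear (lact U).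
Proof.
move=> a P Q; apply: pi_linear => u.
by rewrite /act tau_linear mulmxDr mulmxDl -scalemxAr -scalemxAl.
Qed.
HB.instance Definition _ U :=
  GRing.isLinear.Build C (freud R) (freud R) *:%R (lact U) (lact_is_linear U).

Definition gact U : 'End(freud R) := linfun (lact U).

Lemma gactE U P : gact U P = lact U P.
Proof. exact: lfunE. Qed.

Lemma tau_gact U P : symp U -> tau (gact U P) = act U (tau P).
Proof. by move=> hU; rewrite gactE tau_pi //; apply: act_tens => //; exact: tau_tens. Qed.

Lemma gact_eq U P Q : symp U -> (forall u, act U (tau P) u = tau Q u) -> gact U P = Q.
Proof. by move=> hU h; apply: tau_inj; rewrite tau_gact //; exact: funext. Qed.

Lemma gactM U V P : symp U -> symp V -> gact (U *m V) P = gact U (gact V P).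
Proof.
move=> hU hV; apply: gact_eq; first exact: symp_mul.
by move=> u; rewrite tau_gact // tau_gact // act_mul.
Qed.

Lemma gact1 P : gact 1%:M P = P.
Proof. by apply: gact_eq; [exact: symp1|move=> u; exact: act1]. Qed.

Lemma gact_cross U P Q P' : symp U ->
  gact U (fcross P Q P') = fcross (gact U P) (gact U Q) (gact U P').
Proof.
move=> hU; apply: gact_eq => // u.
rewrite tau_cross !tau_gact // trmat_act //; try exact: tau_tens.
rewrite dact_act //; last exact: tau_tens.
rewrite /act tau_cross -scalemxAr -scalemxAl //.
Qed.

Definition sympV U : mx6 := - J6 C *m U^T *m J6 C.

Lemma sympV_symp U : symp U -> symp (sympV U).
Proof.
move=> hU; have hV : sympV U *m U = 1%:M by apply: mulmx1C; exact: symp_mulV.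
have hV' := symp_mulV hU; rewrite -/(sympV U) in hV'.
have e : (sympV U)^T *m U^T = 1%:M by rewrite -trmx_mul hV' trmx1.
by rewrite /symp -{1}hU -!mulmxA hV' mulmx1 mulmxA e mul1mx.
Qed.

Lemma gactVK U P : symp U -> gact (sympV U) (gact U P) = P.
Proof.
move=> hU; rewrite -gactM //; last exact: sympV_symp.
by rewrite (mulmx1C (symp_mulV hU)) gact1.
Qed.

Definition fconj P : freud R :=
  let: (X, Y, xi, eta) := P in (jconj X, jconj Y, conjc xi, conjc eta).

Lemma tau_fconj P u : tau (fconj P) u = map_mx (@conjc R) (tau P (map_mx (@conjc R) u)).
Proof.
case: P => [[[X Y] xi] eta]; rewrite /tau /fconj map_trif.
have e : map_mx (@conjc R) (map_mx (@conjc R) u) = u.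
  by apply/matrixP => i j; rewrite !mxE conjcK.
exact: (f_equal (trif _ _ _ _) (esym e)).
Qed.

Lemma fherm_bform P Q : 6 * fherm P Q = bform (tau (fconj P)) (tau Q).
Proof.
case: P Q => [[[X Y] xi] eta] [[[Z W] zeta] omega].
rewrite /tau /fconj bform_trif; try exact: jordan_tr.
by rewrite /fherm /jherm !jform_tr.
Qed.

Lemma fconj_gact U P : symp U -> fconj (gact U P) = gact (map_mx (@conjc R) U) (fconj P).
Proof.
move=> hU; apply: esym; apply: gact_eq => [|u]; first exact: map_symp.
have cc m n (M : 'M[C]_(m, n)) : map_mx (@conjc R) (map_mx (@conjc R) M) = M.
  by apply/matrixP => i j; rewrite !mxE conjcK.
have e : map_mx (@conjc R) (u *m map_mx (@conjc R) U) = map_mx (@conjc R) u *m U.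
  by rewrite map_mxM cc.
by rewrite /act !tau_fconj tau_gact // e /act !map_mxM map_trmx.
Qed.

Definition cadj U : mx6 := (map_mx (@conjc R) U)^T.

Lemma cadj_symp U : symp U -> symp (cadj U).
Proof. by move=> hU; apply: symp_transp; exact: map_symp. Qed.

Lemma fherm_gact U P Q : symp U -> fherm (gact U P) Q = fherm P (gact (cadj U) Q).
Proof.
move=> hU; apply: (@mulfI _ (6 : C)); first by rewrite pnatr_eq0.
rewrite !fherm_bform fconj_gact // !tau_gact //; [|exact: cadj_symp|exact: map_symp].
by rewrite bform_act //; exact: tau_tens.
Qed.

Lemma jconjK X : jconj (jconj X) = X.
Proof. by apply: subvs_inj; apply/matrixP => i j; rewrite !mxE conjcK. Qed.

Lemma fherm_inj Q Q' : (forall P, fherm P Q = fherm P Q') -> Q = Q'.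
Proof.
case: Q Q' => [[[Z W] zeta] omega] [[[Z' W'] zeta'] omega'] h.
have h0 X : jherm 0 X = 0.
  have -> : jherm 0 X = jform (jconj 0) X by [].
  have -> : jconj 0 = 0 :> jordan R by apply: subvs_inj; apply/matrixP => i j; rewrite !mxE conjc0.
  by rewrite jformC linear0.
have c0 : conjc 0 = 0 :> C by exact: rmorph0.
have c1 : conjc 1 = 1 :> C by exact: rmorph1.
have m0 (z : C) : conjc 0 * z = 0 by rewrite c0 mul0r.
have m1 (z : C) : conjc 1 * z = z by rewrite c1 mul1r.
have jc X Y : jherm (jconj X) Y = jform Y X by rewrite /jherm jconjK jformC.
have s1 (a b c d : C) : b = 0 -> c = 0 -> d = 0 -> a + b + c + d = a.
  by move=> -> -> ->; rewrite !addr0.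
have s2 (a b c d : C) : a = 0 -> c = 0 -> d = 0 -> a + b + c + d = b.
  by move=> -> -> ->; rewrite !addr0 add0r.
have s3 (a b c d : C) : a = 0 -> b = 0 -> d = 0 -> a + b + c + d = c.
  by move=> -> -> ->; rewrite addr0 !add0r.
have s4 (a b c d : C) : a = 0 -> b = 0 -> c = 0 -> a + b + c + d = d.
  by move=> -> -> ->; rewrite !add0r.
have e1 X Y1 Y2 y3 y4 : fherm (jconj X, 0, 0, 0) (Y1, Y2, y3, y4) = jform Y1 X :=
  etrans (s1 _ _ _ _ (h0 Y2) (m0 y3) (m0 y4)) (jc X Y1).
have e2 X Y1 Y2 y3 y4 : fherm (0, jconj X, 0, 0) (Y1, Y2, y3, y4) = jform Y2 X :=
  etrans (s2 _ _ _ _ (h0 Y1) (m0 y3) (m0 y4)) (jc X Y2).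
have e3 Y1 Y2 y3 y4 : fherm (0, 0, 1, 0) (Y1, Y2, y3, y4) = y3 :=
  etrans (s3 _ _ _ _ (h0 Y1) (h0 Y2) (m0 y4)) (m1 y3).
have e4 Y1 Y2 y3 y4 : fherm (0, 0, 0, 1) (Y1, Y2, y3, y4) = y4 :=
  etrans (s4 _ _ _ _ (h0 Y1) (h0 Y2) (m0 y3)) (m1 y4).
congr (_, _, _, _).
- apply: jform_ext => X.
  exact (etrans (esym (e1 X Z W zeta omega)) (etrans (h (jconj X, 0, 0, 0)) (e1 X Z' W' zeta' omega'))).
- apply: jform_ext => X.
  exact (etrans (esym (e2 X Z W zeta omega)) (etrans (h (0, jconj X, 0, 0)) (e2 X Z' W' zeta' omega'))).
- exact (etrans (esym (e3 Z W zeta omega)) (etrans (h (0, 0, 1, 0)) (e3 Z' W' zeta' omega'))).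
- exact (etrans (esym (e4 Z W zeta omega)) (etrans (h (0, 0, 0, 1)) (e4 Z' W' zeta' omega'))).
Qed.

End GroupAction.

(** * Rank one symmetric matrices *)

Section RankOne.
Variable F : numClosedFieldType.
Implicit Types (X Y Z B S : 'M[F]_3).

Fact fr_entries X : X^T = X ->
  [/\ fr X X o0 o0 = 2 * (X o1 o1 * X o2 o2 - X o1 o2 * X o1 o2),
      fr X X o1 o1 = 2 * (X o0 o0 * X o2 o2 - X o0 o2 * X o0 o2),
      fr X X o2 o2 = 2 * (X o0 o0 * X o1 o1 - X o0 o1 * X o0 o1) &
   [/\ fr X X o0 o1 = 2 * (X o0 o2 * X o1 o2 - X o0 o1 * X o2 o2),
      fr X X o0 o2 = 2 * (X o0 o1 * X o1 o2 - X o0 o2 * X o1 o1) &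
      fr X X o1 o2 = 2 * (X o0 o1 * X o0 o2 - X o1 o2 * X o0 o0)]].
Proof.
move=> /sym_mx3E ->; rewrite /fr; calc3.
by split; [| | |split]; rewrite !mxE /=; ring.
Qed.

Fact fr_eq0 X : X^T = X -> fr X X = 0 ->
  [/\ X o1 o1 * X o2 o2 = X o1 o2 * X o1 o2, X o0 o0 * X o2 o2 = X o0 o2 * X o0 o2,
      X o0 o0 * X o1 o1 = X o0 o1 * X o0 o1 &
   [/\ X o0 o2 * X o1 o2 = X o0 o1 * X o2 o2, X o0 o1 * X o1 o2 = X o0 o2 * X o1 o1 &
      X o0 o1 * X o0 o2 = X o1 o2 * X o0 o0]].
Proof.
move=> hX h0; have [] := fr_entries hX; rewrite h0 !mxE => /esym e1 /esym e2 /esym e3 [/esym e4 /esym e5 /esym e6].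
have red (a b : F) : 2 * (a - b) = 0 -> a = b.
  by move/eqP; rewrite mulf_eq0 pnatr_eq0 /= subr_eq0 => /eqP.
by split; [| | |split]; exact: red.
Qed.

(** All 2 x 2 minors vanish. If [X_ii] is nonzero, v is row i divided by a square root of [X_ii]; if
    the whole diagonal is zero, the minors force the other entries to vanish. *)
Lemma rank_one X : X^T = X -> fr X X = 0 -> exists v : 'rV[F]_3, X = v^T *m v.
Proof.
move=> hX h0; have [e1 e2 e3 [e4 e5 e6]] := fr_eq0 hX h0.
have vv a b c : (rv3 a b c)^T *m rv3 a b c = mx3 (a * a) (a * b) (a * c)
    (a * b) (b * b) (b * c) (a * c) (b * c) (c * c) :> 'M[F]_3.
  by apply/matrixP => i j; rewrite mxE big_ord1; ord3 i; ord3 j; rewrite !mxE //= mulrC.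
have sq (c : F) : c != 0 -> sqrtC c != 0 /\ sqrtC c * sqrtC c = c.
  by move=> c0; rewrite sqrtC_eq0 -expr2 sqrtCK.
have [x0|x0] := eqVneq (X o0 o0) 0; last first.
  have [s0 ss] := sq _ x0; exists (rv3 (sqrtC (X o0 o0)) (X o0 o1 / sqrtC (X o0 o0)) (X o0 o2 / sqrtC (X o0 o0))).
  move: (sqrtC _) s0 ss => s s0 ss; rewrite vv {1}(sym_mx3E hX) -ss.
  have q (a b c : F) : a * b = c * X o0 o0 -> c = a / s * (b / s).
    by move=> e; apply: (mulIf x0); rewrite -e -ss; field.
  by congr mx3; try (by field); apply: q; rewrite -?e3 -?e2 // ?e6 // mulrC.
have [x1|x1] := eqVneq (X o1 o1) 0; last first.
  have [s0 ss] := sq _ x1; exists (rv3 (X o0 o1 / sqrtC (X o1 o1)) (sqrtC (X o1 o1)) (X o1 o2 / sqrtC (X o1 o1))).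
  move: (sqrtC _) s0 ss => s s0 ss; rewrite vv {1}(sym_mx3E hX) -ss.
  have q (a b c : F) : a * b = c * X o1 o1 -> c = a / s * (b / s).
    by move=> e; apply: (mulIf x1); rewrite -e -ss; field.
  by congr mx3; try (by field); apply: q; rewrite -?e3 -?e1 // ?e5 // mulrC.
have [x2|x2] := eqVneq (X o2 o2) 0; last first.
  have [s0 ss] := sq _ x2; exists (rv3 (X o0 o2 / sqrtC (X o2 o2)) (X o1 o2 / sqrtC (X o2 o2)) (sqrtC (X o2 o2))).
  move: (sqrtC _) s0 ss => s s0 ss; rewrite vv {1}(sym_mx3E hX) -ss.
  have q (a b c : F) : a * b = c * X o2 o2 -> c = a / s * (b / s).
    by move=> e; apply: (mulIf x2); rewrite -e -ss; field.
  by congr mx3; try (by field); apply: q; rewrite -?e2 -?e1 // ?e4 // mulrC.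
have z (a b c : F) : a = 0 -> a * b = c * c -> c = 0.
  by move=> ->; rewrite mul0r => /esym/eqP; rewrite mulf_eq0 orbb => /eqP.
exists 0; rewrite mulmx0 {1}(sym_mx3E hX) x0 x1 x2 (z _ _ _ x1 e1) (z _ _ _ x0 e2) (z _ _ _ x0 e3).
by apply/matrixP => i j; ord3 i; ord3 j; rewrite !mxE.
Qed.

(** The three equations are the first minor equation of [offdiag_entries] at the points (1, 1), (-1,
    -1) and (2, 1/2) of the hyperbola [x * y = 1]. *)
Fact lin3 (p q c : F) : 1 + p + q + c = 0 -> 1 - p - q + c = 0 ->
  1 + 2 * p + 2^-1 * q + c = 0 -> [/\ p = 0, q = 0 & c = -1].
Proof.
move=> h1 h2 h3.
have hc : c = -1.
  apply: (@mulfI _ 2); first by rewrite pnatr_eq0.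
  by apply: (addrI 2); rewrite mulrN1 subrr -[RHS]addr0 -{1}h1 -h2; ring.
have hq : q = - p by apply/eqP; rewrite -subr_eq0 -h1 hc; apply/eqP; ring.
have hp : p = 0.
  apply: (@mulfI _ (3 / 2)); first by rewrite mulf_neq0 ?invr_eq0 ?pnatr_eq0.
  by rewrite mulr0 -h3 hc hq; field.
by split=> //; rewrite hq hp oppr0.
Qed.

Fact offdiag_entries (sii sjj skk sij sik sjk : F) :
  (forall x y, x * y = 1 -> [/\ (x + sii) * (y + sjj) = sij * sij,
     (x + sii) * skk = sik * sik & (y + sjj) * skk = sjk * sjk]) ->
  [/\ sii = 0, sjj = 0, skk = 0 & [/\ sik = 0, sjk = 0 & sij * sij = 1]].
Proof.
move=> h.
have m1 : -1 * -1 = 1 :> F by rewrite mulrNN mulr1.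
have m2 : 2 * 2^-1 = 1 :> F by rewrite mulfV ?pnatr_eq0.
have [a1 b1 c1] := h 1 1 (mulr1 1); have [a2 b2 _] := h (-1) (-1) m1.
have [a3 _ _] := h _ _ m2.
have kk : skk = 0.
  apply: (@mulfI _ 2); first by rewrite pnatr_eq0.
  rewrite mulr0 -[RHS](subrr (sik * sik)) -{1}b1 -b2; ring.
have sq0 (a : F) : 0 = a * a -> a = 0 by move/esym/eqP; rewrite mulf_eq0 orbb => /eqP.
have [] := @lin3 sjj sii (sii * sjj - sij * sij).
- by rewrite -{1}a1; ring.
- by rewrite -{1}a2; ring.
- by rewrite -a3 -[X in _ = X](subrr (2 * 2^-1)) m2; field.
move=> -> e e'; split=> //; split.
- by apply: sq0; rewrite -b1 kk mulr0.
- by apply: sq0; rewrite -c1 kk mulr0.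
- by apply: oppr_inj; rewrite -e' e mul0r add0r.
Qed.

Fact delta_mx3 (i j : 'I_3) : delta_mx i j = mx3 ((o0 == i) && (o0 == j))%:R ((o0 == i) && (o1 == j))%:R ((o0 == i) && (o2 == j))%:R ((o1 == i) && (o0 == j))%:R ((o1 == i) && (o1 == j))%:R ((o1 == i) && (o2 == j))%:R ((o2 == i) && (o0 == j))%:R ((o2 == i) && (o1 == j))%:R ((o2 == i) && (o2 == j))%:R :> 'M[F]_3.
Proof. by rewrite [LHS]mx3E !mxE. Qed.

(** S will be the image of [E_ij + E_ji] under a map fixing the diagonal units. As
    [x E_ii + y E_jj + E_ij + E_ji] has rank one along the hyperbola [x * y = 1], comparing minors
    along it leaves only a sign. *)
Fact rank_one_family (i j : 'I_3) S : S^T = S -> (i < j)%N ->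
  (forall x y, x * y = 1 -> fr (x *: delta_mx i i + y *: delta_mx j j + S)
     (x *: delta_mx i i + y *: delta_mx j j + S) = 0) ->
  exists2 c, c * c = 1 & S = c *: (delta_mx i j + delta_mx j i).
Proof.
move=> hS ij h.
have hM x y : (x *: delta_mx i i + y *: delta_mx j j + S)^T = x *: delta_mx i i + y *: delta_mx j j + S.
  by rewrite !linearD !linearZ /= !trmx_delta hS.
have {h}h x y (xy : x * y = 1) := fr_eq0 (hM x y) (h x y xy).
move: h ij; ord3 i; ord3 j => // h _.
- have [] := @offdiag_entries (S o0 o0) (S o1 o1) (S o2 o2) (S o0 o1) (S o0 o2) (S o1 o2).
    move=> x y xy; have [e1 e2 e3 _] := h x y xy; move: e1 e2 e3.
    rewrite !mxE !ord3_eq /= !(mulr0n, mulr1n, mulr0, mulr1, add0r, addr0) => f1 f2 f3.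
    by split; [exact: f3|exact: f2|exact: f1].
  move=> z0 z1 z2 [z3 z4 z5]; exists (S o0 o1) => //.
  rewrite {1}(sym_mx3E hS) z0 z1 z2 z3 z4 !delta_mx3 !ord3_eq /=.
  by ring3.
- have [] := @offdiag_entries (S o0 o0) (S o2 o2) (S o1 o1) (S o0 o2) (S o0 o1) (S o1 o2).
    move=> x y xy; have [e1 e2 e3 _] := h x y xy; move: e1 e2 e3.
    rewrite !mxE !ord3_eq /= !(mulr0n, mulr1n, mulr0, mulr1, add0r, addr0) => f1 f2 f3.
    by split; [exact: f2|exact: f3|rewrite mulrC; exact: f1].
  move=> z0 z1 z2 [z3 z4 z5]; exists (S o0 o2) => //.
  rewrite {1}(sym_mx3E hS) z0 z1 z2 z3 z4 !delta_mx3 !ord3_eq /=.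
  by ring3.
- have [] := @offdiag_entries (S o1 o1) (S o2 o2) (S o0 o0) (S o1 o2) (S o0 o1) (S o0 o2).
    move=> x y xy; have [e1 e2 e3 _] := h x y xy; move: e1 e2 e3.
    rewrite !mxE !ord3_eq /= !(mulr0n, mulr1n, mulr0, mulr1, add0r, addr0) => f1 f2 f3.
    by split; [exact: f1|rewrite mulrC; exact: f3|rewrite mulrC; exact: f2].
  move=> z0 z1 z2 [z3 z4 z5]; exists (S o1 o2) => //.
  rewrite {1}(sym_mx3E hS) z0 z1 z2 z3 z4 !delta_mx3 !ord3_eq /=.
  by ring3.
Qed.

Fact congr_delta (v : 'I_3 -> 'rV[F]_3) i :
  let g : 'M[F]_3 := \matrix_(j, k) v k 0 j in
  g *m delta_mx i i *m g^T = (v i)^T *m v i.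
Proof.
move=> g; rewrite -(mul_delta_mx (0 : 'I_1)) mulmxA -mulmxA -colE -trmx_delta -trmx_mul -colE.
have -> : col i g = (v i)^T by apply/matrixP => a b; rewrite !mxE ord1.
by rewrite trmxK.
Qed.

Fact diag_conj (d : 'rV[F]_3) i j :
  diag_mx d *m delta_mx i j *m (diag_mx d)^T = (d 0 i * d 0 j) *: delta_mx i j.
Proof.
rewrite tr_diag_mx mul_diag_mx mul_mx_diag; apply/matrixP => a b; rewrite !mxE.
by case: eqP => [->|_]; case: eqP => [->|_]; rewrite ?(mulr0, mul0r, mulr1) //.
Qed.

Fact sign_diag (a b c : F) : a * a = 1 -> b * b = 1 -> c * c = 1 -> a * b * c = 1 ->
  exists d : 'rV[F]_3, [/\ (diag_mx d)^T *m diag_mx d = 1%:M, \det (diag_mx d) = 1,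
    forall i, d 0 i * d 0 i = 1 &
    [/\ d 0 o0 * d 0 o1 = a, d 0 o0 * d 0 o2 = b & d 0 o1 * d 0 o2 = c]].
Proof.
move=> a1 b1 c1 abc; have abE : a * b = c by rewrite -[LHS]mulr1 -c1 mulrA abc mul1r.
have dd i : (rv3 c (c * a) (c * b)) 0 i * (rv3 c (c * a) (c * b)) 0 i = 1 :> F.
  by ord3 i; rewrite !mxE /= ?c1 //; rewrite mulrACA c1 ?a1 ?b1 mulr1.
(* Starting with c instead of 1 makes the determinant [c * (c * a) * (c * b)] equal to 1, because
   [a * b = c]. *)
exists (rv3 c (c * a) (c * b)); split; last 1 first.
- rewrite !mxE; split.
  + by rewrite /= mulrA c1 mul1r.
  + by rewrite /= mulrA c1 mul1r.
  + by rewrite /= (mulrACA c) c1 mul1r.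
- rewrite tr_diag_mx mul_diag_mx; apply/matrixP => i j; rewrite [LHS]mxE [diag_mx _ i j]mxE [RHS]mxE.
  by case: eqP => [->|_]; [rewrite !mulr1n dd|rewrite !mulr0n mulr0].
- rewrite det_diag big_ord_recl big_ord_recl big_ord_recl big_ord0 mulr1.
  have e1 : lift ord0 ord0 = o1 by exact: val_inj.
  have e2 : lift ord0 (lift ord0 ord0) = o2 by exact: val_inj.
  have e0 : ord0 = o0 by exact: val_inj.
  rewrite e2 e1 e0 !mxE /=.
  by rewrite (mulrACA c) c1 mul1r abE c1.
- exact: dd.
Qed.

Fact cubic_eq0 (e a b c : F) :
  (forall t, e + t * a + t * t * b + t * t * t * c = 0) -> [/\ e = 0, a = 0, b = 0 & c = 0].
Proof.
move=> h; have e0 : e = 0 by have := h 0; rewrite !mul0r !addr0.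
have h1 : a + b + c = 0 by rewrite -[RHS](h 1) e0; ring.
have h2 : - a + b - c = 0 by rewrite -[RHS](h (-1)) e0; ring.
have h3 : 2 * a + 4 * b + 8 * c = 0 by rewrite -[RHS](h 2) e0; ring.
have b0 : b = 0.
  apply: (@mulfI _ 2); first by rewrite pnatr_eq0.
  transitivity ((a + b + c) + (- a + b - c)); first by ring.
  by rewrite h1 h2 addr0 mulr0.
have c0 : c = 0.
  apply: (@mulfI _ 6); first by rewrite pnatr_eq0.
  transitivity ((2 * a + 4 * b + 8 * c) - 2 * (a + b + c) - 2 * b); first by ring.
  by rewrite h1 h3 b0 !mulr0 !subr0.
by split=> //; rewrite -h1 b0 c0 !addr0.
Qed.

Fact fr_nondeg Y : (forall B, B^T = B -> \tr (fr B B *m Y) = 0) ->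
  forall B, B^T = B -> \tr (B *m Y) = 0.
Proof.
move=> h; have two0 : 2 != 0 :> F by rewrite pnatr_eq0.
(* Polarisation at the identity, where [fr B 1%:M] is [(\tr B)%:M - B]. *)
have h1 B : B^T = B -> \tr B * \tr Y = \tr (B *m Y).
  move=> hB; apply/eqP; rewrite -subr_eq0; apply/eqP.
  have hB1 : (B + 1%:M)^T = B + 1%:M by rewrite linearD /= hB trmx1.
  apply: (mulfI two0); rewrite mulr0.
  transitivity (\tr (fr (B + 1%:M) (B + 1%:M) *m Y) - \tr (fr B B *m Y) - \tr (fr 1%:M 1%:M *m Y)).
    by clear; genm3 B; genm3 Y; rewrite /fr; ring3.
  by rewrite !h ?trmx1 // !subr0.
have t0 : \tr Y = 0.
  apply: (mulfI two0); rewrite mulr0; have := h1 1%:M (trmx1 _ _).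
  rewrite mul1mx mxtrace1 => e; transitivity (3%:R * \tr Y - \tr Y); first by ring.
  by rewrite e subrr.
by move=> B hB; rewrite -h1 // t0 mulr0.
Qed.

Fact crossvec_mx3 (a b c d e f g h i : F) : crossvec (mx3 a b c d e f g h i) = rv3 f g b.
Proof. by rewrite /crossvec !mxE. Qed.

(** The terms of degree 0, 1, 2, 3 in B involve eta, X, Y, xi respectively, so that this single
    entry, for varying B, sees the whole element. *)
Fact competa_upU B X Y xi eta : B^T = B -> X^T = X -> Y^T = Y ->
  2 * competa (act (upU B) (trif X Y xi eta)) =
  2 * eta + 2 * \tr (B *m X) + \tr (fr B B *m Y) + 2 * xi * \det B.
Proof.
move=> hB hX hY; rewrite /competa /act /e0 /upU mul_row_block trif_row tr_block_mx.
rewrite !mulmx_block block_mxKul hB !trmx1.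
rewrite !(mul0mx, mulmx0, mul1mx, mulmx1, add0r, addr0) ?delta_rv3.
gens3 B hB; gens3 X hX; gens3 Y hY; rewrite /fr; calc3; rewrite crossvec_mx3 mxE /=; ring.
Qed.

Fact fr_scale t B : fr (t *: B) (t *: B) = (t * t) *: fr B B.
Proof. by genm3 B; rewrite /fr; ring3. Qed.

Fact upU_eta_scale t B X Y (a b : F) :
  2 * b + 2 * \tr ((t *: B) *m X) + \tr (fr (t *: B) (t *: B) *m Y) + 2 * a * \det (t *: B) =
  2 * b + t * (2 * \tr (B *m X)) + t * t * \tr (fr B B *m Y) + t * t * t * (2 * a * \det B).
Proof. by genm3 B; genm3 X; genm3 Y; rewrite /fr; ring3. Qed.

Fact tr_mul_fr X : \tr (X *m fr X X) = 6 * \det X.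
Proof. by genm3 X; rewrite /fr; ring3. Qed.

Fact fr_vec (v : 'rV[F]_3) : fr (v^T *m v) (v^T *m v) = 0.
Proof.
have vv a b c : (rv3 a b c)^T *m rv3 a b c = mx3 (a * a) (a * b) (a * c)
    (a * b) (b * b) (b * c) (a * c) (b * c) (c * c) :> 'M[F]_3.
  by apply/matrixP => i j; rewrite mxE big_ord1; ord3 i; ord3 j; rewrite !mxE //= mulrC.
have -> : 0 = mx3 0 0 0 0 0 0 0 0 0 :> 'M[F]_3.
  by apply/matrixP => i j; ord3 i; ord3 j; rewrite !mxE.
by gen3 v; rewrite vv /fr; ring3.
Qed.

Fact fr_delta2 i j (x y : F) : x * y = 1 ->
  let N := x *: delta_mx i i + y *: delta_mx j j + (delta_mx i j + delta_mx j i) in fr N N = 0.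
Proof.
move=> xy N.
have x0 : x != 0.
  by apply/eqP => x0; move/eqP: xy; rewrite x0 mul0r eq_sym oner_eq0.
have yE : y = x^-1 by apply: (mulfI x0); rewrite xy mulfV.
(* N is [x^-1] times [v^T *m v], hence of rank one. *)
pose v : 'rV[F]_3 := x *: delta_mx 0 i + delta_mx 0 j.
have vT : v^T = x *: delta_mx i 0 + delta_mx j 0.
  by apply/matrixP => k l; rewrite !mxE ![(_ == i) && _]andbC ![(_ == j) && _]andbC.
have -> : N = y *: (v^T *m v).
  rewrite vT /v !(mulmxDl, mulmxDr) -!scalemxAl -!scalemxAr !mul_delta_mx /N yE.
  move: (delta_mx i i) (delta_mx i j) (delta_mx j i) (delta_mx j j) => A B D E.
  by apply/matrixP => k l; rewrite !mxE; field.
by rewrite fr_scale fr_vec scaler0.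
Qed.

Fact fr_delta i : fr (delta_mx i i) (delta_mx i i) = 0 :> 'M[F]_3.
Proof. by have := fr_vec (delta_mx 0 i); rewrite trmx_delta mul_delta_mx. Qed.

Fact sym_basis X : X^T = X -> X = X o0 o0 *: delta_mx o0 o0 + X o1 o1 *: delta_mx o1 o1
  + X o2 o2 *: delta_mx o2 o2 + X o0 o1 *: (delta_mx o0 o1 + delta_mx o1 o0)
  + X o0 o2 *: (delta_mx o0 o2 + delta_mx o2 o0) + X o1 o2 *: (delta_mx o1 o2 + delta_mx o2 o1).
Proof.
move=> hX; rewrite !delta_mx3 !ord3_eq /= {1}(sym_mx3E hX).
by ring3.
Qed.

Fact det_offdiag (a b c : F) : \det (a *: (delta_mx o0 o1 + delta_mx o1 o0)
  + b *: (delta_mx o0 o2 + delta_mx o2 o0) + c *: (delta_mx o1 o2 + delta_mx o2 o1)) = 2 * (a * b * c).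
Proof. by rewrite !delta_mx3 !ord3_eq /=; ring3. Qed.

Fact double_eq (V : lmodType F) (u v : V) : 4^-1 *: (2 *: u - v - v) = 0 -> u = v.
Proof.
move/eqP; rewrite scaler_eq0 invr_eq0 pnatr_eq0 /= => /eqP h.
apply/eqP; rewrite -subr_eq0; apply/eqP; apply: (@scalerI _ _ 2); first by rewrite pnatr_eq0.
rewrite scaler0 -h scalerBr -addrA; congr (_ + _).
by rewrite -opprD -mulr2n scaler_nat.
Qed.

Fact double_eq_scal (f ab : F) : 8^-1 * (f + f - 3 * (ab + ab)) = 0 -> f = 3 * ab.
Proof.
move/eqP; rewrite mulf_eq0 invr_eq0 pnatr_eq0 /= => /eqP h.
apply/eqP; rewrite -subr_eq0; apply/eqP; apply: (@mulfI _ 2); first by rewrite pnatr_eq0.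
by rewrite mulr0 -h; ring.
Qed.

Fact sum_delta : delta_mx o0 o0 + delta_mx o1 o1 + delta_mx o2 o2 = 1%:M :> 'M[F]_3.
Proof. by rewrite !delta_mx3 !ord3_eq /=; ring3. Qed.

Fact scale_conj (s : F) (g M : 'M[F]_3) : s != 0 ->
  g *m M *m g^T = (s * s) *: ((s^-1 *: g) *m M *m (s^-1 *: g)^T).
Proof.
move=> s0; have -> : (s^-1 *: g)^T = s^-1 *: g^T by apply/matrixP => i j; rewrite !mxE.
rewrite -!scalemxAl -scalemxAr !scalerA.
by rewrite -[LHS]scale1r; congr (_ *: _); field.
Qed.

Fact cube_scale (a b : F) : b != 0 -> a = b * (b^-1 ^+ 3 * (a * b * b)).
Proof. by move=> b0; field. Qed.

Fact six_halves (c : F) : 2^-1 * (6 * c) = 3 * c.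
Proof. by field. Qed.

Fact weight_values : - (3^-1 * - (3 / 8)) = 8^-1 :> F.
Proof. by field. Qed.

Fact weight_eq0 (k : F) (V : lmodType F) (v : V) : 8^-1 *: v = k *: v -> k != 8^-1 -> v = 0.
Proof.
move=> /eqP; rewrite eq_sym -subr_eq0 -scalerBl scaler_eq0 subr_eq0 => /orP[/eqP->|/eqP->] //.
by rewrite eqxx.
Qed.

(** The numbers 1/8, -1/8, -3/8 and 3/8 are the eigenvalues of the product of (0, 0, 0, 1) and (0,
    0, 1, 0) on the summands X, Y, xi and eta. *)
Fact weight_neq : [/\ - 8^-1 != 8^-1 :> F, - (3 / 8) != 8^-1 :> F, 3 / 8 != 8^-1 :> F &
  3 / 8 != - 8^-1 :> F].
Proof.
have q (m n : nat) : m != 0%N -> (m%:R / n.+1%:R : F) != 0.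
  by move=> m0; rewrite mulf_neq0 ?invr_eq0 ?pnatr_eq0.
split; rewrite -subr_eq0.
- by rewrite -opprD oppr_eq0 (_ : _ + _ = 2%:R / 8%:R) ?q //; field.
- by rewrite -opprD oppr_eq0 (_ : _ + _ = 4%:R / 8%:R) ?q //; field.
- by rewrite (_ : _ - _ = 2%:R / 8%:R) ?q //; field.
- by rewrite (_ : _ - _ = 4%:R / 8%:R) ?q //; field.
Qed.

End RankOne.

Fact two_quarters (F : numFieldType) (c : F) : 2 * (c / 4) = c / 2.
Proof. by field. Qed.

(** * The product at special elements *)

Section SpecialValues.
Variable R : realType.
Local Notation C := R[i].
Local Notation J := (jordan R).
Implicit Types (X Y Z W A B : J) (phi : 'End(J)) (P Q : freud R) (nu a b c x e : C).

Fact fr0 (F : comNzRingType) (M : 'M[F]_3) : fr M 0 = 0.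
Proof.
have -> : 0 = mx3 0 0 0 0 0 0 0 0 0 :> 'M[F]_3.
  by apply/matrixP => i j; ord3 i; ord3 j; rewrite !mxE.
by genm3 M; rewrite /fr; ring3.
Qed.

Fact jcrossC X Y : jcross X Y = jcross Y X.
Proof.
apply: subvs_inj.
exact: etrans (vsval_jcross X Y) (etrans (f_equal _ (frC _ _)) (esym (vsval_jcross Y X))).
Qed.

Fact jcross0 X : jcross X 0 = 0.
Proof. by apply: subvs_inj; rewrite vsval_jcross linear0 fr0 scaler0. Qed.

Fact jcross0l X : jcross 0 X = 0.
Proof. by rewrite jcrossC jcross0. Qed.

Fact jform0 X : jform X 0 = 0.
Proof. exact: linear0. Qed.

Fact jform0l X : jform 0 X = 0.
Proof. by rewrite jformC jform0. Qed.

Fact end0E X : (0 : 'End(J)) X = 0. Proof. exact: zero_lfunE. Qed.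

Fact jadj0 : jadj (0 : 'End(J)) = 0.
Proof.
apply: jadj_eq => X Y.
exact: etrans (f_equal (fun Z => jform Z Y) (end0E X)) (etrans (jform0l Y)
  (esym (etrans (f_equal (jform X) (end0E Y)) (jform0 X)))).
Qed.

Fact Phi_p1 phi A B nu c : Phi_fun phi A B nu (0, 0, c, 0) = (0, c *: B, nu * c, 0).
Proof.
rewrite /Phi_fun !jcross0 !jform0 !linear0 ?scaler0 !scale0r.
by rewrite ?mulr0 ?subr0 ?add0r ?addr0 ?oppr0 ?sub0r.
Qed.

Fact Phi_p0 phi A B nu c : Phi_fun phi A B nu (0, 0, 0, c) = (c *: A, 0, 0, - (nu * c)).
Proof.
rewrite /Phi_fun !jcross0 !jform0 !linear0 ?scaler0 !scale0r.
by rewrite ?mulr0 ?subr0 ?add0r ?addr0 ?oppr0 ?sub0r.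
Qed.

Fact Phi_diag nu X Y a b : Phi_fun 0 0 0 nu (X, Y, a, b) =
  (- ((3^-1 * nu) *: X), (3^-1 * nu) *: Y, nu * a, - (nu * b)).
Proof.
rewrite /Phi_fun jadj0 (end0E X) (end0E Y) !jcross0l !jform0l !scaler0.
by rewrite !addr0 !subr0 !add0r.
Qed.

Fact vee00 : vee (0 : J) 0 = 0.
Proof.
apply/lfunP => Z; rewrite [RHS]end0E; apply: subvs_inj; rewrite vsval_vee jform0.
by rewrite linear0 !mul0mx !mulmx0 addr0 scaler0 mulr0 scale0r subrr.
Qed.

Fact phi00 : - (2^-1 *: (vee (0 : J) 0 + vee 0 0)) = 0.
Proof. by rewrite vee00 addr0 scaler0 oppr0. Qed.

Fact fcross_p0p1 x e P : x * e = 1 ->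
  fcross (0, 0, 0, e) (0, 0, x, 0) P = Phi_fun 0 0 0 (- (3 / 8)) P.
Proof.
move=> xe; rewrite /fcross PhiE.
refine (f_equal5 (@Phi_fun R) phi00 _ _ _ (erefl P)).
- by rewrite jcross0 ?scaler0 ?scale0r ?subr0 ?scaler0 ?oppr0.
- by rewrite jcross0 ?scaler0 ?scale0r ?subr0 ?scaler0.
- by rewrite !jform0 mul0r !add0r xe mulr1 ?sub0r ?add0r mulrN mulrC.
Qed.

Fact fcross_p0p0 e P : fcross (0, 0, 0, e) (0, 0, 0, e) P = 0.
Proof.
transitivity (Phi_fun 0 0 0 0 P).
  rewrite /fcross PhiE.
  refine (f_equal5 (@Phi_fun R) phi00 _ _ _ (erefl P)).
  - by rewrite jcross0 ?scaler0 ?scale0r ?subr0 ?scaler0 ?oppr0.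
  - by rewrite jcross0 ?scaler0 ?scale0r ?subr0 ?scaler0.
  - by rewrite !jform0 !mul0r !addr0 mulr0 subr0 mulr0.
case: P => [[[X Y] a] b]; rewrite Phi_diag mulr0 !scale0r !mul0r !oppr0 //.
Qed.

Fact fcross_p1p1 x P : fcross (0, 0, x, 0) (0, 0, x, 0) P = 0.
Proof.
transitivity (Phi_fun 0 0 0 0 P).
  rewrite /fcross PhiE.
  refine (f_equal5 (@Phi_fun R) phi00 _ _ _ (erefl P)).
  - by rewrite jcross0 ?scaler0 ?scale0r ?subr0 ?scaler0 ?oppr0.
  - by rewrite jcross0 ?scaler0 ?scale0r ?subr0 ?scaler0.
  - by rewrite !jform0 !mulr0 !addr0 mulr0 subr0 mulr0.
case: P => [[[X Y] a] b]; rewrite Phi_diag mulr0 !scale0r !mul0r !oppr0 //.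
Qed.

Fact fcross_sqr_p1 X Y a b : fcross (X, Y, a, b) (X, Y, a, b) (0, 0, 1, 0) =
  (0, 4^-1 *: (2 *: jcross X X - b *: Y - b *: Y),
   8^-1 * (jform X Y + jform X Y - 3 * (a * b + a * b)), 0).
Proof. by rewrite /fcross PhiE Phi_p1 scale1r mulr1. Qed.

Fact fcross_sqr_p0 X Y a b : fcross (X, Y, a, b) (X, Y, a, b) (0, 0, 0, 1) =
  (- (4^-1 *: (2 *: jcross Y Y - a *: X - a *: X)), 0, 0,
   - (8^-1 * (jform X Y + jform X Y - 3 * (a * b + a * b)))).
Proof. by rewrite /fcross PhiE Phi_p0 scale1r mulr1. Qed.

Fact fcross_p0_p0 X Y a b e c : (fcross (0, 0, 0, e) (X, Y, a, b) (0, 0, 0, c)).2 = 3 / 8 * (a * e * c).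
Proof.
rewrite /fcross PhiE Phi_p0 /= jform0l jform0 mul0r !add0r mulrN mulNr opprK.
by rewrite !mulrA (mulrC 3).
Qed.

Fact jcrossZl k X Y : jcross (k *: X) Y = k *: jcross X Y.
Proof.
apply: subvs_inj; refine (etrans (vsval_jcross _ _) (esym _)).
refine (etrans (vsvalZ _ _) _); rewrite vsval_jcross vsvalZ scalerA mulrC -scalerA.
refine (f_equal _ (esym _)); move: (vsval X) (vsval Y) => x y.
rewrite /fr mxtraceZ -!scalemxAl -scalemxAr mxtraceZ -mulrA -mulrBr !scalerDr.
by rewrite !scalerN !scalerA (mulrC (\tr _) k) scale_scalar_mx.
Qed.

Fact Xp1_A X c : - (4^-1 *: (2 *: jcross (0 : J) 0 - (0 : C) *: 0 - c *: X)) = (c / 4) *: X.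
Proof. by rewrite jcross0 !scaler0 subr0 sub0r scalerN opprK scalerA mulrC. Qed.

(** Only the component to which A contributes is read off, both here and in [fcross_Xp1_Y], so the
    operator phi of this product need not be computed. *)
Fact fcross_Xp1_X X X' c : (fcross (X, 0, 0, 0) (0, 0, c, 0) (X', 0, 0, 0)).1.1.2 =
  (c / 2) *: jcross X X'.
Proof.
rewrite /fcross PhiE Xp1_A /Phi_fun /= linear0 scale0r scaler0 subr0 !addr0 jcrossZl scalerA.
by rewrite two_quarters.
Qed.

Fact fcross_Xp1_Y X Y c : (fcross (X, 0, 0, 0) (0, 0, c, 0) (0, Y, 0, 0)).1.2 =
  c / 4 * jform X Y.
Proof.
rewrite /fcross PhiE Xp1_A /Phi_fun /= mulr0 addr0 jformC linearZ /= jformC //.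
Qed.

End SpecialValues.

(** * Moving an automorphism so that it fixes two lines *)

Section Surjectivity.
Variable R : realType.
Local Notation C := R[i].
Local Notation J := (jordan R).
Implicit Types (X Y Z B : J) (P Q : freud R) (x e a b c : C) (U V : 'M[C]_(3 + 3)).
Implicit Types alpha : 'End(freud R).

Definition cross_aut alpha := injective alpha /\
  forall P Q P', alpha (fcross P Q P') = fcross (alpha P) (alpha Q) (alpha P').
Definition reach alpha := exists2 U, symp U & forall P, alpha P = gact U P.

Lemma cross_aut_gact V alpha : symp V -> cross_aut alpha -> cross_aut (gact V \o alpha)%VF.
Proof.
move=> hV [ia ha]; split=> [P Q|P Q P'].
  by rewrite !comp_lfunE => /(can_inj (fun Q => gactVK Q hV)) /ia.
by rewrite !comp_lfunE ha gact_cross.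
Qed.

Lemma reach_gact V alpha : symp V -> reach (gact V \o alpha)%VF -> reach alpha.
Proof.
move=> hV [U hU h]; exists (sympV V *m U); first exact: symp_mul (sympV_symp hV) hU.
move=> P; rewrite gactM //; last exact: sympV_symp.
by rewrite -h comp_lfunE gactVK.
Qed.

Lemma inj_surj alpha : injective alpha -> forall Q, exists P, alpha P = Q.
Proof.
move=> ia Q; exists ((alpha^-1)%VF Q).
by rewrite -comp_lfunE lker0_compfV ?id_lfunE //; apply/lker0P.
Qed.

Fact p0Z e : (0, 0, 0, e) = e *: ((0, 0, 0, 1) : freud R).
Proof. by congr (_, _, _, _); rewrite ?scaler0 //; exact: esym (mulr1 e). Qed.

Fact p1Z x : (0, 0, x, 0) = x *: ((0, 0, 1, 0) : freud R).
Proof. by congr (_, _, _, _); rewrite ?scaler0 //; exact: esym (mulr1 x). Qed.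

Fact gact_lowU_p0 Z : gact (lowU (vsval Z)) (0, 0, 0, 1) = (Z, jcross Z Z, \det (vsval Z), 1).
Proof.
apply: gact_eq => [|u]; first exact: lowU_symp (jordan_tr Z).
rewrite /tau linear0 (act_lowU (C2_neq0 R) _ (jordan_tr Z)).
by rewrite vsval_jcross.
Qed.

Fact gact_upU_p1 Z : gact (upU (vsval Z)) (0, 0, 1, 0) = (jcross Z Z, Z, 1, \det (vsval Z)).
Proof.
apply: gact_eq => [|u]; first exact: upU_symp (jordan_tr Z).
rewrite /tau linear0 (act_upU (C2_neq0 R) _ (jordan_tr Z)).
by rewrite vsval_jcross.
Qed.

Fact gact_upU_p0 Z : gact (upU (vsval Z)) (0, 0, 0, 1) = (0, 0, 0, 1).
Proof.
apply: gact_eq => [|u]; first exact: upU_symp (jordan_tr Z).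
by rewrite /tau linear0 act_upU0.
Qed.

Fact gact_diagU (D E : 'M[C]_3) X Y X' Y' a b : D^T *m E = 1%:M ->
  vsval X' = \det D *: (E *m vsval X *m E^T) -> vsval Y' = \det E *: (D *m vsval Y *m D^T) ->
  gact (diagU D E) (X, Y, a, b) = (X', Y', \det E * a, \det D * b).
Proof.
move=> h eX eY; apply: gact_eq => [|u]; first exact: diagU_symp.
rewrite /tau eX eY; exact: (act_diagU _ _ _ _ _ h).
Qed.

Fact gact_upU_eta B X Y a b : 2 * (gact (upU (vsval B)) (X, Y, a, b)).2 =
  2 * b + 2 * \tr (vsval B *m vsval X) + \tr (fr (vsval B) (vsval B) *m vsval Y)
  + 2 * a * \det (vsval B).
Proof.
rewrite gactE; exact: (competa_upU _ _ (jordan_tr B) (jordan_tr X) (jordan_tr Y)).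
Qed.

Lemma exists_upU P : P != 0 -> exists B, (gact (upU (vsval B)) P).2 != 0.
Proof.
case: P => [[[X Y] a] b] P0; apply: contrapT => h.
have {}h B : 2 * b + 2 * \tr (vsval B *m vsval X) + \tr (fr (vsval B) (vsval B) *m vsval Y)
  + 2 * a * \det (vsval B) = 0.
  rewrite -gact_upU_eta; apply/eqP; rewrite mulf_eq0 pnatr_eq0 /=; apply/negPn/negP => hB.
  by apply: h; exists B.
(* Replacing B by [t *: B] separates the degrees in B. *)
have {}h B : [/\ 2 * b = 0, 2 * \tr (vsval B *m vsval X) = 0,
    \tr (fr (vsval B) (vsval B) *m vsval Y) = 0 & 2 * a * \det (vsval B) = 0].
  by apply: cubic_eq0 => t; rewrite -upU_eta_scale -vsvalZ.
have two0 := C2_neq0 R.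
have b0 : b = 0 by have [/eqP] := h 0; rewrite mulf_eq0 (negPf two0) => /eqP.
have a0 : a = 0.
  by have [_ _ _ /eqP] := h (jid R); rewrite det1 mulr1 mulf_eq0 (negPf two0) => /eqP.
have X0 : X = 0.
  apply: jform_nondeg => B; have [_ /eqP + _ _] := h B.
  by rewrite mulf_eq0 (negPf two0) jformC jform_tr => /eqP.
have Y0 : Y = 0.
  apply: jform_nondeg => B; rewrite jformC jform_tr.
  apply: fr_nondeg (jordan_tr B) => M hM; have [_ _ + _] := h (jsym M).
  by rewrite vsval_jsymK.
by move: P0; rewrite X0 Y0 a0 b0 eqxx.
Qed.

Fact jform_jcross X : jform X (jcross X X) = 3 * \det (vsval X).
Proof. by rewrite jform_tr vsval_jcross -scalemxAr mxtraceZ tr_mul_fr six_halves. Qed.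

Fact det_of_sqr X Y a b : b != 0 -> jcross X X = b *: Y -> jform X Y = 3 * (a * b) ->
  \det (vsval X) = a * b * b.
Proof.
move=> b0 hY hn; apply: (@mulfI _ 3); first by rewrite pnatr_eq0.
by rewrite -jform_jcross hY jformZ hn mulrCA (mulrC b).
Qed.

Fact jcross_scale c X : jcross (c *: X) (c *: X) = (c * c) *: jcross X X.
Proof. by rewrite jcrossZl jcrossC jcrossZl scalerA. Qed.

Fact sqr_scale X Y a b : b != 0 -> jcross X X = b *: Y -> \det (vsval X) = a * b * b ->
  [/\ X = b *: (b^-1 *: X), Y = b *: jcross (b^-1 *: X) (b^-1 *: X) &
      a = b * \det (vsval (b^-1 *: X))].
Proof.
move=> b0 hY hd; split.
- by rewrite scalerA mulfV // scale1r.
- by rewrite jcross_scale hY !scalerA mulrA mulfV // mul1r mulVf // scale1r.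
- by rewrite vsvalZ detZ hd; exact: cube_scale.
Qed.

Fact freud_components (P : freud R) : exists X Y a b, P = (X, Y, a, b).
Proof. by case: P => [[[X Y] a] b]; exists X, Y, a, b. Qed.

Lemma aut_p0 alpha : cross_aut alpha -> exists V e,
  [/\ symp V, e != 0 & gact V (alpha (0, 0, 0, 1)) = (0, 0, 0, e)].
Proof.
move=> [ia ha].
have Q0 : alpha (0, 0, 0, 1) != 0.
  apply/eqP => h; have /ia e : alpha (0, 0, 0, 1) = alpha 0 by rewrite linear0.
  have : (1 : C) = 0 := congr1 (fun P : freud R => P.2) e.
  by apply/eqP; rewrite oner_eq0.
have [B] := exists_upU Q0; have hV := upU_symp (jordan_tr B).
move: (upU _) hV => V1 hV1; have [ia2 ha2] := cross_aut_gact hV1 (conj ia ha).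
move=> b0; have [X [Y [a [b E]]]] := freud_components (gact V1 (alpha (0, 0, 0, 1))).
have {}b0 : b != 0 := eq_ind _ (fun P : freud R => is_true (P.2 != 0)) b0 _ E.
(* As alpha is onto, the vanishing square of (0, 0, 0, 1) is transported to its image as an identity
   of operators. *)
have sq P : fcross (X, Y, a, b) (X, Y, a, b) P = 0.
  have [P' <-] := inj_surj ia2 P.
  have -> : (X, Y, a, b) = (gact V1 \o alpha)%VF (0, 0, 0, 1) by rewrite comp_lfunE E.
  by rewrite -ha2 fcross_p0p0 linear0.
(* Evaluation at (0, 0, 1, 0) isolates the B and nu of the square: [jcross X X = b *: Y] and
   [jform X Y = 3 * (a * b)], hence [\det X = a * b * b]. *)
have e1 := sq (0, 0, 1, 0); rewrite fcross_sqr_p1 in e1.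
have hB : jcross X X = b *: Y.
  by apply: double_eq; exact: (congr1 (fun P : freud R => P.1.1.2) e1).
have hn : jform X Y = 3 * (a * b).
  by apply: double_eq_scal; exact: (congr1 (fun P : freud R => P.1.2) e1).
have [eX eY ea] := sqr_scale b0 hB (det_of_sqr b0 hB hn).
set Z := b^-1 *: X in eX eY ea; have hL := lowU_symp (jordan_tr Z).
exists (sympV (lowU (vsval Z)) *m V1), b; split=> //; first exact: symp_mul (sympV_symp hL) hV1.
rewrite gactM //; last exact: sympV_symp.
have e3 : b *: (Z, jcross Z Z, \det (vsval Z), 1) = (X, Y, a, b) :> freud R.
  by congr (_, _, _, _); [exact: esym eX|exact: esym eY|exact: esym ea|exact: mulr1 b].
have e2 : gact V1 (alpha (0, 0, 0, 1)) = b *: gact (lowU (vsval Z)) (0, 0, 0, 1) :=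
  etrans E (esym (etrans (congr1 (fun Q => b *: Q) (gact_lowU_p0 Z)) e3)).
apply: (etrans (congr1 (fun Q => gact (sympV (lowU (vsval Z))) Q) e2)).
by rewrite linearZ /= gactVK // -p0Z.
Qed.

Lemma aut_p1 alpha e : cross_aut alpha -> e != 0 -> alpha (0, 0, 0, 1) = (0, 0, 0, e) ->
  exists V x, [/\ symp V, x * e = 1, gact V (alpha (0, 0, 0, 1)) = (0, 0, 0, e) &
    gact V (alpha (0, 0, 1, 0)) = (0, 0, x, 0)].
Proof.
move=> [ia ha] e0 h0.
case E : (alpha (0, 0, 1, 0)) => [[[X Y] a] b].
(* The product of (0, 0, 0, 1) and (0, 0, 1, 0) multiplies (0, 0, 0, 1) by 3/8; the last entry of
   the transported identity involves only a and e. *)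
have ae : a * e = 1.
  have h : alpha (fcross (0, 0, 0, 1) (0, 0, 1, 0) (0, 0, 0, 1)) = (3 / 8) *: (0, 0, 0, e).
    rewrite fcross_p0p1 ?mulr1 // Phi_diag !scaler0 oppr0 mulr0 mulr1 opprK p0Z.
    by rewrite linearZ /= h0.
  rewrite ha h0 E in h; have := congr1 (fun P : freud R => P.2) h.
  rewrite fcross_p0_p0 => h'; have {}h' : 3 / 8 * (a * e * e) = 3 / 8 * e := h'.
  have n0 : 3 / 8 != 0 :> C by rewrite mulf_neq0 ?invr_eq0 ?pnatr_eq0.
  by apply: (mulIf e0); rewrite mul1r; exact: (mulfI n0 h').
have a0 : a != 0.
  by apply/eqP => a0; move/eqP: ae; rewrite a0 mul0r eq_sym oner_eq0.
have sq P : fcross (X, Y, a, b) (X, Y, a, b) P = 0.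
  have [P' <-] := inj_surj ia P.
  by rewrite -E -ha fcross_p1p1 linear0.
have e1 := sq (0, 0, 0, 1); rewrite fcross_sqr_p0 in e1.
have hB : jcross Y Y = a *: X.
  apply: double_eq; apply: oppr_inj; rewrite oppr0.
  exact: (congr1 (fun P : freud R => P.1.1.1) e1).
have hn : jform Y X = 3 * (b * a).
  rewrite jformC (mulrC b); apply: double_eq_scal; apply: oppr_inj; rewrite oppr0.
  exact: (congr1 (fun P : freud R => P.2) e1).
have [eX eY ea] := sqr_scale a0 hB (det_of_sqr a0 hB hn).
set Z := a^-1 *: Y in eX eY ea; have hL := upU_symp (jordan_tr Z).
(* Upper unipotent matrices fix (0, 0, 0, 1), so the earlier normalisation survives. *)
exists (sympV (upU (vsval Z))), a; split=> //; first exact: sympV_symp.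
  by rewrite h0 p0Z linearZ /= -{1}(gact_upU_p0 Z) gactVK.
have -> : (X, Y, a, b) = a *: gact (upU (vsval Z)) (0, 0, 1, 0).
  rewrite gact_upU_p1; congr (_, _, _, _) => //.
  exact: esym (mulr1 a).
by rewrite linearZ /= gactVK // -p1Z.
Qed.

End Surjectivity.

(** * Automorphisms fixing both lines *)

Section Block.
Variable R : realType.
Local Notation C := R[i].
Local Notation J := (jordan R).
Implicit Types (X Y Z B : J) (P Q : freud R) (x e a b c : C) (U V : 'M[C]_(3 + 3)).
Implicit Types alpha : 'End(freud R).

Section BlockForm.
Variables (alpha : 'End(freud R)) (x e : C).
Hypothesis (aut : cross_aut alpha) (xe : x * e = 1).
Hypothesis (fix0 : alpha (0, 0, 0, 1) = (0, 0, 0, e)) (fix1 : alpha (0, 0, 1, 0) = (0, 0, x, 0)).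

Let x0 : x != 0.
Proof. by apply/eqP => h; move/eqP: xe; rewrite h mul0r eq_sym oner_eq0. Qed.

(** Because [x * e = 1], the product of the two fixed lines is carried to itself, so alpha commutes
    with it; its eigenspaces are the four summands, which gives the block form. *)
Let weight P : alpha (Phi_fun 0 0 0 (- (3 / 8)) P) = Phi_fun 0 0 0 (- (3 / 8)) (alpha P).
Proof.
have [_ ha] := aut.
rewrite -(@fcross_p0p1 R 1 1 P (mulr1 1)) ha fix0 fix1.
exact: fcross_p0p1.
Qed.

Fact block_X X : alpha (X, 0, 0, 0) = ((alpha (X, 0, 0, 0)).1.1.1, 0, 0, 0).
Proof.
have h := weight (X, 0, 0, 0); rewrite Phi_diag in h.
have e1 : (- ((3^-1 * - (3 / 8)) *: X), (3^-1 * - (3 / 8)) *: (0 : J), - (3 / 8) * 0, - (- (3 / 8) * 0))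
    = 8^-1 *: ((X, 0, 0, 0) : freud R).
  congr (_, _, _, _); rewrite ?scaler0 ?mulr0 ?oppr0 //.
  by rewrite -scaleNr weight_values.
rewrite e1 linearZ /= in h; case: (alpha (X, 0, 0, 0)) h => [[[X' Y'] a'] b'] h.
rewrite Phi_diag in h.
have [n1 n2 n3 _] := weight_neq C.
have wv : 3^-1 * - (3 / 8) = - 8^-1 :> C.
  by apply: oppr_inj; rewrite opprK; exact: weight_values.
have Y0 : Y' = 0.
  apply: (weight_eq0 (k := - 8^-1)) n1; rewrite -wv.
  exact: (congr1 (fun P : freud R => P.1.1.2) h).
have a0 : a' = 0.
  apply: (@weight_eq0 C _ C^o) n2.
  exact: (congr1 (fun P : freud R => P.1.2) h).
have b0 : b' = 0.
  apply: (@weight_eq0 C _ C^o) n3.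
  by have := congr1 (fun P : freud R => P.2) h; rewrite /= mulNr opprK.
by rewrite Y0 a0 b0.
Qed.

Fact block_Y Y : alpha (0, Y, 0, 0) = (0, (alpha (0, Y, 0, 0)).1.1.2, 0, 0).
Proof.
have h := weight (0, Y, 0, 0); rewrite Phi_diag in h.
have e1 : (- ((3^-1 * - (3 / 8)) *: (0 : J)), (3^-1 * - (3 / 8)) *: Y, - (3 / 8) * 0, - (- (3 / 8) * 0))
    = - 8^-1 *: ((0, Y, 0, 0) : freud R).
  congr (_, _, _, _); rewrite ?scaler0 ?mulr0 ?oppr0 //.
  by congr (_ *: _); apply: oppr_inj; rewrite opprK; exact: weight_values.
rewrite e1 linearZ /= in h; case: (alpha (0, Y, 0, 0)) h => [[[X' Y'] a'] b'] h.
rewrite Phi_diag in h.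
have [n1 n2 n3 n4] := weight_neq C.
have wv : 3^-1 * - (3 / 8) = - 8^-1 :> C.
  by apply: oppr_inj; rewrite opprK; exact: weight_values.
have X0 : X' = 0.
  have h1 : - 8^-1 *: X' = - ((3^-1 * - (3 / 8)) *: X') := congr1 (fun P : freud R => P.1.1.1) h.
  apply: (weight_eq0 (k := - 8^-1)) n1; rewrite h1 wv scaleNr opprK //.
have a0 : a' = 0.
  have h1 : - 8^-1 * a' = - (3 / 8) * a' := congr1 (fun P : freud R => P.1.2) h.
  apply: (@weight_eq0 C _ C^o) n3.
  by move: h1; rewrite !mulNr => /oppr_inj.
have b0 : b' = 0.
  have h1 : - 8^-1 * b' = - (- (3 / 8) * b') := congr1 (fun P : freud R => P.2) h.
  apply: (@weight_eq0 C _ C^o) n2.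
  by move: h1; rewrite !mulNr opprK => h2; rewrite /GRing.scale /= mulNr -h2 opprK.
by rewrite X0 a0 b0.
Qed.

Definition betaX X : J := (alpha (X, 0, 0, 0)).1.1.1.
Definition gammaY Y : J := (alpha (0, Y, 0, 0)).1.1.2.

Lemma blockE X Y a b : alpha (X, Y, a, b) = (betaX X, gammaY Y, a * x, b * e).
Proof.
have h1 Z : Z + 0 + (a *: 0 + b *: 0) = Z by rewrite !scaler0 !addr0.
have h2 Z : 0 + Z + (a *: 0 + b *: 0) = Z by rewrite !scaler0 !addr0 add0r.
have h3 c : 0 + 0 + (a * c + b * 0) = a * c by rewrite !add0r mulr0 addr0.
have h4 c : 0 + 0 + (a * 0 + b * c) = b * c by rewrite !add0r mulr0 add0r.
have -> : (X, Y, a, b) = ((X, 0, 0, 0) + (0, Y, 0, 0)) + (a *: (0, 0, 1, 0) + b *: (0, 0, 0, 1)) :> freud R.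
  congr (_, _, _, _); [exact: esym (h1 X)|exact: esym (h2 Y)|..].
    exact: (esym (etrans (h3 1) (mulr1 a))).
  exact: (esym (etrans (h4 1) (mulr1 b))).
have aD P Q : alpha (P + Q) = alpha P + alpha Q by exact: linearD.
have aZ k P : alpha (k *: P) = k *: alpha P by exact: linearZ.
rewrite aD (aD (X, 0, 0, 0)) (aD (a *: _)) 2!aZ.
rewrite block_X block_Y fix0 fix1 -/(betaX X) -/(gammaY Y).
by congr (_, _, _, _); [exact: h1|exact: h2|exact: h3|exact: h4].
Qed.

Lemma betaX_linear : linear betaX.
Proof.
move=> k X X'; rewrite /betaX.
have -> : (k *: X + X', 0, 0, 0) = k *: (X, 0, 0, 0) + (X', 0, 0, 0) :> freud R.
  have h1 : k *: (0 : J) + 0 = 0 by rewrite scaler0 addr0.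
  have h2 : k * 0 + 0 = 0 by rewrite mulr0 addr0.
  by congr (_, _, _, _); [exact: esym h1|exact: esym h2|exact: esym h2].
by rewrite linearP.
Qed.

Lemma gammaY_scale k Y : gammaY (k *: Y) = k *: gammaY Y.
Proof.
rewrite /gammaY.
have -> : (0, k *: Y, 0, 0) = k *: (0, Y, 0, 0) :> freud R.
  by congr (_, _, _, _); [exact: esym (scaler0 _ k)|exact: esym (mulr0 k)|exact: esym (mulr0 k)].
by rewrite linearZ.
Qed.

Lemma beta_cross X X' : gammaY (jcross X X') = x *: jcross (betaX X) (betaX X').
Proof.
have [_ ha] := aut.
have := ha (X, 0, 0, 0) (0, 0, 1, 0) (X', 0, 0, 0).
rewrite fix1 (block_X X) (block_X X') -/(betaX X) -/(betaX X').
case E : (fcross (X, 0, 0, 0) (0, 0, 1, 0) (X', 0, 0, 0)) => [[[X2 Y2] a2] b2].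
rewrite blockE => /(congr1 (fun P : freud R => P.1.1.2)) /=; rewrite fcross_Xp1_X => h.
have hY : Y2 = (1 / 2) *: jcross X X' by rewrite -fcross_Xp1_X E.
rewrite hY gammaY_scale in h.
apply: (@scalerI _ _ (1 / 2)); first by rewrite mul1r invr_eq0 pnatr_eq0.
have q : x / 2 = 1 / 2 * x by rewrite mul1r mulrC.
exact: etrans h (etrans (f_equal (fun k => k *: jcross (betaX X) (betaX X')) q) (esym (scalerA _ _ _))).
Qed.

Lemma beta_form X Y : jform (betaX X) (gammaY Y) = jform X Y.
Proof.
have [_ ha] := aut.
have := ha (X, 0, 0, 0) (0, 0, 1, 0) (0, Y, 0, 0).
rewrite fix1 (block_X X) (block_Y Y) -/(betaX X) -/(gammaY Y).
case E : (fcross (X, 0, 0, 0) (0, 0, 1, 0) (0, Y, 0, 0)) => [[[X2 Y2] a2] b2].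
rewrite blockE => /(congr1 (fun P : freud R => P.1.2)) /=; rewrite fcross_Xp1_Y => h.
have hY : a2 = 1 / 4 * jform X Y by rewrite -fcross_Xp1_Y E.
rewrite hY in h; have q0 : x / 4 != 0 by rewrite mulf_neq0 ?invr_eq0 ?pnatr_eq0.
by apply: (mulfI q0); rewrite -h mul1r mulrC mulrA.
Qed.

(** Three times the determinant is [jform X (jcross X X)], to which [beta_cross] and [beta_form]
    apply. *)
Lemma beta_det X : x * \det (vsval (betaX X)) = \det (vsval X).
Proof.
apply: (@mulfI _ 3); first by rewrite pnatr_eq0.
rewrite mulrCA -!jform_jcross -jformZ -beta_cross; exact: beta_form.
Qed.

Lemma beta_rank_one X : fr (vsval X) (vsval X) = 0 -> fr (vsval (betaX X)) (vsval (betaX X)) = 0.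
Proof.
move=> h; have h0 : jcross X X = 0.
  by apply: subvs_inj; rewrite vsval_jcross h scaler0 linear0.
have := beta_cross X X; rewrite h0 -(scale0r 0) gammaY_scale scale0r.
move=> /esym/eqP; rewrite scaler_eq0 (negPf x0) /= => /eqP /(congr1 (@vsval _ _ _)).
rewrite vsval_jcross linear0 => /eqP; rewrite scaler_eq0 invr_eq0 pnatr_eq0 /=.
by move=> /eqP.
Qed.

Lemma beta_id_reach : x = 1 -> e = 1 -> (forall X, betaX X = X) -> reach alpha.
Proof.
move=> x1 e1 hb; exists 1%:M; first exact: symp1.
move=> [[[X Y] a] b]; rewrite gact1 blockE hb x1 e1 !mulr1; congr (_, _, _, _).
by apply: jform_ext => Z; rewrite jformC -{1}(hb Z) beta_form jformC.
Qed.

End BlockForm.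

Definition jdelta (i j : 'I_3) : J := jsym (delta_mx i j).

Fact vsval_jdelta i : vsval (jdelta i i) = delta_mx i i.
Proof. by rewrite vsval_jsymK // trmx_delta. Qed.

Definition joff (i j : 'I_3) : J := jsym (delta_mx i j + delta_mx j i).

Fact vsval_joff i j : vsval (joff i j) = delta_mx i j + delta_mx j i.
Proof. by rewrite vsval_jsymK // linearD /= !trmx_delta addrC. Qed.

Fact jordan_basis X : let M := vsval X in X = M o0 o0 *: jdelta o0 o0 + M o1 o1 *: jdelta o1 o1
  + M o2 o2 *: jdelta o2 o2 + M o0 o1 *: joff o0 o1 + M o0 o2 *: joff o0 o2 + M o1 o2 *: joff o1 o2.
Proof.
apply: subvs_inj; rewrite !vsvalD !vsvalZ !vsval_jdelta !vsval_joff.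
exact: sym_basis (jordan_tr X).
Qed.

Lemma linear_jordan_eq (f g : J -> J) : linear f -> linear g ->
  (forall i, f (jdelta i i) = g (jdelta i i)) ->
  (forall i j : 'I_3, (i < j)%N -> f (joff i j) = g (joff i j)) -> forall X, f X = g X.
Proof.
move=> lf lg h1 h2 X.
have z (h : J -> J) : linear h -> h 0 = 0.
  by move=> lh; have := lh 1 0 0; rewrite !scale1r addr0 -{1}[h 0]addr0 => /addrI <-.
have step Y Z k : f Y = g Y -> f Z = g Z -> f (Y + k *: Z) = g (Y + k *: Z).
  by move=> e e'; rewrite addrC lf lg e e'.
rewrite (jordan_basis X) -(add0r (_ *: jdelta o0 o0)).
do 6 (refine (step _ _ _ _ _); last by [exact: h1|exact: h2]).
by rewrite !z.
Qed.

Lemma diag_block alpha x e : cross_aut alpha -> x * e = 1 ->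
  alpha (0, 0, 0, 1) = (0, 0, 0, e) -> alpha (0, 0, 1, 0) = (0, 0, x, 0) ->
  exists2 g : 'M[C]_3, \det g * \det g = e &
    forall i, vsval (betaX alpha (jdelta i i)) = g *m delta_mx i i *m g^T.
Proof.
move=> aut xe f0 f1.
have h i : exists v : 'rV[C]_3, vsval (betaX alpha (jdelta i i)) = v^T *m v.
  apply: rank_one; first exact: jordan_tr.
  by apply: (beta_rank_one aut xe f0 f1); rewrite vsval_jdelta fr_delta.
have [v hv] := fin_all_exists h.
pose g : 'M[C]_3 := \matrix_(j, k) v k 0 j.
have hg i : vsval (betaX alpha (jdelta i i)) = g *m delta_mx i i *m g^T.
  by rewrite hv /g congr_delta.
exists g => //.
(* The identity is the sum of the diagonal units, so its image is [g *m g^T] and [x] times the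
   square of [\det g] is 1. *)
have := beta_det aut xe f0 f1 (jid R); rewrite vsval_jid det1.
have -> : vsval (betaX alpha (jid R)) = g *m g^T.
  have -> : jid R = 1 *: (1 *: jdelta o0 o0 + jdelta o1 o1) + jdelta o2 o2.
    apply: subvs_inj; rewrite !(vsvalD, vsvalZ) !vsval_jdelta !scale1r vsval_jid.
    exact: esym (sum_delta _).
  rewrite !(betaX_linear alpha) !scale1r !vsvalD !hg -!mulmxDl -!mulmxDr.
  rewrite sum_delta.
  by rewrite mulmx1.
rewrite det_mulmx det_tr => h1.
have x0 : x != 0 by apply/eqP => x0; move/eqP: xe; rewrite x0 mul0r eq_sym oner_eq0.
by apply: (mulfI x0); rewrite h1 xe.
Qed.

Lemma sign_block alpha : cross_aut alpha ->
  alpha (0, 0, 0, 1) = (0, 0, 0, 1) -> alpha (0, 0, 1, 0) = (0, 0, 1, 0) ->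
  (forall i, betaX alpha (jdelta i i) = jdelta i i) -> reach alpha.
Proof.
move=> aut f0 f1 hd; have xe : 1 * 1 = 1 :> C := mulr1 1.
have lin := betaX_linear alpha.
have off (i j : 'I_3) : (i < j)%N -> exists2 c : C, c * c = 1 & betaX alpha (joff i j) = c *: joff i j.
  move=> ij.
  have [||c c1 hc] := @rank_one_family C i j (vsval (betaX alpha (joff i j))) _ ij.
  - exact: jordan_tr.
  - move=> y z yz.
    have -> : y *: delta_mx i i + z *: delta_mx j j + vsval (betaX alpha (joff i j)) =
        vsval (betaX alpha (y *: jdelta i i + (z *: jdelta j j + joff i j))).
      by rewrite !lin !hd !(vsvalD, vsvalZ) !vsval_jdelta addrA.
    apply: (beta_rank_one aut xe f0 f1).
    rewrite !(vsvalD, vsvalZ) !vsval_jdelta vsval_joff addrA.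
    exact: fr_delta2.
  by exists c => //; apply: subvs_inj; rewrite hc vsvalZ vsval_joff.
have [a a1 ha] := off o0 o1 isT; have [b b1 hb] := off o0 o2 isT.
have [c c1 hc] := off o1 o2 isT.
(* A symmetric matrix with zero diagonal and off-diagonal entries p, q, r has determinant
   [2 * (p * q * r)], and here the determinant is preserved. *)
have abc : a * b * c = 1.
  have := beta_det aut xe f0 f1 (1 *: joff o0 o1 + (1 *: joff o0 o2 + joff o1 o2)).
  rewrite !lin ha hb hc !scale1r mul1r !(vsvalD, vsvalZ) !vsval_joff !addrA det_offdiag.
  have -> : delta_mx o0 o1 + delta_mx o1 o0 + delta_mx o0 o2 + delta_mx o2 o0 + delta_mx o1 o2 + delta_mx o2 o1 =
     1 *: (delta_mx o0 o1 + delta_mx o1 o0) + 1 *: (delta_mx o0 o2 + delta_mx o2 o0)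
     + 1 *: (delta_mx o1 o2 + delta_mx o2 o1) :> 'M[C]_3 by rewrite !scale1r !addrA.
  by rewrite det_offdiag => /(mulfI (C2_neq0 R)); rewrite !mulr1.
have [d [dd ddet d1 [dab dac dbc]]] := sign_diag a1 b1 c1 abc.
set D := diag_mx d in dd ddet.
have hV := diagU_symp dd; apply: (reach_gact hV).
have aut' := cross_aut_gact hV aut.
have f0' : (gact (diagU D D) \o alpha)%VF (0, 0, 0, 1) = (0, 0, 0, 1).
  rewrite comp_lfunE f0 (@gact_diagU _ D D 0 0 0 0 0 1 dd) ?ddet ?mulr0 ?mulr1 //;
  by rewrite linear0 mulmx0 mul0mx scaler0.
have f1' : (gact (diagU D D) \o alpha)%VF (0, 0, 1, 0) = (0, 0, 1, 0).
  rewrite comp_lfunE f1 (@gact_diagU _ D D 0 0 0 0 1 0 dd) ?ddet ?mulr0 ?mulr1 //;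
  by rewrite linear0 mulmx0 mul0mx scaler0.
apply: (beta_id_reach aut' xe f0' f1') => // X.
have gX Y Z : vsval Z = D *m vsval Y *m D^T -> (gact (diagU D D) (Y, 0, 0, 0)).1.1.1 = Z.
  move=> hZ; rewrite (@gact_diagU _ D D Y 0 Z 0 0 0 dd) ?ddet ?scale1r ?hZ //.
  by rewrite linear0 mulmx0 mul0mx.
apply: (@linear_jordan_eq (betaX (gact (diagU D D) \o alpha)) id (betaX_linear _)) => {X} //.
  move=> i; rewrite /betaX comp_lfunE (block_X aut xe f0 f1) -/(betaX alpha _) hd.
  by apply: gX; rewrite vsval_jdelta diag_conj d1 scale1r.
move=> i j ij; rewrite /betaX comp_lfunE (block_X aut xe f0 f1) -/(betaX alpha _).
have [k k1 [hk dk]] : exists2 k, k * k = 1 & betaX alpha (joff i j) = k *: joff i j /\ d 0 i * d 0 j = k.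
  move: ij; ord3 i; ord3 j => // _; [exists a|exists b|exists c] => //.
apply: gX; rewrite hk vsvalZ vsval_joff -scalemxAr -scalemxAl mulmxDr mulmxDl !diag_conj.
by rewrite (mulrC (d 0 j)) dk -scalerDr scalerA k1 scale1r.
Qed.

Theorem cross_aut_reach alpha : cross_aut alpha -> reach alpha.
Proof.
move=> aut0; have [V0 [e [hV0 e0 h0]]] := aut_p0 aut0.
apply: (reach_gact hV0); have aut1 := cross_aut_gact hV0 aut0.
move: (gact V0 \o alpha)%VF aut1 (comp_lfunE (gact V0) alpha (0, 0, 0, 1)).
rewrite h0 => {alpha aut0 h0 hV0 V0} alpha aut0 h0.
have [V1 [x [hV1 xe f0 f1]]] := aut_p1 aut0 e0 h0.
apply: (reach_gact hV1); have aut1 := cross_aut_gact hV1 aut0.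
move: (gact V1 \o alpha)%VF aut1 (comp_lfunE (gact V1) alpha (0, 0, 0, 1))
  (comp_lfunE (gact V1) alpha (0, 0, 1, 0)).
rewrite f0 f1 => {alpha aut0 h0 f0 f1 hV1 V1} alpha aut f0 f1.
have [g dg hg] := diag_block aut xe f0 f1.
have g0 : \det g != 0 by apply/eqP => g0; move: e0; rewrite -dg g0 mul0r eqxx.
have gu : g \in unitmx by rewrite unitmxE unitfE.
(* The factor [s^-1] in E compensates for [gact_diagU]: there X goes to [\det D *: (E X E^T)], and
   [\det D] is [s * s], which leaves exactly [g X g^T]. *)
pose s := \det g; pose D := s *: (invmx g)^T; pose E := s^-1 *: g.
have DE : D^T *m E = 1%:M.
  have DT : D^T = s *: invmx g by apply/matrixP => i j; rewrite !mxE.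
  by rewrite DT /E -scalemxAl -scalemxAr scalerA mulfV // scale1r mulVmx.
have detD : \det D = e.
  rewrite /D detZ det_tr det_inv -dg -/s !exprS expr0 mulr1 !mulrA mulfK //.
have detE : \det E = x.
  rewrite /E detZ -/s; apply: (mulIf e0); rewrite xe -dg -/s.
  by rewrite !exprS expr0 mulr1 -!mulrA (mulrA s^-1 s) mulVf // mul1r (mulrA s^-1 s) mulVf // mul1r mulVf.
have hV := diagU_symp DE.
apply: (reach_gact (sympV_symp hV)).
have hW P Q : gact (diagU D E) Q = alpha P -> (gact (sympV (diagU D E)) \o alpha)%VF P = Q.
  by move=> h; rewrite comp_lfunE -h gactVK.
have z0 (M N : 'M[C]_3) k : vsval (0 : J) = k *: (M *m vsval (0 : J) *m N).
  by rewrite linear0 mulmx0 mul0mx scaler0.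
apply: sign_block; first exact: cross_aut_gact (sympV_symp hV) aut.
- by apply: hW; rewrite f0 (@gact_diagU _ D E 0 0 0 0 0 1 DE) // detD mulr0 mulr1.
- by apply: hW; rewrite f1 (@gact_diagU _ D E 0 0 0 0 1 0 DE) // detE mulr0 mulr1.
- move=> i; rewrite /betaX.
  suff -> : (gact (sympV (diagU D E)) \o alpha)%VF (jdelta i i, 0, 0, 0) = (jdelta i i, 0, 0, 0) by [].
  apply: hW; rewrite (block_X aut xe f0 f1).
  rewrite (@gact_diagU _ D E (jdelta i i) 0 (betaX alpha (jdelta i i)) 0 0 0 DE) ?mulr0 //.
  rewrite hg vsval_jdelta detD -dg; exact: scale_conj.
Qed.

End Block.

(** * Quaternionic matrices as complex 6 x 6 matrices *)

Section Quaternionic.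
Variable R : realType.
Local Notation C := R[i].
Local Notation cj := (@conjc R).

Definition qz (a : quat R) : C := (q1 a +i* qi a)%C.
Definition qw (a : quat R) : C := (qj a +i* qk a)%C.
Definition zquat (z w : C) : quat R :=
  Quat (complex.Re z) (complex.Im z) (complex.Re w) (complex.Im w).

(* A quaternion is z + w j with z and w complex, and j z = z^* j. *)
Lemma zquatK a : zquat (qz a) (qw a) = a. Proof. by case: a. Qed.
Lemma qz_zquat z w : qz (zquat z w) = z. Proof. by case: z. Qed.
Lemma qw_zquat z w : qw (zquat z w) = w. Proof. by case: w. Qed.
Lemma quat_zw a b : qz a = qz b -> qw a = qw b -> a = b.
Proof. by move=> h1 h2; rewrite -(zquatK a) h1 h2 zquatK. Qed.

Lemma qzD a b : qz (a + b) = qz a + qz b. Proof. by []. Qed.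
Lemma qwD a b : qw (a + b) = qw a + qw b. Proof. by []. Qed.

Lemma qzM a b : qz (a * b) = qz a * qz b - qw a * cj (qw b).
Proof.
case: a b => [a1 a2 a3 a4] [b1 b2 b3 b4]; apply/eqP; rewrite eq_complex /=.
by apply/andP; split; apply/eqP; ring.
Qed.

Lemma qwM a b : qw (a * b) = qz a * qw b + qw a * cj (qz b).
Proof.
case: a b => [a1 a2 a3 a4] [b1 b2 b3 b4]; apply/eqP; rewrite eq_complex /=.
by apply/andP; split; apply/eqP; ring.
Qed.

Lemma qz_conj a : qz (quat_conj a) = cj (qz a). Proof. by []. Qed.
Lemma qw_conj a : qw (quat_conj a) = - qw a. Proof. by []. Qed.

Definition mz m n (A : 'M[quat R]_(m, n)) : 'M[C]_(m, n) := map_mx qz A.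
Definition mw m n (A : 'M[quat R]_(m, n)) : 'M[C]_(m, n) := map_mx qw A.
Local Notation mc := (map_mx cj).

Lemma qz_sum (I : finType) (f : I -> quat R) : qz (\sum_i f i) = \sum_i qz (f i).
Proof. exact: (big_morph qz qzD). Qed.
Lemma qw_sum (I : finType) (f : I -> quat R) : qw (\sum_i f i) = \sum_i qw (f i).
Proof. exact: (big_morph qw qwD). Qed.

Lemma mzM m n p (A : 'M[quat R]_(m, n)) (B : 'M[quat R]_(n, p)) : mz (A *m B) = mz A *m mz B - mw A *m mc (mw B).
Proof.
apply/matrixP => i j; rewrite !mxE qz_sum -sumrB; apply: eq_bigr => k _.
by rewrite !mxE qzM.
Qed.

Lemma mwM m n p (A : 'M[quat R]_(m, n)) (B : 'M[quat R]_(n, p)) : mw (A *m B) = mz A *m mw B + mw A *m mc (mz B).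
Proof.
apply/matrixP => i j; rewrite !mxE qw_sum -big_split; apply: eq_bigr => k _.
by rewrite !mxE qwM.
Qed.

Definition psi (A : 'M[quat R]_3) : 'M[C]_(3 + 3) :=
  block_mx (mz A) (mw A) (- mc (mw A)) (mc (mz A)).

Lemma mcK m n (M : 'M[C]_(m, n)) : mc (mc M) = M.
Proof. by apply/matrixP => i j; rewrite !mxE conjcK. Qed.

Lemma psiM A B : psi (A *m B) = psi A *m psi B.
Proof.
rewrite /psi mulmx_block mzM mwM !map_mxD !map_mxN !map_mxM !mcK.
rewrite !mulmxN !mulNmx; congr block_mx.
- by rewrite opprD addrC.
- by rewrite addrC.
Qed.

Lemma psi1 : psi 1%:M = 1%:M.
Proof.
have z1 : mz (1%:M : 'M[quat R]_3) = 1%:M.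
  by apply/matrixP => i j; rewrite !mxE; case: (i == j).
have w1 : mw (1%:M : 'M[quat R]_3) = 0.
  by apply/matrixP => i j; rewrite !mxE; case: (i == j).
by rewrite /psi z1 w1 map_mx0 oppr0 map_mx1 -scalar_mx_block.
Qed.

Lemma psi_inj : injective psi.
Proof.
move=> A B /eq_block_mx [h1 h2 _ _]; apply/matrixP => i j.
by apply: quat_zw; [move/matrixP: h1 => /(_ i j)|move/matrixP: h2 => /(_ i j)]; rewrite !mxE.
Qed.

Lemma psi_adj A : psi (quat_adj A) = cadj (psi A).
Proof.
rewrite /psi /cadj map_block_mx tr_block_mx !map_mxN !mcK.
congr block_mx; apply/matrixP => i j; rewrite !mxE ?qz_conj ?qw_conj ?conjcK //.
by rewrite rmorphN opprK.
Qed.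

(* J conj(U) = U J singles out the image of psi. *)
Lemma psi_J A : J6 C *m mc (psi A) = psi A *m J6 C.
Proof.
rewrite /psi /J6 map_block_mx !mulmx_block !(mul0mx, mulmx0, mul1mx, mulmx1, mulNmx, mulmxN).
by rewrite !(add0r, addr0) map_mxN !mcK.
Qed.

Definition unpsi (U : 'M[C]_(3 + 3)) : 'M[quat R]_3 :=
  \matrix_(i, j) zquat (ulsubmx U i j) (- cj (dlsubmx U i j)).

Fact cjNN w : - cj (- cj w) = w.
Proof. by case: w => a b; apply/eqP; rewrite eq_complex /= !opprK !eqxx. Qed.

Lemma psiK A : unpsi (psi A) = A.
Proof.
apply/matrixP => i j; rewrite mxE /psi block_mxKul block_mxKdl !mxE.
by rewrite cjNN zquatK.
Qed.

Lemma unpsiK U : J6 C *m mc U = U *m J6 C -> psi (unpsi U) = U.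
Proof.
rewrite -[U]submxK; move: (ulsubmx U) (ursubmx U) (dlsubmx U) (drsubmx U) => a b c d.
rewrite /J6 map_block_mx !mulmx_block !(mul0mx, mulmx0, mul1mx, mulmx1, mulNmx, mulmxN).
rewrite !(add0r, addr0) => /eq_block_mx [h1 h2 _ _].
have hu : unpsi (block_mx a b c d) = \matrix_(i, j) zquat (a i j) (- cj (c i j)).
  by rewrite /unpsi block_mxKul block_mxKdl.
rewrite /psi hu; congr block_mx; apply/matrixP => i j; rewrite !mxE ?qz_zquat ?qw_zquat //.
- by move/matrixP: h1 => /(_ i j); rewrite !mxE => ->; rewrite opprK.
- exact: cjNN.
- by move/matrixP: h2 => /(_ i j); rewrite !mxE => <-; rewrite conjcK.
Qed.

Lemma Sp3_unitary A : Sp3 A -> psi A *m cadj (psi A) = 1%:M.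
Proof. by move=> h; rewrite -psi_adj -psiM h psi1. Qed.

(** Any two of the conditions unitary, symplectic and [J conj U = U J] imply the third. Here [psi_J]
    and unitarity are used; [symp_psi] uses the other two to land in the image of [psi]. *)
Lemma psi_symp A : Sp3 A -> symp (psi A).
Proof.
move=> /Sp3_unitary h; have hT : cadj (psi A) *m J6 C = J6 C *m (psi A)^T.
  have := congr1 trmx (psi_J A); rewrite !trmx_mul -/(cadj (psi A)) J6_tr mulmxN mulNmx.
  by move=> /oppr_inj.
rewrite -[psi A]trmxK; apply: symp_transp.
by rewrite /symp trmxK -mulmxA -hT mulmxA h mul1mx.
Qed.

Lemma symp_psi U : symp U -> cadj U *m U = 1%:M -> exists2 A, Sp3 A & psi A = U.
Proof.
move=> hU hu; have hJU : J6 C *m mc U = U *m J6 C.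
  have e := symp_tr hU.
  have : mc (cadj U *m U) = 1%:M by rewrite hu map_mx1.
  rewrite map_mxM /cadj map_trmx mcK => h.
  by rewrite -{1}e -!mulmxA h mulmx1.
exists (unpsi U); last exact: unpsiK.
apply: psi_inj; rewrite psiM psi_adj unpsiK // psi1.
exact: mulmx1C.
Qed.

End Quaternionic.

(** * Recovering a symplectic matrix from its action *)

Section RecoveryFacts.
Variable F : fieldType.

Local Notation O := (0 : 'M[F]_3).
Fact block_p0_Y (Y : 'M[F]_3) :
  block_mx (- 4 *: (fr O O - 1 *: Y - 0 *: O))
   (4 *: (Y *m O + O *m O) + (2 * (0 * 0 + 0 * 1) - 2 * \tr (Y *m O + O *m O))%:M)
   (4 *: (O *m Y + O *m O) + (2 * (0 * 0 + 0 * 1) - 2 * \tr (Y *m O + O *m O))%:M)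
   (- 4 *: (fr O Y - 0 *: O - 0 *: O)) = block_mx (4 *: Y) O O O.
Proof.
have m0 : (0 : F)%:M = 0 :> 'M[F]_3 by rewrite -scalemx1 scale0r.
rewrite (frC 0 Y) !fr0 scale1r.
rewrite !(mulmx0, mul0mx, addr0, scaler0, mxtrace0, mulr0, mul0r, subr0) m0 ?addr0 ?add0r.
by rewrite ?sub0r ?add0r scaleNr scalerN opprK.
Qed.

Fact mul_delta_tr m (A : 'M[F]_(m, 3)) i j a b : (A *m delta_mx i j *m A^T) a b = A a i * A b j.
Proof.
rewrite -(mul_delta_mx (0 : 'I_1)) mulmxA -mulmxA -colE -trmx_delta -trmx_mul -colE.
by rewrite mxE big_ord1 !mxE.
Qed.

Fact competa_act W : competa (act W (trif 0 0 0 1)) = \det (ulsubmx W) :> F.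
Proof.
rewrite /competa /act /e0 -{1 2 3}[W]submxK mul_row_block trif_row tr_block_mx !mulmx_block block_mxKul.
rewrite !(mul0mx, mulmx0, add0r, addr0, linear0) scale1r crossmx_conj.
have KZ k (x : 'rV[F]_3) : k *: crossmx x = crossmx (k *: x) by rewrite linearZ.
by rewrite KZ scale0r linear0 mulmx0 mul0mx addr0 crossmxK !mxE eqxx mulr1.
Qed.

Fact scale_lsubmx m n p (M : 'M[F]_(m, n + p)) (k : F) a j :
  (k *: lsubmx M) a j = k * M a (lshift p j).
Proof. by rewrite !mxE. Qed.

Fact symp_block1 (b d : 'M[F]_3) : symp (block_mx 1%:M b 0 d) -> d = 1%:M /\ b^T = b.
Proof.
rewrite /symp /J6 tr_block_mx !mulmx_block !trmx1 !trmx0.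
rewrite !(mul0mx, mulmx0, mul1mx, mulmx1, add0r, addr0, mulNmx, mulmxN).
move=> /eq_block_mx [_ d1 _]; rewrite d1 trmx1 mul1mx mulmx1 => /eqP.
by rewrite addrC subr_eq0 => /eqP.
Qed.

(** With u = W_00, v = W_aj, w = W_0j and x = W_a0 this is the combination taken in [col_num]; the
    mixed term [w * x] cancels. *)
Fact quad_identity (u v w x : F) :
  2 * (4 * (u * u + u * u)) * (4 * (u * v + w * x)) - 4 * (u * w + w * u) * (4 * (u * x + u * x))
  = 64 * u ^+ 3 * v.
Proof. by ring. Qed.

End RecoveryFacts.

Fact rec_scalar (F : numFieldType) (u d : F) : (64 * u ^+ 3) ^+ 3 * d != 0 ->
  8 * (4 * (u * u + u * u)) ^+ 3 * d * ((64 * u ^+ 3) ^+ 3 * d)^-1 * (64 * u ^+ 3) = 1.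
Proof.
rewrite mulf_eq0 negb_or expf_eq0 /= mulf_eq0 negb_or expf_eq0 /= => /andP[/andP[_ u0] d0].
by field; rewrite u0 d0.
Qed.

Section Recovery.
Variable R : realType.
Local Notation C := R[i].
Local Notation l := (lshift 3).
Implicit Types (A B : 'M[quat R]_3) (alpha : 'End(freud R)) (W : 'M[C]_(3 + 3)).
Implicit Types (t : 'rV[C]_(3 + 3) -> 'M[C]_(3 + 3)).

Section Formula.
Variables (t0 : 'rV[C]_(3 + 3) -> 'M[C]_(3 + 3)) (ts : 'I_3 -> 'rV[C]_(3 + 3) -> 'M[C]_(3 + 3)).
(** Taken for arbitrary tensors, since the local inverse must be a function on an open set of the
    ambient space; for the images under W the entries are [4 (W_a0 W_bj + W_aj W_b0)]. *)
Definition col_quad (j : 'I_3) : 'M[C]_(3 + 3) := trmat t0 (ts j).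
Definition col_num : 'M[C]_(3 + 3, 3) := \matrix_(a, j)
  (2 * col_quad o0 (l o0) (l o0) * col_quad j (l o0) a
   - col_quad j (l o0) (l o0) * col_quad o0 (l o0) a).
Fact col_num_entry a j : col_num a j =
  2 * col_quad o0 (l o0) (l o0) * col_quad j (l o0) a
  - col_quad j (l o0) (l o0) * col_quad o0 (l o0) a.
Proof. by rewrite mxE. Qed.
Definition col_den : C := \det (usubmx col_num).
(** The factor is the inverse of [64 u^3], where u = W_00, written in terms of the data: with
    [q = 8 u^2] the value of [col_quad] at o0, [8 q^3] is [(64 u^3)^2], while [col_den] divided by
    [competa t0] is [(64 u^3)^3]. *)
Definition col_rec : 'M[C]_(3 + 3, 3) :=
  (8 * col_quad o0 (l o0) (l o0) ^+ 3 * competa t0 * col_den^-1) *: col_num.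
End Formula.

Definition tp0 (phi : freud R -> freud R) := tau (phi (0, 0, 0, 1)).
(** For j = 0 the matrix is [2 E_00], which gives [col_quad] the same formula for all j. *)
Definition tpt (phi : freud R -> freud R) (j : 'I_3) := tau (phi (0, joff R o0 j, 0, 0)).

Fact trmat_p0_Y (Y : jordan R) :
  trmat (tau (0, 0, 0, 1)) (tau (0, Y, 0, 0)) = block_mx (4 *: vsval Y) 0 0 0.
Proof. by rewrite trmat_tau linear0; exact: block_p0_Y. Qed.

Fact col_quadE W j a b : symp W -> col_quad (tp0 (gact W)) (tpt (gact W)) j a b =
  4 * (W a (l o0) * W b (l j) + W a (l j) * W b (l o0)).
Proof.
move=> hW; rewrite /col_quad /tp0 /tpt !tau_gact // trmat_act //; try exact: tau_tens.
rewrite trmat_p0_Y -{1 2}[W]hsubmxK mul_row_block tr_row_mx mul_row_col.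
rewrite !(mulmx0, mul0mx, addr0) -scalemxAr -scalemxAl vsval_joff mulmxDr mulmxDl.
by rewrite mxE mxE !mul_delta_tr !mxE.
Qed.

Fact col_numE W : symp W -> col_num (tp0 (gact W)) (tpt (gact W)) =
  (64 * W (l o0) (l o0) ^+ 3) *: lsubmx W.
Proof.
move=> hW; apply/matrixP => a j; have q k c := col_quadE k (l o0) c hW.
apply: (etrans (col_num_entry _ _ a j)); apply: (etrans _ (esym (scale_lsubmx _ _ a j))).
apply: (etrans _ (quad_identity _ _ (W (l o0) (l j)) (W a (l o0)))).
exact (f_equal2 (fun c d : C => c - d)
  (f_equal2 *%R (f_equal (fun c : C => 2 * c) (q o0 (l o0))) (q j a))
  (f_equal2 *%R (q j (l o0)) (q o0 a))).
Qed.

Fact competa_tp0 W : symp W -> competa (tp0 (gact W)) = \det (ulsubmx W).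
Proof. by move=> hW; rewrite /tp0 tau_gact // /tau linear0 competa_act. Qed.

Fact col_denE W : symp W -> col_den (tp0 (gact W)) (tpt (gact W)) =
  (64 * W (l o0) (l o0) ^+ 3) ^+ 3 * \det (ulsubmx W).
Proof.
move=> hW; rewrite /col_den col_numE //.
have -> : usubmx ((64 * W (l o0) (l o0) ^+ 3) *: lsubmx W) = (64 * W (l o0) (l o0) ^+ 3) *: ulsubmx W.
  by apply/matrixP => i j; rewrite !mxE.
by rewrite detZ.
Qed.

Lemma col_recE W : symp W -> col_den (tp0 (gact W)) (tpt (gact W)) != 0 ->
  col_rec (tp0 (gact W)) (tpt (gact W)) = lsubmx W.
Proof.
move=> hW; rewrite /col_rec col_denE // => h.
by rewrite col_numE // col_quadE // competa_tp0 // scalerA rec_scalar // scale1r.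
Qed.

Lemma col_den1 : col_den (tp0 (gact 1%:M)) (tpt (gact 1%:M)) != 0 :> C.
Proof.
rewrite col_denE; last exact: symp1.
have -> : ulsubmx (1%:M : 'M[C]_(3 + 3)) = 1%:M by rewrite scalar_mx_block block_mxKul.
by rewrite det1 mulr1 mxE eqxx expr1n mulr1 expf_neq0 // pnatr_eq0.
Qed.

Fact gact_ext W W' : (forall P, gact W P = gact W' P) ->
  tp0 (gact W) = tp0 (gact W') /\ tpt (gact W) = tpt (gact W').
Proof.
move=> h; have e : (fun P => gact W P) = (fun P => gact W' P) := funext h.
split; first exact (f_equal (fun p : freud R -> freud R => tp0 p) e).
exact (f_equal (fun p : freud R -> freud R => tpt p) e).
Qed.

(** The recovery formula, applied to W and to 1, shows that their left halves agree. What remains is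
    an upper unipotent matrix, which is detected by its effect on (0, 0, 1, 0). *)
Lemma gact_id W : symp W -> (forall P, gact W P = P) -> W = 1%:M.
Proof.
move=> hW h; have [e0 e1] := @gact_ext W 1%:M (fun P => etrans (h P) (esym (gact1 P))).
have d1 := col_den1.
have d2 : col_den (tp0 (gact W)) (tpt (gact W)) != 0 :=
  eq_ind_r (fun c : C => is_true (c != 0)) d1 (f_equal2 col_den e0 e1).
have lW : lsubmx W = lsubmx 1%:M.
  exact: etrans (esym (col_recE hW d2)) (etrans (f_equal2 col_rec e0 e1)
    (col_recE (symp1 _) d1)).
have W0 : W = block_mx 1%:M (ursubmx W) 0 (drsubmx W).
  rewrite -[LHS]submxK; congr block_mx; apply/matrixP => i j.
    have := congr1 (fun M : 'M[C]_(3 + 3, 3) => M (lshift 3 i) j) lW.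
    by rewrite /= !mxE => ->; rewrite eq_lshift.
  have := congr1 (fun M : 'M[C]_(3 + 3, 3) => M (rshift 3 i) j) lW.
  by rewrite /= !mxE => ->; rewrite eq_rlshift.
move: hW h; rewrite W0; move: (ursubmx W) (drsubmx W) => b d hW h.
have [d1' hb] := symp_block1 hW; rewrite {}d1' in hW h *.
have eb : block_mx 1%:M b 0 1%:M = upU (vsval (jsym b)) by rewrite /upU vsval_jsymK.
have b0 := etrans (esym (gact_upU_p1 (jsym b)))
  (etrans (congr1 (fun M => gact M (0, 0, 1, 0)) (esym eb)) (h (0, 0, 1, 0))).
have {}b0 : jsym b = 0 := congr1 (fun P : freud R => P.1.1.2) b0.
by rewrite -(vsval_jsymK hb) b0 linear0 -scalar_mx_block.
Qed.

Definition gspin A : 'End(freud R) := gact (psi A).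

Lemma gspin_E7R A : Sp3 A -> E7R (gspin A).
Proof.
move=> hA; have hU := psi_symp hA.
have k0 : lker (gspin A) == 0%VS.
  by apply/lker0P => P Q; exact: (can_inj (fun P => gactVK P hU)).
split=> // P Q.
  apply/(lker0_conj _ _ k0); apply/lfunP => P'.
  by rewrite !comp_lfunE; exact: gact_cross.
rewrite /gspin fherm_gact // -gactM //; last exact: cadj_symp.
by rewrite (mulmx1C (Sp3_unitary hA)) gact1.
Qed.

Lemma E7R_gspin alpha : E7R alpha -> exists2 A, Sp3 A & gspin A = alpha.
Proof.
move=> [k0 hc hh].
have aut : cross_aut alpha.
  split; first exact/lker0P.
  move=> P Q P'; have /(lker0_conj _ _ k0) := hc P Q.
  by move/(congr1 (fun f : 'End(freud R) => f P')); rewrite !comp_lfunE.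
have [U hU h] := cross_aut_reach aut.
(* Invariance of the Hermitian form says that the adjoint [gact (cadj U)] inverts [gact U];
   faithfulness turns this into unitarity of U. *)
have hu : cadj U *m U = 1%:M.
  apply: gact_id => [|P]; first exact: symp_mul (cadj_symp hU) hU.
  rewrite gactM //; last exact: cadj_symp.
  by apply: fherm_inj => Q; rewrite -fherm_gact // -!h hh.
have [A hA hAU] := symp_psi hU hu; exists A => //.
by apply/lfunP => P; rewrite /gspin hAU h.
Qed.

Lemma gspinM A B : Sp3 A -> Sp3 B -> gspin (A *m B) = (gspin A \o gspin B)%VF.
Proof.
move=> hA hB; apply/lfunP => P; rewrite comp_lfunE /gspin psiM.
by apply: gactM; exact: psi_symp.
Qed.

Lemma quat_adj_mul A : Sp3 A -> quat_adj A *m A = 1%:M.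
Proof. by move=> hA; have := Sp3_inv hA; rewrite /Sp3 /= quat_adjK. Qed.

Lemma gspin_adjVK A P : Sp3 A -> gspin (quat_adj A) (gspin A P) = P.
Proof.
move=> hA; rewrite /gspin -gactM; try by apply: psi_symp => //; exact: Sp3_inv.
by rewrite -psiM quat_adj_mul // psi1 gact1.
Qed.

Lemma gspin_inj A B : Sp3 A -> Sp3 B -> gspin A = gspin B -> A = B.
Proof.
move=> hA hB h; have hA' := Sp3_inv hA.
have hP P : gact (psi (quat_adj A *m B)) P = P :=
  etrans (congr1 (fun f : 'End(freud R) => f P) (gspinM hA' hB))
   (etrans (comp_lfunE _ _ P)
     (etrans (congr1 (fun f : 'End(freud R) => gspin (quat_adj A) (f P)) (esym h))
       (gspin_adjVK P hA))).
have hS : symp (psi (quat_adj A *m B)) := psi_symp (Sp3_mul hA' hB).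
have e : quat_adj A *m B = 1%:M := psi_inj (etrans (gact_id hS hP) (esym (psi1 R))).
have e2 : A *m (quat_adj A *m B) = A by rewrite e mulmx1.
by rewrite -[LHS]e2 mulmxA hA mul1mx.
Qed.

End Recovery.

(** * Smooth dependence of the action and of the recovery formula *)

Section SmoothGroup.
Variable R : realType.
Local Notation C := R[i].
Local Notation freud := (freud R).
Implicit Types (P Q : freud).

Section OnOpen.
Context {V : normedModType R}.
Variable U : set V.
Hypothesis Uop : open U.
Local Notation csm := (csmooth U).
Local Notation mxsm := (mxsmooth U).

Fact mxsmooth_block m1 m2 n1 n2 (a : V -> 'M[C]_(m1, n1)) (b : V -> 'M[C]_(m1, n2))
    (c : V -> 'M[C]_(m2, n1)) (d : V -> 'M[C]_(m2, n2)) :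
  mxsm a -> mxsm b -> mxsm c -> mxsm d -> mxsm (fun x => block_mx (a x) (b x) (c x) (d x)).
Proof.
move=> sa sb sc sd i j.
case: (split_ordP i) => i' ->; case: (split_ordP j) => j' ->.
- by apply: (csmooth_ext Uop _ (sa i' j')) => x _; rewrite block_mxEul.
- by apply: (csmooth_ext Uop _ (sb i' j')) => x _; rewrite block_mxEur.
- by apply: (csmooth_ext Uop _ (sc i' j')) => x _; rewrite block_mxEdl.
- by apply: (csmooth_ext Uop _ (sd i' j')) => x _; rewrite block_mxEdr.
Qed.

Fact mxsmooth_tr m n (a : V -> 'M[C]_(m, n)) : mxsm a -> mxsm (fun x => (a x)^T).
Proof. by move=> sa i j; apply: (csmooth_ext Uop _ (sa j i)) => x _; rewrite mxE. Qed.

Fact mxsmooth_cst m n (M : 'M[C]_(m, n)) : mxsm (fun=> M).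
Proof. by move=> i j; exact: csmooth_cst. Qed.

Fact csmoothN (f : V -> C) : csm f -> csm (fun x => - f x).
Proof.
move=> sf; apply: (csmooth_ext Uop _ (csmoothM Uop (csmooth_cst Uop (-1)) sf)) => x _.
by rewrite mulN1r.
Qed.

Fact csmoothX (f : V -> C) n : csm f -> csm (fun x => f x ^+ n).
Proof.
move=> sf; elim: n => [|n IH]; first exact: csmooth_cst.
by apply: (csmooth_ext Uop _ (csmoothM Uop sf IH)) => x _; rewrite exprS.
Qed.

Definition tsmooth (t : V -> 'rV[C]_(3 + 3) -> 'M[C]_(3 + 3)) :=
  forall u, mxsm (fun x => t x u).

Fact tsmooth_act (w : V -> 'M[C]_(3 + 3)) P : mxsm w -> tsmooth (fun x => act (w x) (tau P)).
Proof.
move=> sw u; rewrite /act; apply: mxsmoothM => //; last exact: mxsmooth_tr.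
apply: mxsmoothM => // i j.
have sum (v : V -> 'rV[C]_(3 + 3)) x : tau P (v x) i j = \sum_a v x 0 a * tau P (delta_mx 0 a) i j.
  rewrite (tens_sum (v x) (tau_tens P)) summxE; apply: eq_bigr => a _; by rewrite mxE.
apply: (csmooth_ext Uop (h := fun x => \sum_a (u *m w x) 0 a * tau P (delta_mx 0 a) i j)) => [x _|].
  exact: esym (sum (fun x => u *m w x) x).
apply: csmooth_sum => // a; apply: csmoothM => //; last exact: csmooth_cst.
by apply: mxsmoothM => // i' j'; exact: csmooth_cst.
Qed.

Fact csmooth_competa t : tsmooth t -> csm (fun x => competa (t x)).
Proof.
move=> st; apply: (csmooth_ext Uop _ (st (e0 C o0) (lshift 3 o1) (lshift 3 o2))) => x _.
by rewrite /competa /crossvec !mxE.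
Qed.

Fact csmooth_compxi t : tsmooth t -> csm (fun x => compxi (t x)).
Proof.
move=> st; apply: (csmooth_ext Uop _ (st (e1 C o0) (rshift 3 o1) (rshift 3 o2))) => x _.
by rewrite /compxi /crossvec !mxE.
Qed.

Fact mxsmooth_compX t : tsmooth t -> mxsm (fun x => compX (t x)).
Proof.
move=> st i j; ord3 j; [have h := st (e1 C i) (lshift 3 o1) (lshift 3 o2)
  | have h := st (e1 C i) (lshift 3 o2) (lshift 3 o0) | have h := st (e1 C i) (lshift 3 o0) (lshift 3 o1)];
by apply: (csmooth_ext Uop _ h) => x _; rewrite !mxE.
Qed.

Fact mxsmooth_compY t : tsmooth t -> mxsm (fun x => compY (t x)).
Proof.
move=> st i j; ord3 j; [have h := st (e0 C i) (rshift 3 o1) (rshift 3 o2)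
  | have h := st (e0 C i) (rshift 3 o2) (rshift 3 o0) | have h := st (e0 C i) (rshift 3 o0) (rshift 3 o1)];
by apply: (csmooth_ext Uop _ h) => x _; rewrite !mxE.
Qed.

(** For linear L this is the value at [pi t], as a combination of tensor components with constant
    coefficients, hence visibly smooth in the tensor. *)
Definition pi_form (L : freud -> C) t : C :=
  \sum_i \sum_j compX t i j * L (jsym (delta_mx i j), 0, 0, 0)
    + \sum_i \sum_j compY t i j * L (0, jsym (delta_mx i j), 0, 0)
    + compxi t * L (0, 0, 1, 0) + competa t * L (0, 0, 0, 1).

Fact pi_expand (L : freud -> C) t : (forall a P Q, L (a *: P + Q) = a * L P + L Q) ->
  L (pi t) = pi_form L t.
Proof.
move=> lL; rewrite /pi_form.
have L0 : L 0 = 0 by have := lL 1 0 0; rewrite scale1r addr0 mul1r -{1}[L 0]addr0 => /addrI.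
have LD P Q : L (P + Q) = L P + L Q by have := lL 1 P Q; rewrite scale1r mul1r.
have LZ a P : L (a *: P) = a * L P by have := lL a P 0; rewrite L0 !addr0.
have Lsum (f : jordan R -> freud) (M : 'M[C]_3) :
    (forall a X Y, f (a *: X + Y) = a *: f X + f Y) ->
    L (f (jsym M)) = \sum_i \sum_j M i j * L (f (jsym (delta_mx i j))).
  move=> lf.
  have f0 : f 0 = 0 by have := lf 1 0 0; rewrite !scale1r addr0 -{1}[f 0]addr0 => /addrI.
  have h (I : Type) (r : seq I) (c : I -> C) (X : I -> jordan R) :
      L (f (\sum_(k <- r) c k *: X k)) = \sum_(k <- r) c k * L (f (X k)).
    elim: r => [|k r IH]; first by rewrite !big_nil f0 L0.
    by rewrite !big_cons lf lL IH.
  have -> : jsym M = \sum_(p : 'I_3 * 'I_3) M p.1 p.2 *: jsym (delta_mx p.1 p.2).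
    rewrite {1}[M]matrix_sum_delta pair_big /= linear_sum.
    by apply: eq_bigr => p _; rewrite linearZ.
  by rewrite h pair_big.
have pE : pi t = (jsym (compX t), 0, 0, 0) + (0, jsym (compY t), 0, 0)
    + compxi t *: (0, 0, 1, 0) + competa t *: (0, 0, 0, 1).
  have h1 Z (a b : C) : Z = Z + 0 + a *: 0 + b *: 0 :> jordan R by rewrite !scaler0 !addr0.
  have h2 Z (a b : C) : Z = 0 + Z + a *: 0 + b *: 0 :> jordan R by rewrite !scaler0 !addr0 add0r.
  have h3 (a b : C) : a = 0 + 0 + a * 1 + b * 0 by rewrite mulr0 mulr1 !addr0 add0r.
  have h4 (a b : C) : b = 0 + 0 + a * 0 + b * 1 by rewrite mulr0 mulr1 !add0r.
  by rewrite /pi; congr (_, _, _, _); [exact: h1|exact: h2|exact: h3|exact: h4].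
rewrite pE !LD !LZ.
rewrite (Lsum (fun X => (X, 0, 0, 0) : freud)); last first.
  move=> a X Y; have h1 : a *: 0 + 0 = 0 :> jordan R by rewrite scaler0 addr0.
  have h2 : a * 0 + 0 = 0 by rewrite mulr0 addr0.
  by congr (_, _, _, _); [exact: esym h1|exact: esym h2|exact: esym h2].
rewrite (Lsum (fun X => (0, X, 0, 0) : freud)) //.
move=> a X Y; have h1 : a *: 0 + 0 = 0 :> jordan R by rewrite scaler0 addr0.
have h2 : a * 0 + 0 = 0 by rewrite mulr0 addr0.
by congr (_, _, _, _); [exact: esym h1|exact: esym h2|exact: esym h2].
Qed.

Fact csmooth_gact (L : freud -> C) (w : V -> 'M[C]_(3 + 3)) P :
  (forall a P Q, L (a *: P + Q) = a * L P + L Q) -> mxsm w -> csm (fun x => L (gact (w x) P)).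
Proof.
move=> lL sw; have st := tsmooth_act P sw.
apply: (csmooth_ext Uop (h := fun x => pi_form L (act (w x) (tau P)))) => [x _|].
  exact: esym (etrans (congr1 L (gactE (w x) P)) (pi_expand _ lL)).
rewrite /pi_form.
apply: csmoothD => //; first apply: csmoothD => //; first apply: csmoothD => //.
- apply: csmooth_sum => // i; apply: csmooth_sum => // j.
  by apply: (csmoothM Uop _ (csmooth_cst Uop _)); exact: mxsmooth_compX.
- apply: csmooth_sum => // i; apply: csmooth_sum => // j.
  by apply: (csmoothM Uop _ (csmooth_cst Uop _)); exact: mxsmooth_compY.
- by apply: (csmoothM Uop _ (csmooth_cst Uop _)); exact: csmooth_compxi.
- by apply: (csmoothM Uop _ (csmooth_cst Uop _)); exact: csmooth_competa.
Qed.

Section Rational.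
Variables (t0 : V -> 'rV[C]_(3 + 3) -> 'M[C]_(3 + 3)) (ts : V -> 'I_3 -> 'rV[C]_(3 + 3) -> 'M[C]_(3 + 3)).
Hypothesis st0 : tsmooth t0.
Hypothesis sts : forall j, tsmooth (fun x => ts x j).

Fact mxsmooth_quad j : mxsm (fun x => col_quad (t0 x) (ts x) j).
Proof.
move=> a b.
apply: (csmooth_ext Uop (h := fun x => trform (t0 x) (ts x j) (delta_mx 0 a) (delta_mx 0 b))) => [x _|].
  by rewrite mxE.
rewrite /trform.
by repeat first [apply: (csmoothD Uop) | apply: (csmoothM Uop) | apply: (csmooth_cst Uop)
  | apply: csmoothN | apply: (csmooth_tr Uop) | apply: st0 | apply: sts | apply: mxsmooth_tr
  | apply: mxsmooth_cst | apply: (mxsmoothM Uop)].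
Qed.

Fact mxsmooth_num : mxsm (fun x => col_num (t0 x) (ts x)).
Proof.
move=> a j; pose q x k := col_quad (t0 x) (ts x) k (lshift 3 o0).
apply: (csmooth_ext Uop (h := fun x =>
  2 * q x o0 (lshift 3 o0) * q x j a - q x j (lshift 3 o0) * q x o0 a)) => [x _|].
  by rewrite mxE.
apply: (csmoothD Uop).
  by apply: (csmoothM Uop); [apply: (csmoothM Uop); [exact: csmooth_cst|]|]; exact: mxsmooth_quad.
by apply: csmoothN; apply: (csmoothM Uop); exact: mxsmooth_quad.
Qed.

Fact csmooth_den : csm (fun x => col_den (t0 x) (ts x)).
Proof.
apply: csmooth_det => // i j.
by apply: (csmooth_ext Uop _ (mxsmooth_num (lshift 3 i) j)) => x _; rewrite [RHS]mxE.
Qed.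

Fact mxsmooth_rec : (forall x, U x -> col_den (t0 x) (ts x) != 0) ->
  mxsm (fun x => col_rec (t0 x) (ts x)).
Proof.
move=> d0 a j.
apply: (csmooth_ext Uop (h := fun x => 8 * col_quad (t0 x) (ts x) o0 (lshift 3 o0) (lshift 3 o0) ^+ 3
  * competa (t0 x) * (col_den (t0 x) (ts x))^-1 * col_num (t0 x) (ts x) a j)) => [x _|].
  by rewrite [RHS]mxE.
apply: (csmoothM Uop); last exact: mxsmooth_num.
apply: (csmoothM Uop); last exact: (csmoothV Uop d0 csmooth_den).
apply: (csmoothM Uop); last exact: csmooth_competa.
apply: (csmoothM Uop); first exact: csmooth_cst.
by apply: csmoothX; exact: mxsmooth_quad.
Qed.

End Rational.
End OnOpen.

End SmoothGroup.

(** * Smoothness in coordinates *)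

Section Charts.
Context {R : realType} {V : normedModType R}.

Fact open_neq0 (f : V -> R[i]) : csmooth setT f -> open [set x | f x != 0].
Proof.
move=> [f1 f2].
pose r x := complex.Re (f x) * complex.Re (f x) + complex.Im (f x) * complex.Im (f x).
have r0 x : (f x != 0) = (r x != 0).
  rewrite /r; case: (f x) => a b /=; rewrite eq_complex /= -!expr2.
  by rewrite paddr_eq0 ?sqr_ge0 // !sqrf_eq0.
have sr : Ck_on setT 0 r by apply: (Ck_onD openT); apply: (Ck_onM openT); [exact: f1|exact: f1|exact: f2|exact: f2].
have H (x : V) : f x != 0 -> \forall y \near x, f y != 0.
  rewrite r0 => rx.
  have h : \forall y \near x, r y != 0 := cvgr_neq0 (r x) (sr x I) rx.
  by near=> y; rewrite r0; near: y; exact: h.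
by rewrite openE => x; exact: H.
Unshelve. all: by end_near.
Qed.

Variable U : set V.
Hypothesis Uop : open U.

Fact smooth_entry m n (p : V -> 'M[R]_(m, n)) i j : linear p -> continuous p ->
  smooth_on U (fun x => p x i j).
Proof.
move=> lp cp k; apply: (Ck_on_linear Uop) => [a x y|x]; first by rewrite lp !mxE.
exact: (continuous_comp (cp x) (@coord_continuous R m n i j (p x))).
Qed.

Fact smooth_on_pair m n m' n' (f : V -> 'M[R]_(m, n)) (g : V -> 'M[R]_(m', n')) :
  (forall i j, smooth_on U (fun x => f x i j)) -> (forall i j, smooth_on U (fun x => g x i j)) ->
  smooth_on U (fun x => (f x, g x)).
Proof.
move=> sf sg.
pose T1 (A : 'M[R]_(m, n)) : ('M[R]_(m, n) * 'M[R]_(m', n'))%type := (A, 0).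
pose T2 (A : 'M[R]_(m', n')) : ('M[R]_(m, n) * 'M[R]_(m', n'))%type := (0, A).
have l1 : linear T1.
  move=> a A B; have h : a *: 0 + 0 = 0 :> 'M[R]_(m', n') by rewrite scaler0 addr0.
  by rewrite /T1 -{1}h.
have l2 : linear T2.
  move=> a A B; have h : a *: 0 + 0 = 0 :> 'M[R]_(m, n) by rewrite scaler0 addr0.
  by rewrite /T2 -{1}h.
move=> k; apply: (Ck_on_ext Uop _ (Ck_onD Uop (smooth_on_mx Uop l1 sf k)
  (smooth_on_mx Uop l2 sg k))) => x _.
have h1 : f x + 0 = f x by rewrite addr0.
have h2 : 0 + g x = g x by rewrite add0r.
exact (f_equal2 (fun (a : 'M[R]_(m, n)) (b : 'M[R]_(m', n')) => (a, b)) h1 h2).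
Qed.

Fact smooth_on_quad m n (f g h l : V -> 'M[R]_(m, n)) :
  (forall i j, smooth_on U (fun x => f x i j)) -> (forall i j, smooth_on U (fun x => g x i j)) ->
  (forall i j, smooth_on U (fun x => h x i j)) -> (forall i j, smooth_on U (fun x => l x i j)) ->
  smooth_on U (fun x => (f x, g x, h x, l x)).
Proof.
move=> sf sg sh sl; pose W := ('M[R]_(m, n) * 'M[R]_(m, n) * 'M[R]_(m, n) * 'M[R]_(m, n))%type.
pose T1 A : W := (A, 0, 0, 0); pose T2 A : W := (0, A, 0, 0).
pose T3 A : W := (0, 0, A, 0); pose T4 A : W := (0, 0, 0, A).
have z a : a *: 0 + 0 = 0 :> 'M[R]_(m, n) by rewrite scaler0 addr0.
have l1 : linear T1 by move=> a A B; rewrite /T1 -{1 2 3}(z a).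
have l2 : linear T2 by move=> a A B; rewrite /T2 -{1 2 3}(z a).
have l3 : linear T3 by move=> a A B; rewrite /T3 -{1 2 3}(z a).
have l4 : linear T4 by move=> a A B; rewrite /T4 -{1 2 3}(z a).
move=> k; have := Ck_onD Uop (Ck_onD Uop (smooth_on_mx Uop l1 sf k)
  (smooth_on_mx Uop l2 sg k)) (Ck_onD Uop (smooth_on_mx Uop l3 sh k)
  (smooth_on_mx Uop l4 sl k)).
apply: (Ck_on_ext Uop) => x _.
have h1 (A : 'M[R]_(m, n)) : A + 0 + (0 + 0) = A by rewrite !addr0.
have h2 (A : 'M[R]_(m, n)) : 0 + A + (0 + 0) = A by rewrite !addr0 add0r.
have h3 (A : 'M[R]_(m, n)) : 0 + 0 + (A + 0) = A by rewrite !addr0 add0r.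
have h4 (A : 'M[R]_(m, n)) : 0 + 0 + (0 + A) = A by rewrite !add0r.
pose q4 (a b c d : 'M[R]_(m, n)) : W := (a, b, c, d).
have q4E a b c d a' b' c' d' : a = a' -> b = b' -> c = c' -> d = d' -> q4 a b c d = q4 a' b' c' d'.
  by move=> -> -> -> ->.
exact (q4E _ _ _ _ _ _ _ _ (h1 (f x)) (h2 (g x)) (h3 (h x)) (h4 (l x))).
Qed.

Fact csmooth_complex (f g : V -> R) : smooth_on U f -> smooth_on U g ->
  csmooth U (fun x => (f x +i* g x)%C).
Proof. by []. Qed.

End Charts.

Fact lfun_vbasis (K : fieldType) (V : vectType K) (f : 'End(V)) v :
  f v = \sum_i coord (vbasis {:V}) i v *: f (vbasis {:V})`_i.
Proof.
rewrite {1}(coord_vbasis (memvf v)) linear_sum; apply: eq_bigr => i _.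
by rewrite linearZ.
Qed.

(** * Smoothness of the isomorphism and of its inverse *)

Section FinalSmooth.
Variable R : realType.
Local Notation C := R[i].
Local Notation freud := (freud R).
Local Notation cj := (@conjc R).
Local Notation D := (\dim {:freud}).
Local Notation QV := ('M[R]_3 * 'M[R]_3 * 'M[R]_3 * 'M[R]_3)%type.
Local Notation EV := ('M[R]_D * 'M[R]_D)%type.
Implicit Types (P Q : freud) (A : 'M[quat R]_3) (alpha : 'End(freud)).

Definition quat_of (x : QV) : 'M[quat R]_3 :=
  \matrix_(i, j) Quat (x.1.1.1 i j) (x.1.1.2 i j) (x.1.2 i j) (x.2 i j).

Fact quat_coordK A : quat_of (quat_coord A) = A.
Proof. by apply/matrixP => i j; rewrite !mxE /=; case: (A i j). Qed.

Fact mxsmooth_psi (V : normedModType R) (U : set V) (N : V -> 'M[quat R]_3) : open U ->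
  mxsmooth U (fun x => mz (N x)) -> mxsmooth U (fun x => mw (N x)) -> mxsmooth U (fun x => psi (N x)).
Proof.
move=> Uop sz sw; apply: mxsmooth_block => // i j.
  have := csmoothN Uop (csmooth_conj Uop (sw i j)).
  by apply: (csmooth_ext Uop) => x _; rewrite !mxE.
have := csmooth_conj Uop (sz i j).
by apply: (csmooth_ext Uop) => x _; rewrite !mxE.
Qed.

Lemma smooth_gspin : smooth_map (@quat_coord R) (@end_coord R) (@Sp3 R) (@gspin R).
Proof.
(* [gspin] is defined for every quaternionic matrix, so it provides its own extension to the whole
   ambient space. *)
move=> A _; exists setT, (fun x => end_coord (gspin (quat_of x))).
split=> [|//||B _ _]; [exact: openT| |by rewrite quat_coordK].
have cf (A' B' : normedModType R) : continuous (@fst A' B') by move=> x; exact: cvg_fst.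
have cs (A' B' : normedModType R) : continuous (@snd A' B') by move=> x; exact: cvg_snd.
have c11 : continuous (fun x : QV => x.1.1) := fun x => continuous_comp (cf _ _ x) (cf _ _ x.1).
have c1 : continuous (fun x : QV => x.1.1.1) := fun x => continuous_comp (c11 x) (cf _ _ x.1.1).
have c2 : continuous (fun x : QV => x.1.1.2) := fun x => continuous_comp (c11 x) (cs _ _ x.1.1).
have c3 : continuous (fun x : QV => x.1.2) := fun x => continuous_comp (cf _ _ x) (cs _ _ x.1).
have c4 : continuous (fun x : QV => x.2) by move=> x; exact: cvg_snd.
have sz : mxsmooth setT (fun x => mz (quat_of x)).
  move=> i j; have := csmooth_complex (smooth_entry openT i j _ c1) (smooth_entry openT i j _ c2).
  by move=> h; apply: (csmooth_ext openT _ (h _ _)) => // x _; rewrite !mxE.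
have sw : mxsmooth setT (fun x => mw (quat_of x)).
  move=> i j; have := csmooth_complex (smooth_entry openT i j _ c3) (smooth_entry openT i j _ c4).
  by move=> h; apply: (csmooth_ext openT _ (h _ _)) => // x _; rewrite !mxE.
have sp := mxsmooth_psi openT sz sw.
have sM i j : csmooth setT (fun x => coord (vbasis {:freud}) j (gspin (quat_of x) (vbasis {:freud})`_i)).
  by apply: (csmooth_gact openT _ _ sp) => a P Q; rewrite linearP.
apply: (smooth_on_pair openT) => i j.
- by apply: (smooth_on_ext openT _ (sM i j).1) => x _; rewrite !mxE.
- by apply: (smooth_on_ext openT _ (sM i j).2) => x _; rewrite !mxE.
Qed.

Definition end_entry (x : EV) i j : C := (x.1 i j +i* x.2 i j)%C.
(** Evaluation of the endomorphism with coordinates x, written as a sum that is visibly smooth in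
    x. *)
Definition end_act (x : EV) P : freud :=
  \sum_i coord (vbasis {:freud}) i P *: \sum_j end_entry x i j *: (vbasis {:freud})`_j.

Fact end_coordK alpha P : end_act (end_coord alpha) P = alpha P.
Proof.
have e i j : end_entry (end_coord alpha) i j = coord (vbasis {:freud}) j (alpha (vbasis {:freud})`_i).
  by rewrite /end_entry !mxE; case: (coord _ _ _).
have h i : \sum_j end_entry (end_coord alpha) i j *: (vbasis {:freud})`_j = alpha (vbasis {:freud})`_i.
  apply: (etrans _ (esym (coord_vbasis (memvf _)))).
  by apply: eq_bigr => j _; exact (congr1 (fun c : C => c *: (vbasis {:freud})`_j) (e i j)).
apply: (etrans _ (esym (lfun_vbasis alpha P))); apply: eq_bigr => i _.
exact (congr1 (fun Q : freud => coord (vbasis {:freud}) i P *: Q) (h i)).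
Qed.

Fact tau0 u : tau (0 : freud) u = 0.
Proof.
have h : tau (0 : freud) u = tau (0 : freud) u + tau (0 : freud) u.
  have := tau_linear 1 (0 : freud) 0 u.
  by rewrite !scale1r addr0.
by apply: (addrI (tau (0 : freud) u)); rewrite -h addr0.
Qed.

Fact tau_sum (I : Type) (r : seq I) (c : I -> C) (p : I -> freud) u :
  tau (\sum_(i <- r) c i *: p i) u = \sum_(i <- r) c i *: tau (p i) u.
Proof.
elim: r => [|i r IH]; first by rewrite !big_nil tau0.
by rewrite !big_cons tau_linear IH.
Qed.

Fact csmooth_end_entry (U : set EV) i j : open U -> csmooth U (fun x => end_entry x i j).
Proof.
move=> Uop; apply: csmooth_complex.
- by apply: (@smooth_entry R EV U Uop D D (fun x => x.1)) => // x; exact: cvg_fst.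
- by apply: (@smooth_entry R EV U Uop D D (fun x => x.2)) => // x; exact: cvg_snd.
Qed.

Fact tsmooth_end_act (U : set EV) P : open U -> tsmooth U (fun x => tau (end_act x P)).
Proof.
move=> Uop u a b.
apply: (csmooth_ext Uop (h := fun x => \sum_i coord (vbasis {:freud}) i P *
   \sum_j end_entry x i j * tau (vbasis {:freud})`_j u a b)) => [x _|].
  rewrite /end_act tau_sum summxE; apply: eq_bigr => i _.
  rewrite tau_sum [RHS]mxE summxE; congr (_ * _); apply: eq_bigr => j _.
  by rewrite [RHS]mxE.
apply: (csmooth_sum Uop) => i; apply: (csmoothM Uop); first exact: csmooth_cst.
apply: (csmooth_sum Uop) => j; apply: (csmoothM Uop); last exact: csmooth_cst.
exact: csmooth_end_entry.
Qed.

(** The inverse is defined by choice, with default value 1 outside the image; the rational formula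
    only serves to show that it is smooth. *)
Definition gspin_inv alpha : 'M[quat R]_3 :=
  if pselect (exists A, Sp3 A /\ gspin A = alpha) is left p then projT1 (cid p) else 1%:M.

Lemma gspin_invP alpha : E7R alpha -> Sp3 (gspin_inv alpha) /\ gspin (gspin_inv alpha) = alpha.
Proof.
move=> h; rewrite /gspin_inv; case: pselect => [p|np]; first exact: projT2 (cid p).
by have [A hA e] := E7R_gspin h; case: np; exists A.
Qed.

Lemma gspinK A : Sp3 A -> gspin_inv (gspin A) = A.
Proof. by move=> hA; have [h1 h2] := gspin_invP (gspin_E7R hA); exact: gspin_inj h1 hA h2. Qed.

Lemma gspin_invM alpha beta : E7R alpha -> E7R beta ->
  gspin_inv (alpha \o beta)%VF = gspin_inv alpha *m gspin_inv beta.
Proof.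
move=> ha hb; have [a1 a2] := gspin_invP ha; have [b1 b2] := gspin_invP hb.
have [c1 c2] := gspin_invP (E7R_comp ha hb).
apply: (gspin_inj c1 (Sp3_mul a1 b1)); apply: etrans c2 _.
exact: etrans (esym (f_equal2 (fun f g : 'End(freud) => (f \o g)%VF) a2 b2)) (esym (gspinM a1 b1)).
Qed.

(** By the block form of [psi], the left three columns determine the quaternionic matrix. *)
Definition quat_cols (L : 'M[C]_(3 + 3, 3)) : 'M[quat R]_3 :=
  \matrix_(i, j) zquat (L (lshift 3 i) j) (- cj (L (rshift 3 i) j)).

Fact quat_cols_psi A : quat_cols (lsubmx (psi A)) = A.
Proof. by rewrite -[RHS]psiK; apply/matrixP => i j; rewrite !mxE. Qed.

Fact mxsmooth_cols (V : normedModType R) (U : set V) (L : V -> 'M[C]_(3 + 3, 3)) : open U ->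
  mxsmooth U L ->
  mxsmooth U (fun x => mz (quat_cols (L x))) /\ mxsmooth U (fun x => mw (quat_cols (L x))).
Proof.
move=> Uop sL.
have ez M i j : mz (quat_cols M) i j = M (lshift 3 i) j by rewrite !mxE qz_zquat.
have ew M i j : mw (quat_cols M) i j = - cj (M (rshift 3 i) j) by rewrite !mxE qw_zquat.
split=> i j.
  by apply: (csmooth_ext Uop _ (sL (lshift 3 i) j)) => x _; exact: esym (ez _ _ _).
apply: (csmooth_ext Uop _ (csmoothN Uop (csmooth_conj Uop (sL (rshift 3 i) j)))) => x _.
exact: esym (ew _ _ _).
Qed.

Fact smooth_quat_coord (V : normedModType R) (U : set V) (N : V -> 'M[quat R]_3) : open U ->
  mxsmooth U (fun x => mz (N x)) -> mxsmooth U (fun x => mw (N x)) ->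
  smooth_on U (fun x => quat_coord (N x)).
Proof.
move=> Uop sz sw; apply: (smooth_on_quad Uop) => i j.
- by apply: (smooth_on_ext Uop _ (sz i j).1) => x _; rewrite !mxE.
- by apply: (smooth_on_ext Uop _ (sz i j).2) => x _; rewrite !mxE.
- by apply: (smooth_on_ext Uop _ (sw i j).1) => x _; rewrite !mxE.
- by apply: (smooth_on_ext Uop _ (sw i j).2) => x _; rewrite !mxE.
Qed.

Section AtPoint.
Variable A0 : 'M[quat R]_3.
Hypothesis hA0 : Sp3 A0.

(** Composition with the inverse of [gspin A0] moves A0 to 1, where the denominator does not vanish;
    right multiplication by A0 undoes this in [rel_recE]. *)
Definition end_rel (x : EV) P : freud := end_act x (gspin (quat_adj A0) P).
Definition rel_den (x : EV) : C := col_den (tp0 (end_rel x)) (tpt (end_rel x)).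
Definition rel_rec (x : EV) := col_rec (tp0 (end_rel x)) (tpt (end_rel x)).

Fact end_relE A : Sp3 A ->
  end_rel (end_coord (gspin A)) = (fun P => gact (psi (A *m quat_adj A0)) P).
Proof.
move=> hA; apply: funext => P.
apply: etrans (end_coordK _ _) _.
exact: esym (etrans (congr1 (fun f : 'End(freud) => f P) (gspinM hA (Sp3_inv hA0))) (comp_lfunE _ _ P)).
Qed.

Fact rel_recE A : Sp3 A -> rel_den (end_coord (gspin A)) != 0 ->
  quat_cols (rel_rec (end_coord (gspin A))) *m A0 = A.
Proof.
move=> hA d0; have e := end_relE hA.
have hW := psi_symp (Sp3_mul hA (Sp3_inv hA0)).
have d1 := eq_ind _ (fun p => is_true (col_den (tp0 p) (tpt p) != 0)) d0 _ e.
have r := etrans (f_equal (fun p => col_rec (tp0 p) (tpt p)) e) (col_recE hW d1).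
have q := etrans (congr1 quat_cols r) (quat_cols_psi _).
apply: etrans (congr1 (fun M => M *m A0) q) _.
by rewrite -mulmxA quat_adj_mul // mulmx1.
Qed.

Fact rel_den1 : rel_den (end_coord (gspin A0)) != 0.
Proof.
have e := end_relE hA0.
have e1 : psi (A0 *m quat_adj A0) = 1%:M := etrans (congr1 (@psi R) hA0) (psi1 R).
have e2 : end_rel (end_coord (gspin A0)) = (fun P => gact 1%:M P) :=
  etrans e (congr1 (fun (W : 'M[C]_(3 + 3)) P => gact W P) e1).
exact (eq_ind_r (fun p : freud -> freud => is_true (col_den (tp0 p) (tpt p) != 0)) (col_den1 R) e2).
Qed.

Fact csmooth_rel_den (U : set EV) : open U -> csmooth U rel_den.
Proof. by move=> Uop; apply: (csmooth_den Uop) => [|j]; exact: tsmooth_end_act. Qed.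

Fact mxsmooth_rel_rec (U : set EV) : open U -> (forall x, U x -> rel_den x != 0) -> mxsmooth U rel_rec.
Proof.
by move=> Uop d0; apply: (mxsmooth_rec Uop) => [|j|//]; exact: tsmooth_end_act.
Qed.

Fact mxsmooth_quat_mul (V : normedModType R) (U : set V) (N : V -> 'M[quat R]_3) : open U ->
  mxsmooth U (fun x => mz (N x)) -> mxsmooth U (fun x => mw (N x)) ->
  mxsmooth U (fun x => mz (N x *m A0)) /\ mxsmooth U (fun x => mw (N x *m A0)).
Proof.
move=> Uop sz sw.
have cst (M : 'M[C]_3) : mxsmooth U (fun=> M) by exact: mxsmooth_cst.
have s1 M := mxsmoothM Uop sz (cst M); have s2 M := mxsmoothM Uop sw (cst M).
split=> i j.
  have := csmoothD Uop (s1 (mz A0) i j) (csmoothN Uop (s2 (map_mx cj (mw A0)) i j)).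
  by apply: (csmooth_ext Uop) => x _; rewrite mzM [RHS]mxE [X in _ = _ + X]mxE.
have := csmoothD Uop (s1 (mw A0) i j) (s2 (map_mx cj (mz A0)) i j).
by apply: (csmooth_ext Uop) => x _; rewrite mwM [RHS]mxE.
Qed.

End AtPoint.

Lemma smooth_gspin_inv : smooth_map (@end_coord R) (@quat_coord R) (@E7R R) gspin_inv.
Proof.
move=> alpha0 h0; have [hA0 eA0] := gspin_invP h0; move: (gspin_inv alpha0) hA0 eA0 => A0 hA0 eA0.
pose U := [set x | rel_den A0 x != 0].
have Uop : open U := open_neq0 (csmooth_rel_den A0 openT).
exists U, (fun x => quat_coord (quat_cols (rel_rec A0 x) *m A0)); split=> //.
- exact: eq_ind _ (fun b => is_true (rel_den A0 (end_coord b) != 0)) (rel_den1 hA0) _ eA0.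
- have sr := mxsmooth_rel_rec Uop (fun x (Ux : U x) => Ux).
  have [sz sw] := mxsmooth_cols Uop sr; have [tz tw] := mxsmooth_quat_mul A0 Uop sz sw.
  exact: smooth_quat_coord Uop tz tw.
- move=> b hb Ub; have [hB eB] := gspin_invP hb.
  have Ub' := eq_ind_r (fun b => is_true (rel_den A0 (end_coord b) != 0)) Ub eB.
  have r := rel_recE hA0 hB Ub'.
  exact: etrans (congr1 (fun b => quat_coord (quat_cols (rel_rec A0 (end_coord b)) *m A0)) (esym eB))
    (congr1 (@quat_coord R) r).
Qed.

End FinalSmooth.

Theorem theorem5p16 (R : realType) :
  lie_group_isomorphic
    (fun alpha beta : 'End(freud R) => (alpha \o beta)%VF)
    (@end_coord R) (@E7R R)
    (fun A B : 'M[quat R]_3 => A *m B)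
    (@quat_coord R) (@Sp3 R).
Proof.
exists (@gspin_inv R), (@gspin R); split.
- exact: gspin_invP.
- by move=> A hA; split; [exact: gspin_E7R|exact: gspinK].
- exact: gspin_invM.
- exact: smooth_gspin_inv.
- exact: smooth_gspin.
Qed.
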